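(* Let $a>0$ be fixed and known, and let $X$ be a random variable with probability density $f_\lambda(x)=\frac{\lambda^a}{\Gamma(a)}x^{a-1}e^{-\lambda x}$, $x>0$, where $\lambda>0$ is an unknown parameter. Let $h:(0,\infty)\to\mathbb{R}$ be a given parametric function. Then the UMVUE $u(X)$ of $h(\lambda)$ exists with $u\in L^2_0$ if and only if the following two conditions are satisfied: (1) The function $h$ can be extended to a holomorphic function in $\mathbb{C}^+$; and (2) For any $\lambda>0$, $$\sum_{n=0}^\infty \beta_n(\lambda)^2<\infty,\qquad\text{where}\qquad \beta_n(\lambda)=\frac{(-1)^n}{\sqrt{n!\,[a]_n}}\left(\lambda\frac{\mathrm{d}^n}{\mathrm{d}\lambda^n}\Big[\lambda^{n-1}h(\lambda)\Big]\right),\quad n=0,1,2,\ldots$$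
   Context: $\mathbb{C}^+=\{\lambda\in\mathbb{C}:\Re(\lambda)>0\}$. $[a]_n=\prod_{j=0}^{n-1}(a+j)=\Gamma(a+n)/\Gamma(a)$ is the ascending factorial (Pochhammer symbol), with $[a]_0=1$. For $\lambda>0$, $L^2(\lambda)$ is the space of (measurable) functions $u:(0,\infty)\to\mathbb{R}$ with $\int_0^\infty x^{a-1}e^{-\lambda x}u(x)^2\,\mathrm{d}x<\infty$, and $L^2_0=\bigcap_{\lambda>0}L^2(\lambda)$. For measurable $\psi$, $\mathbb{E}_\lambda\psi(X)=\int_0^\infty f_\lambda(x)\psi(x)\,\mathrm{d}x$, and $\operatorname{Var}_\lambda$ denotes the corresponding variance. An estimator is a measurable function $T=T(X)$ of $X$ (not depending on $\lambda$); it is unbiased for $h(\lambda)$ if $\mathbb{E}_\lambda T=h(\lambda)$ for all $\lambda>0$. The UMVUE (uniformly minimum variance unbiased estimator) of $h(\lambda)$ is an estimator $u(X)$ such that $\mathbb{E}_\lambda u(X)=h(\lambda)$ for all $\lambda>0$, $\operatorname{Var}_\lambda u(X)<\infty$ for all $\lambda>0$, and $\operatorname{Var}_\lambda u(X)\le\operatorname{Var}_\lambda T$ for every unbiased estimator $T$ of $h(\lambda)$ and every $\lambda>0$. *)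

(* Defs.v *)
From HB Require Import structures.
From mathcomp Require Import all_boot all_order all_algebra.
From mathcomp Require Import complex.
From mathcomp Require Import all_classical all_reals all_analysis.

Set Implicit Arguments.
Unset Strict Implicit.
Unset Printing Implicit Defensive.

Import Order.TTheory GRing.Theory Num.Theory.
Import numFieldNormedType.Exports.

Local Open Scope classical_set_scope.
Local Open Scope ring_scope.

(* Functions on (0,oo) are rendered as total functions [R -> R]; every
   definition below only depends on their values on [`]0, +oo[]. Measurability
   is with respect to the Borel sigma-algebra, the one on which
   [lebesgue_measure] is defined. *)

Definition Gamma (R : realType) (a : R) : R :=
  \int[lebesgue_measure]_(x in `]0, +oo[) (x `^ (a - 1) * expR (- x)).

Definition gamma_density (R : realType) (a lambda x : R) : R :=
  lambda `^ a / Gamma a * x `^ (a - 1) * expR (- (lambda * x)).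

(* Values are in [\bar R]. When the positive and the negative part of psi both
   have infinite expectation the value is [-oo] (as [+oo - +oo = -oo]), so, for
   measurable psi, [expect a lambda psi = c%:E] implies integrability. *)
Definition expect (R : realType) (a lambda : R) (psi : R -> R) : \bar R :=
  (\int[lebesgue_measure]_(x in `]0%R, +oo[)
     (gamma_density a lambda x * psi x)%:E)%E.

(* Only meaningful when the expectation of psi is finite. *)
Definition var (R : realType) (a lambda : R) (psi : R -> R) : \bar R :=
  expect a lambda (fun x => (psi x - fine (expect a lambda psi)) ^+ 2).

Definition L2 (R : realType) (a lambda : R) : set (R -> R) :=
  [set u : R -> R | measurable_fun (`]0, +oo[ : set R) u /\
    (\int[lebesgue_measure]_(x in `]0%R, +oo[)
       (x `^ (a - 1) * expR (- (lambda * x)) * u x ^+ 2)%:E < +oo)%E].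

Definition L20 (R : realType) (a : R) : set (R -> R) :=
  \bigcap_(lambda in [set l : R | 0 < l]) L2 a lambda.

Definition unbiased (R : realType) (a : R) (h T : R -> R) : Prop :=
  measurable_fun (`]0, +oo[ : set R) T /\
  forall lambda, 0 < lambda -> expect a lambda T = (h lambda)%:E.

Definition UMVUE (R : realType) (a : R) (h u : R -> R) : Prop :=
  [/\ unbiased a h u,
      forall lambda, 0 < lambda -> (var a lambda u < +oo)%E &
      forall T, unbiased a h T ->
        forall lambda, 0 < lambda -> (var a lambda u <= var a lambda T)%E].

(* The derivative along 1 of a function on the field [R[i]], seen as a normed
   module over itself, is the usual complex derivative. *)
Definition holomorphic_on (R : realType)
    (D : set R[i]) (f : R[i] -> R[i]) : Prop :=
  let C : numFieldType := R[i] in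
  forall z, D z -> derivable (f : C^o -> C^o) z 1.

Definition right_half_plane (R : realType) : set R[i] :=
  [set z | 0 < complex.Re z].

Definition pochhammer (R : realType) (a : R) (n : nat) : R :=
  \prod_(0 <= j < n) (a + j%:R).

(* The exponent [n%:Z - 1] is an integer: it is -1 for n = 0. *)
Definition beta_coef (R : realType) (a : R) (h : R -> R) (n : nat)
    (lambda : R) : R :=
  (-1) ^+ n / Num.sqrt (n`!%:R * pochhammer a n) *
  (lambda * derive1n n (fun l : R => l ^ (n%:Z - 1) * h l) lambda).

(* Main.v *)
Require Import Defs.
From mathcomp Require Import all_boot all_order all_algebra.
From mathcomp Require Import complex.
From mathcomp Require Import all_classical all_reals all_analysis.
From mathcomp Require Import measurable_realfun.
From mathcomp Require Import ring lra zify.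

Set Implicit Arguments.
Unset Strict Implicit.
Unset Printing Implicit Defensive.

Import Order.TTheory GRing.Theory Num.Theory.
Import numFieldNormedType.Exports.
Import complex.ComplexField.Normc.

Local Open Scope classical_set_scope.
Local Open Scope ring_scope.
Local Open Scope complex_scope.

(** Fix [l > 0] and write [f_m] for the gamma density with parameter [m]. The
    rescaled Laguerre polynomials [q_n] are orthogonal in [L2(f_l)], with norm
    [sqrt (n! / [a]_n)], and satisfy [E_m q_n = (1 - l / m)^n]
    ([laguerre_orthogonality], [laguerre_gamma_density]). For [m > l / 2] the
    likelihood ratio [f_m / f_l] belongs to [L2(f_l)]; with [t = 1 - l / m] its
    squared norm is [(1 - t^2)^(-a)], and the binomial series says that this
    norm is exhausted by the Fourier coefficients on the [q_n]. Hence every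
    [u] in [L2(f_l)], with Fourier coefficients [c_n] on the normalised [q_n],
    satisfies
    [[
      E_m u = sum_n sqrt ([a]_n / n!) c_n t^n,   m = l / (1 - t), |t| < 1,
    ]]
    which is the lemma [expansion]. If [u] is unbiased for [h], this is the
    Taylor series of [h (l / (1 - t))] at [t = 0], and a computation with power
    series ([derive1n_moebius]) identifies [beta_n(l)] with [(-1)^n c_n].

    For the direct implication, Bessel's inequality gives the summability of
    [beta_n(l)^2], and the expansions centred at the various [l], each of which
    is holomorphic on [Re z > l / 2], are glued into a holomorphic extension of
    [h] ([holomorphic_extension]).

    For the converse, a holomorphic [h] has a Taylor expansion in [t] on the
    whole unit disc, because [t |-> l / (1 - t)] maps the disc into the right
    half-plane. By square summability and the Riesz-Fischer theorem there is
    [u_l] in [L2(f_l)] with the required Fourier coefficients, so that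
    [E_m u_l = h m] for all [m > l / 2] ([local_estimator]). By uniqueness of
    Laplace transforms
    ([laplace_unique], [expectation_unique]) all the [u_l] are equal almost
    everywhere; their common value is in [L2] for every parameter and unbiased
    for [h]. The same uniqueness makes it almost everywhere equal to any other
    unbiased estimator, so its variance is minimal.

    The complex analysis that this uses, namely that a complex differentiable
    function on a disc is the sum of a power series ([taylor]), is derived from
    Goursat's theorem on rectangles: in the coordinate [log z], circles become
    vertical segments and annuli become rectangles. *)

(** * Complex differentiability and continuity *)

Section ComplexDifferentiability.
Variable R : realType.
Local Notation C := R[i].
Implicit Types (z w k : C) (f g : C -> C).

Lemma normcE z : `|z| = (normc z)%:C.
Proof. by []. Qed.

Lemma normc_ge0 z : 0 <= normc z.
Proof. by case: z => a b /=; exact: sqrtr_ge0. Qed.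

Lemma normc_gt0 z : (0 < normc z) = (z != 0).
Proof. by rewrite -[RHS]normr_gt0 normcE ltcE /= eqxx. Qed.

Lemma normc_real (x : R) : normc x%:C = `|x|.
Proof. by rewrite /= expr0n /= addr0 sqrtr_sqr. Qed.

Lemma normc_i : normc ('i : C) = 1.
Proof. by rewrite /= expr0n expr1n add0r sqrtr1. Qed.

Lemma normcX z n : normc (z ^+ n) = normc z ^+ n.
Proof. by elim: n => [|n IH]; rewrite ?expr0 ?normc1 // !exprS normcM IH. Qed.

Lemma normcB z w : normc (z - w) = normc (w - z).
Proof. by rewrite -normcN opprB. Qed.

Lemma Re_le_normc z : `|complex.Re z| <= normc z.
Proof.
case: z => a b /=; rewrite -sqrtr_sqr ler_wsqrtr// lerDl; exact: sqr_ge0.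
Qed.

Lemma Im_le_normc z : `|complex.Im z| <= normc z.
Proof.
case: z => a b /=; rewrite -sqrtr_sqr ler_wsqrtr// lerDr; exact: sqr_ge0.
Qed.

Lemma normc_le_ReIm z : normc z <= `|complex.Re z| + `|complex.Im z|.
Proof.
case: z => a b /=.
rewrite -[leRHS]ger0_norm ?addr_ge0// -sqrtr_sqr ler_wsqrtr// sqrrD.
rewrite !real_normK ?num_real// addrAC lerDl mulrn_wge0//; exact: mulr_ge0.
Qed.

Lemma pos_complex (e : C) : 0 < e -> exists2 r : R, 0 < r & e = r%:C.
Proof. by case: e => a b; rewrite ltcE /= => /andP[/eqP -> a0]; exists a. Qed.

(** The bridge between the complex derivative as a limit along a filter on the
    field [R[i]] and the estimate with real radii that integral bounds use. *)
Lemma differentiable_epsP f (z : C^o) :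
  differentiable (f : C^o -> C^o) z <->
  exists d, forall e : R, 0 < e -> exists2 r : R, 0 < r & forall k,
    normc k < r -> normc (f (z + k) - f z - d * k) <= e * normc k.
Proof.
rewrite -derivable1_diffP; split.
- move=> df; exists ('D_1 (f : C^o -> C^o) z) => e e0.
  have ec0 : 0 < e%:C :> C by rewrite ltcR.
  move: (df) => /cvgrPdist_le /(_ _ ec0).
  rewrite -/('D_1 (f : C^o -> C^o) z).
  case/nbhs_ballP => r /= /pos_complex[s s0 ->] H; exists s => // k ks.
  have [->|k0] := eqVneq k 0.
    by rewrite addr0 mulr0 subr0 subrr normc0 mulr0.
  have := H k; rewrite /ball /= sub0r normrN normcE ltcR => /(_ ks k0).
  rewrite /= normcE lecR /GRing.scale/= mulr1 => {}H.
  have -> : f (z + k) - f z - 'D_1 (f : C^o -> C^o) z * k =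
      (k^-1 * (f (k + z) - f z) - 'D_1 (f : C^o -> C^o) z) * k.
    by rewrite mulrBl mulrAC mulVf// mul1r (addrC z).
  by rewrite normcM ler_wpM2r ?normc_ge0// normcB.
- move=> [d H]; apply/cvg_ex; exists d; apply/cvgrPdist_le => _ /pos_complex[e e0 ->].
  have [r r0 {}H] := H e e0.
  apply/nbhs_ballP; exists r%:C => /=; first by rewrite ltcR.
  move=> k; rewrite /ball /= sub0r normrN normcE ltcR => /H {}H k0.
  rewrite normcE lecR -(ler_pM2r (_ : 0 < normc k)) ?normc_gt0//.
  rewrite normcB -normcM.
  suff -> : (k^-1 *: (f (k *: 1 + z) - f z) - d) * k =
      f (z + k) - f z - d * k by [].
  by rewrite /GRing.scale/= mulr1 mulrBl mulrAC mulVf// mul1r (addrC z).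
Qed.

End ComplexDifferentiability.

Section ComplexContinuity.
Variable R : realType.
Local Notation C := R[i].
Implicit Types (z w k : C) (f g : C -> C).

(** Continuity with real radii, matching [differentiable_epsP]. *)
Definition ccontinuous f z := forall e : R, 0 < e ->
  exists2 r : R, 0 < r & forall k, normc k < r -> normc (f (z + k) - f z) < e.

Lemma differentiable_ccontinuous f (z : C^o) :
  differentiable (f : C^o -> C^o) z -> ccontinuous f z.
Proof.
case/differentiable_epsP => d H e e0.
have [r r0 {}H] := H 1 ltr01.
have d1 : 0 < 1 + normc d by rewrite ltr_pwDl// normc_ge0.
exists (Num.min r (e / (1 + normc d))); first by rewrite lt_min r0 divr_gt0.
move=> k; rewrite lt_min ltr_pdivlMr// => /andP[kr ke].
rewrite -(subrK (d * k) (f (z + k) - f z)).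
rewrite (le_lt_trans (le_normcD _ _))//.
rewrite (le_lt_trans _ ke)// mulrDr mulr1 normcM [normc d * _]mulrC lerD2r.
by rewrite -[leRHS]mul1r H.
Qed.

Lemma ccontinuous_cst (c : C) z : ccontinuous (fun=> c) z.
Proof. by move=> e e0; exists 1 => // k _; rewrite subrr normc0. Qed.

Lemma ccontinuousB f g z :
  ccontinuous f z -> ccontinuous g z -> ccontinuous (fun z => f z - g z) z.
Proof.
move=> cf cg e e0.
have [r r0 Hf] := cf (e / 2) (divr_gt0 e0 (ltr0n _ 2)).
have [s s0 Hg] := cg (e / 2) (divr_gt0 e0 (ltr0n _ 2)).
exists (Num.min r s); first by rewrite lt_min r0.
move=> k; rewrite lt_min => /andP[/Hf{}Hf /Hg{}Hg].
have -> : f (z + k) - g (z + k) - (f z - g z) =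
  (f (z + k) - f z) - (g (z + k) - g z) by ring.
by rewrite (le_lt_trans (le_normcD _ _))// normcN (splitr e) ltrD.
Qed.

Lemma ccontinuousMl (c : C) f z :
  ccontinuous f z -> ccontinuous (fun z => c * f z) z.
Proof.
move=> cf e e0; have c1 : 0 < 1 + normc c by rewrite ltr_pwDl// normc_ge0.
have [r r0 H] := cf (e / (1 + normc c)) (divr_gt0 e0 c1).
exists r => // k /H; rewrite -mulrBr normcM ltr_pdivlMr// => {}H.
by rewrite (le_lt_trans _ H)// mulrDr mulr1 ler_wpDl ?normc_ge0// mulrC.
Qed.

Lemma ccontinuous_id z : ccontinuous id z.
Proof. by move=> e e0; exists e => // k; rewrite addrAC subrr add0r. Qed.

End ComplexContinuity.

(** * Integrals of complex functions along segments *)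

Lemma integrable_mulrl d (T : measurableType d) (R : realType)
    (mu : {measure set T -> \bar R}) (D : set T) (h : T -> R) (r : R) :
  measurable D -> mu.-integrable D (EFin \o h) ->
  mu.-integrable D (EFin \o (fun x => r * h x)).
Proof.
by move=> mD ih; apply: eq_integrable (integrableZl mD r ih) => // x _ /=.
Qed.

Section ComplexIntegral.
Variable R : realType.
Local Notation C := R[i].
Local Notation mu := (@lebesgue_measure R).
Implicit Types (F G : R -> C) (f : C -> C) (a b x y : R).

(** Componentwise, so that real Lebesgue integrals apply. *)
Definition cint a b F : C :=
  (\int[mu]_(x in `[a, b]) complex.Re (F x)) +i*
  (\int[mu]_(x in `[a, b]) complex.Im (F x)).

Definition cintegrable a b F :=
  mu.-integrable `[a, b] (EFin \o (fun x => complex.Re (F x))) /\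
  mu.-integrable `[a, b] (EFin \o (fun x => complex.Im (F x))).

Lemma eq_cint a b F G : (forall x, a <= x <= b -> F x = G x) ->
  cint a b F = cint a b G.
Proof.
move=> FG; congr Complex; apply: eq_Rintegral => x; rewrite inE /= in_itv /=;
  by move=> /FG ->.
Qed.

Lemma cintegrableB a b F G : cintegrable a b F -> cintegrable a b G ->
  cintegrable a b (fun x => F x - G x).
Proof.
move=> [rF iF] [rG iG]; split.
  apply: eq_integrable (integrableB _ rF rG) => // y _ /=.
  by rewrite -EFinB; case: (F y) (G y) => ? ? [].
apply: eq_integrable (integrableB _ iF iG) => // y _ /=.
by rewrite -EFinB; case: (F y) (G y) => ? ? [].
Qed.

Lemma cintB a b F G : cintegrable a b F -> cintegrable a b G ->
  cint a b (fun x => F x - G x) = cint a b F - cint a b G.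
Proof.
move=> [rF iF] [rG iG]; rewrite /cint; simpc.
by rewrite -!RintegralB//; congr Complex; apply: eq_Rintegral => x _;
  case: (F x) (G x) => p q [p' q'].
Qed.

Lemma cintZ a b (c : C) F : cintegrable a b F ->
  cint a b (fun x => c * F x) = c * cint a b F.
Proof.
case: c => p q [rF iF]; rewrite /cint; simpc.
rewrite -!RintegralZl// -RintegralB -?RintegralD//;
  try exact: integrable_mulrl.
by congr Complex; apply: eq_Rintegral => x _; case: (F x).
Qed.

Lemma Rintegral_cst_itv a b (r : R) : a <= b ->
  \int[mu]_(_ in `[a, b]) r = (b - a) * r.
Proof.
move=> ab; rewrite Rintegral_cst//= lebesgue_measure_itv/= lte_fin.
case: ltgtP ab => [ab _|//|->]; first by rewrite mulrC.
by rewrite subrr mul0r mulr0.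
Qed.

Lemma cint_cst a b (c : C) : a <= b -> cint a b (fun=> c) = (b - a)%:C * c.
Proof.
by move=> ab; case: c => p q; rewrite /cint !Rintegral_cst_itv//; simpc.
Qed.

Lemma cint_cat a b c F : a <= b -> b <= c -> cintegrable a c F ->
  cint a c F = cint a b F + cint b c F.
Proof.
move=> ab bc [rF iF]; rewrite /cint; simpc.
have H (h : R -> R) : mu.-integrable `[a, c] (EFin \o h) ->
    \int[mu]_(x in `[a, c]) h x =
    \int[mu]_(x in `[a, b]) h x + \int[mu]_(x in `[b, c]) h x.
  move=> ih; rewrite -[X in _ = _ + X]Rintegral_itv_obnd_cbnd; last first.
    by apply: integrableS ih => //; apply: subset_itvr; rewrite bnd_simp.
  by rewrite -(Rintegral_itvB ih) ?bnd_simp// addrC subrK.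
by rewrite (H _ rF) (H _ iF).
Qed.

(** The factor [2] comes from bounding the real and the imaginary part
    separately. *)
Lemma cint_bound a b F (M : R) : a <= b -> cintegrable a b F ->
  (forall x, a <= x <= b -> normc (F x) <= M) ->
  normc (cint a b F) <= 2 * M * (b - a).
Proof.
move=> ab [rF iF] FM.
have H (h : R -> R) : mu.-integrable `[a, b] (EFin \o h) ->
    (forall x, `|h x| <= normc (F x)) ->
    `|\int[mu]_(x in `[a, b]) h x| <= M * (b - a).
  move=> ih hF; rewrite (le_trans (le_normr_Rintegral _ ih))//.
  rewrite mulrC -Rintegral_cst_itv//; apply: le_Rintegral => //.
  - exact: (integrable_norm ih).
  - apply/integrableP; split; first exact: measurable_cst.
    under eq_integral do rewrite /=.
    rewrite integral_cst//= lebesgue_measure_itv/= -EFinB.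
    by case: ifP => _; rewrite ?mule0 ?ltry// -EFinM ltry.
  - by move=> x; rewrite /= in_itv /= => /FM; exact: le_trans.
rewrite (le_trans (normc_le_ReIm _))// -mulrA mulr2n mulrDl mul1r lerD//=.
  by apply: H => // x; exact: Re_le_normc.
by apply: H => // x; exact: Im_le_normc.
Qed.

Lemma continuous_cintegrable a b F :
  (forall x, a <= x <= b -> {for x, continuous (fun x => complex.Re (F x))}) ->
  (forall x, a <= x <= b -> {for x, continuous (fun x => complex.Im (F x))}) ->
  cintegrable a b F.
Proof.
move=> cr ci; split; apply: continuous_compact_integrable;
  try exact: segment_compact; apply/continuous_in_subspaceT => x;
  rewrite inE /= in_itv /= => xab; [exact: cr|exact: ci].
Qed.

(** The horizontal and the vertical direction at once: [p] is [x |-> x] or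
    [x |-> 'i * x]. *)
Lemma ccontinuous_line (p : R -> C) f x : {morph p : x y / x + y >-> x + y} ->
  (forall x, normc (p x) = `|x|) -> forall c, ccontinuous f (p x + c) ->
  {for x, continuous (fun x => complex.Re (f (p x + c)))} /\
  {for x, continuous (fun x => complex.Im (f (p x + c)))}.
Proof.
move=> pD pn c cf.
have H e : 0 < e -> \forall t \near x, normc (f (p x + c) - f (p t + c)) < e.
  move=> e0; have [r r0 {}cf] := cf e e0.
  apply/nbhs_ballP; exists r => //= t xt.
  rewrite normcB; have -> : p t + c = p x + c + p (t - x).
    by rewrite addrAC -pD addrCA subrr addr0.
  by apply: cf; rewrite pn distrC.
split; apply/cvgrPdist_lt => e /H; apply: filterS => t; apply: le_lt_trans.
  apply: le_trans (Re_le_normc _).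
  by case: (f (p x + c)) (f (p t + c)) => ? ? [].
apply: le_trans (Im_le_normc _).
by case: (f (p x + c)) (f (p t + c)) => ? ? [].
Qed.

Lemma ccontinuous_horizontal f x y : ccontinuous f (x +i* y) ->
  {for x, continuous (fun x => complex.Re (f (x +i* y)))} /\
  {for x, continuous (fun x => complex.Im (f (x +i* y)))}.
Proof.
move=> cf; have := @ccontinuous_line (fun x => x%:C) f x _ _ (0 +i* y).
have E u : u%:C + 0 +i* y = u +i* y by simpc.
rewrite E; under [X in {for _, continuous X}]eq_fun do rewrite E.
under [X in _ /\ {for _, continuous X}]eq_fun do rewrite E.
by apply => //; [move=> u v; simpc|exact: normc_real].
Qed.

Lemma ccontinuous_vertical f x y : ccontinuous f (x +i* y) ->
  {for y, continuous (fun y => complex.Re (f (x +i* y)))} /\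
  {for y, continuous (fun y => complex.Im (f (x +i* y)))}.
Proof.
move=> cf; have := @ccontinuous_line (fun y => 0 +i* y) f y _ _ x%:C.
have E u : 0 +i* u + x%:C = x +i* u by simpc.
rewrite E; under [X in {for _, continuous X}]eq_fun do rewrite E.
under [X in _ /\ {for _, continuous X}]eq_fun do rewrite E.
apply => //; [by move=> u v; simpc|move=> u /=].
by rewrite expr0n add0r sqrtr_sqr.
Qed.

End ComplexIntegral.

(** * Rules of complex differentiation *)

Section ComplexRules.
Variable R : realType.
Local Notation C := R[i].
Local Notation cdiff f z := (differentiable (f : C^o -> C^o) (z : C^o)).
Implicit Types (z : C) (f g : C -> C).

Lemma cdiff_id z : cdiff (fun z => z) z.
Proof. by apply/derivable1_diffP; exact: (@derivable_id _ C^o). Qed.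

Lemma cdiff_cst (c : C) z : cdiff (fun=> c) z.
Proof. exact: (@differentiable_cst _ C^o C^o). Qed.

Lemma cdiffB f g z : cdiff f z -> cdiff g z -> cdiff (fun z => f z - g z) z.
Proof. exact: (@differentiableB _ C^o C^o). Qed.

Lemma cdiffD f g z : cdiff f z -> cdiff g z -> cdiff (fun z => f z + g z) z.
Proof. exact: (@differentiableD _ C^o C^o). Qed.

Lemma cdiffM f g z : cdiff f z -> cdiff g z -> cdiff (fun z => f z * g z) z.
Proof. exact: (@differentiableM _ C^o). Qed.

Lemma cdiffV f z : f z != 0 -> cdiff f z -> cdiff (fun z => (f z)^-1) z.
Proof. by move=> f0 df; exact: (@differentiableV _ C^o). Qed.

Lemma cdiffX f n z : cdiff f z -> cdiff (fun z => f z ^+ n) z.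
Proof.
move=> df; elim: n => [|n IH]; first exact: cdiff_cst.
have -> : (fun z => f z ^+ n.+1) = (fun z => f z * f z ^+ n).
  by apply/funext => w; rewrite exprS.
exact: cdiffM.
Qed.

Lemma cdiff_comp f g z : cdiff f z -> cdiff g (f z) -> cdiff (fun z => g (f z)) z.
Proof. exact: (@differentiable_comp _ C^o C^o C^o). Qed.

Lemma near_eq_cdiff f g (r : R) z : 0 < r ->
  (forall k, normc k < r -> f (z + k) = g (z + k)) -> cdiff f z -> cdiff g z.
Proof.
move=> r0 fg /differentiable_epsP[d H]; apply/differentiable_epsP; exists d.
move=> e /H[s s0 {}H]; exists (Num.min r s); first by rewrite lt_min r0.
move=> k; rewrite lt_min => /andP[kr /H]; rewrite fg//.
by have := fg 0; rewrite normc0 addr0 => ->.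
Qed.

End ComplexRules.

Local Arguments normc : simpl never.

(** * Goursat's theorem on rectangles *)

Section Goursat.
Variable R : realType.
Local Notation C := R[i].
Implicit Types (f g : C -> C) (x y l m : R).

Definition hint f x l y : C := cint x (x + l) (fun t => f (t +i* y)).
Definition vint f x y m : C := cint y (y + m) (fun t => f (x +i* t)).

(** The integral of [f] along the positively oriented boundary of the rectangle
    with lower left corner [x +i* y], width [l] and height [m]. *)
Definition rect_int f x y l m : C :=
  hint f x l y - hint f x l (y + m) + 'i * (vint f (x + l) y m - vint f x y m).

Definition in_rect x y l m : set C := [set z |
  x <= complex.Re z <= x + l /\ y <= complex.Im z <= y + m].

Definition ccontinuous_on (D : set C) f := forall z, D z -> ccontinuous f z.

Lemma in_rectP x y l m u v : x <= u <= x + l -> y <= v <= y + m ->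
  in_rect x y l m (u +i* v).
Proof. by []. Qed.

Lemma hintegrable f x y l m v : ccontinuous_on (in_rect x y l m) f ->
  y <= v <= y + m -> cintegrable x (x + l) (fun t => f (t +i* v)).
Proof.
move=> cf yv; apply: continuous_cintegrable => t xt;
  by have [] := ccontinuous_horizontal (cf _ (in_rectP xt yv)).
Qed.

Lemma vintegrable f x y l m u : ccontinuous_on (in_rect x y l m) f ->
  x <= u <= x + l -> cintegrable y (y + m) (fun t => f (u +i* t)).
Proof.
move=> cf xu; apply: continuous_cintegrable => t yt;
  by have [] := ccontinuous_vertical (cf _ (in_rectP xu yt)).
Qed.

Lemma rect_intB f g x y l m : 0 <= l -> 0 <= m ->
  ccontinuous_on (in_rect x y l m) f -> ccontinuous_on (in_rect x y l m) g ->
  rect_int (fun z => f z - g z) x y l m = rect_int f x y l m - rect_int g x y l m.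
Proof.
move=> l0 m0 cf cg; rewrite /rect_int /hint /vint.
have y1 : y <= y <= y + m by rewrite lexx lerDl.
have y2 : y <= y + m <= y + m by rewrite lexx lerDl m0.
have x1 : x <= x <= x + l by rewrite lexx lerDl.
have x2 : x <= x + l <= x + l by rewrite lexx lerDl l0.
rewrite !cintB; [ring|..]; by [apply: hintegrable cf _|apply: hintegrable cg _|
  apply: vintegrable cf _|apply: vintegrable cg _].
Qed.

Lemma rect_int_affine (c d : C) x y l m : 0 <= l -> 0 <= m ->
  rect_int (fun z => c + d * z) x y l m = 0.
Proof.
move=> l0 m0; rewrite /rect_int /hint /vint.
have cc (b a : C) z : ccontinuous (fun z => a * z - b) z.
  apply: ccontinuousB; last exact: ccontinuous_cst.
  by apply: ccontinuousMl; exact: ccontinuous_id.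
have ih b a v : cintegrable x (x + l) (fun t => a * (t +i* v) - b).
  by apply: (@hintegrable (fun z => a * z - b) x v l 0 v) => [z _|]; rewrite ?addr0 ?lexx//; exact: cc.
have iv b a u : cintegrable y (y + m) (fun t => a * (u +i* t) - b).
  by apply: (@vintegrable (fun z => a * z - b) u y 0 m u) => [z _|]; rewrite ?addr0 ?lexx//; exact: cc.
have E t : c + t = t - (- c) by rewrite opprK addrC.
under [X in X - _ + _]eq_cint do rewrite E.
under [X in _ - X + _]eq_cint do rewrite E.
under [X in _ + _ * (X - _)]eq_cint do rewrite E.
under [X in _ + _ * (_ - X)]eq_cint do rewrite E.
rewrite -!cintB//.
rewrite (@eq_cint _ _ _ _ (fun=> d * (0 -i* m))); last first.
  move=> t _; transitivity (d * ((t +i* y) - (t +i* (y + m)))); first by ring.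
  by congr (_ * _); simpc; congr Complex; ring.
rewrite [X in _ + _ * X](@eq_cint _ _ _ _ (fun=> d * l%:C)); last first.
  move=> t _; transitivity (d * (((x + l) +i* t) - (x +i* t))); first by ring.
  by congr (_ * _); simpc; congr Complex; ring.
rewrite !cint_cst ?lerDl// !(addrAC _ _ (- _)) !subrr !add0r.
by case: d {cc ih iv E} => p q; simpc; apply/eqP; rewrite eq_complex /=;
  apply/andP; split; apply/eqP; ring.
Qed.

Lemma rect_int_quarter f x y l m : 0 <= l -> 0 <= m ->
  ccontinuous_on (in_rect x y (l + l) (m + m)) f ->
  rect_int f x y (l + l) (m + m) =
  rect_int f x y l m + rect_int f (x + l) y l m +
  rect_int f x (y + m) l m + rect_int f (x + l) (y + m) l m.
Proof.
move=> l0 m0 cf; rewrite /rect_int /hint /vint.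
have y1 : y <= y <= y + (m + m) by rewrite lexx lerDl addr_ge0.
have y2 : y <= y + m <= y + (m + m) by rewrite addrA !lerDl m0.
have y3 : y <= y + (m + m) <= y + (m + m) by rewrite lexx lerDl addr_ge0.
have x1 : x <= x <= x + (l + l) by rewrite lexx lerDl addr_ge0.
have x2 : x <= x + l <= x + (l + l) by rewrite addrA !lerDl l0.
have x3 : x <= x + (l + l) <= x + (l + l) by rewrite lexx lerDl addr_ge0.
have [x12 x23] := andP x2; have [y12 y23] := andP y2.
rewrite (cint_cat x12 x23 (hintegrable cf y1)).
rewrite (cint_cat x12 x23 (hintegrable cf y3)).
rewrite (cint_cat y12 y23 (vintegrable cf x3)).
rewrite (cint_cat y12 y23 (vintegrable cf x1)).
rewrite !addrA; ring.
Qed.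

Lemma rect_int_bound f x y l m M : 0 <= l -> 0 <= m ->
  ccontinuous_on (in_rect x y l m) f ->
  (forall z, in_rect x y l m z -> normc (f z) <= M) ->
  normc (rect_int f x y l m) <= 4 * M * (l + m).
Proof.
move=> l0 m0 cf fM; rewrite /rect_int /hint /vint.
have y1 : y <= y <= y + m by rewrite lexx lerDl.
have y2 : y <= y + m <= y + m by rewrite lexx lerDl m0.
have x1 : x <= x <= x + l by rewrite lexx lerDl.
have x2 : x <= x + l <= x + l by rewrite lexx lerDl l0.
have xl : x <= x + l by rewrite lerDl.
have ym : y <= y + m by rewrite lerDl.
have lx : x + l - x = l by rewrite addrAC subrr add0r.
have my : y + m - y = m by rewrite addrAC subrr add0r.
have := cint_bound xl (hintegrable cf y1) (fun t xt => fM _ (in_rectP xt y1)).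
have := cint_bound xl (hintegrable cf y2) (fun t xt => fM _ (in_rectP xt y2)).
have := cint_bound ym (vintegrable cf x1) (fun t yt => fM _ (in_rectP x1 yt)).
have := cint_bound ym (vintegrable cf x2) (fun t yt => fM _ (in_rectP x2 yt)).
rewrite lx my => h1 h2 h3 h4.
rewrite (le_trans (le_normcD _ _))// normcM normc_i mul1r.
have := le_normcD (cint x (x + l) (fun t => f (t +i* y)))
  (- cint x (x + l) (fun t => f (t +i* (y + m)))).
have := le_normcD (cint y (y + m) (fun t => f ((x + l) +i* t)))
  (- cint y (y + m) (fun t => f (x +i* t))).
rewrite !normcN; lra.
Qed.

(** [a] is a sequence of lower ends of nested intervals, one coordinate of the
    corners of the rectangles obtained by bisection. *)
Lemma nested_halving (a : nat -> R) l : 0 <= l ->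
  (forall n, a n <= a n.+1 <= a n + l / 2 ^+ n.+1) ->
  exists c, forall n, a n <= c <= a n + l / 2 ^+ n.
Proof.
move=> l0 ha.
have step n : a n.+1 + l / 2 ^+ n.+1 <= a n + l / 2 ^+ n.
  have /andP[_ h] := ha n.
  have -> : l / 2 ^+ n = l / 2 ^+ n.+1 + l / 2 ^+ n.+1.
    by rewrite exprS; field; rewrite expf_neq0.
  by rewrite addrA lerD2r.
have up n k : a n <= a (n + k)%N.
  elim: k => [|k IH]; first by rewrite addn0.
  by rewrite addnS (le_trans IH)//; have /andP[] := ha (n + k)%N.
have down n k : a (n + k)%N + l / 2 ^+ (n + k) <= a n + l / 2 ^+ n.
  by elim: k => [|k IH]; rewrite ?addn0// addnS (le_trans (step _)).
have ub n k : a k <= a n + l / 2 ^+ n.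
  rewrite (le_trans (up k n))// addnC (le_trans _ (down n k))//.
  by rewrite lerDl divr_ge0// exprn_ge0.
have hs : has_sup (range a).
  split; first by exists (a 0%N), 0%N.
  by exists (a 0%N + l / 2 ^+ 0) => _ [k _ <-]; exact: ub.
exists (sup (range a)) => n; apply/andP; split.
  by case: hs => _ hb; apply: ub_le_sup => //; exists n.
by case: hs => hn _; apply: ge_sup => // _ [k _ <-]; exact: ub.
Qed.

(** Goursat: bisection keeps a quarter carrying at least a quarter of the
    integral; at the limit point the affine part of [f] integrates to zero and
    the remainder is of smaller order than the area. *)
Lemma goursat f x y l m : 0 <= l -> 0 <= m ->
  (forall z : C^o, in_rect x y l m z -> differentiable (f : C^o -> C^o) z) ->
  rect_int f x y l m = 0.
Proof.
move=> l0 m0 df.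
have cf : ccontinuous_on (in_rect x y l m) f.
  by move=> z /df/differentiable_ccontinuous.
pose K := normc (rect_int f x y l m).
pose ln n : R := l / 2 ^+ n; pose mn n : R := m / 2 ^+ n.
have ln0 n : 0 <= ln n by rewrite divr_ge0// exprn_ge0.
have mn0 n : 0 <= mn n by rewrite divr_ge0// exprn_ge0.
have lnS n : ln n = ln n.+1 + ln n.+1.
  by rewrite /ln exprS; field; rewrite expf_neq0.
have mnS n : mn n = mn n.+1 + mn n.+1.
  by rewrite /mn exprS; field; rewrite expf_neq0.
pose inv n (p : R * R) := [/\ x <= p.1, p.1 + ln n <= x + l,
  y <= p.2, p.2 + mn n <= y + m &
  K / 4 ^+ n <= normc (rect_int f p.1 p.2 (ln n) (mn n))].
have step n (p : {p | inv n p}) : {q : {q | inv n.+1 q} |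
    (sval p).1 <= (sval q).1 <= (sval p).1 + ln n.+1 /\
    (sval p).2 <= (sval q).2 <= (sval p).2 + mn n.+1}.
  apply: cid; case: p => -[u v] [/= xu ul yv vm hK].
  have cq : ccontinuous_on (in_rect u v (ln n) (mn n)) f.
    move=> z [/andP[h1 h2] /andP[h3 h4]]; apply: cf; split; apply/andP; split.
    - exact: le_trans h1.
    - exact: le_trans ul.
    - exact: le_trans h3.
    - exact: le_trans vm.
  rewrite (lnS n) in ul; rewrite (mnS n) in vm.
  have key p : u <= p.1 <= u + ln n.+1 -> v <= p.2 <= v + mn n.+1 ->
      K / 4 ^+ n.+1 <= normc (rect_int f p.1 p.2 (ln n.+1) (mn n.+1)) ->
      exists q : {q | inv n.+1 q},
        u <= (sval q).1 <= u + ln n.+1 /\ v <= (sval q).2 <= v + mn n.+1.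
    move=> hp1 hp2 hp3; have hp : inv n.+1 p.
      by split => //; move: hp1 hp2 => /andP[? ?] /andP[? ?]; lra.
    by exists (exist _ p hp).
  have lnn := ln0 n.+1; have mnn := mn0 n.+1.
  have [h|h1] := leP (K / 4 ^+ n.+1) (normc (rect_int f u v (ln n.+1) (mn n.+1))).
    by apply: (key (u, v)) => //=; lra.
  have [h|h2] := leP (K / 4 ^+ n.+1)
      (normc (rect_int f (u + ln n.+1) v (ln n.+1) (mn n.+1))).
    by apply: (key (u + ln n.+1, v)) => //=; lra.
  have [h|h3] := leP (K / 4 ^+ n.+1)
      (normc (rect_int f u (v + mn n.+1) (ln n.+1) (mn n.+1))).
    by apply: (key (u, v + mn n.+1)) => //=; lra.
  have [h|h4] := leP (K / 4 ^+ n.+1)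
      (normc (rect_int f (u + ln n.+1) (v + mn n.+1) (ln n.+1) (mn n.+1))).
    by apply: (key (u + ln n.+1, v + mn n.+1)) => //=; lra.
  exfalso; rewrite (lnS n) (mnS n) in hK cq.
  move: hK. rewrite rect_int_quarter//.
  have -> : K / 4 ^+ n = 4 * (K / 4 ^+ n.+1).
    by rewrite exprS; field; rewrite expf_neq0.
  apply/negP; rewrite -ltNge.
  rewrite (le_lt_trans (le_normcD _ _))//.
  have := le_normcD (rect_int f u v (ln n.+1) (mn n.+1) +
    rect_int f (u + ln n.+1) v (ln n.+1) (mn n.+1))
    (rect_int f u (v + mn n.+1) (ln n.+1) (mn n.+1)).
  have := le_normcD (rect_int f u v (ln n.+1) (mn n.+1))
    (rect_int f (u + ln n.+1) v (ln n.+1) (mn n.+1)).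
  lra.
have inv0 : inv 0 (x, y).
  by split; rewrite /= /ln /mn ?expr0 ?divr1.
pose s := fix s n : {p | inv n p} :=
  if n is n'.+1 then sval (step n' (s n')) else exist _ (x, y) inv0.
have [c hc] : exists c, forall n, (sval (s n)).1 <= c <= (sval (s n)).1 + l / 2 ^+ n.
  by apply: nested_halving => // n; case: (svalP (step n (s n))).
have [d hd] : exists d, forall n, (sval (s n)).2 <= d <= (sval (s n)).2 + m / 2 ^+ n.
  by apply: nested_halving => // n; case: (svalP (step n (s n))).
have zin : in_rect x y l m (c +i* d).
  by split; [have := hc 0%N|have := hd 0%N]; rewrite /= expr0 divr1.
have [D hD] := (differentiable_epsP _ _).1 (df _ zin).
suff : K = 0 by exact: eq0_normc.
have K0 : 0 <= K by exact: normc_ge0.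
suff Ke (e : R) : 0 < e -> K <= 4 * e * (l + m) ^+ 2.
  apply/eqP; rewrite eq_le K0 andbT leNgt; apply/negP => Kgt.
  have w0 : 0 < 4 * (l + m) ^+ 2 + 1 by rewrite ltr_wpDl// mulr_ge0// sqr_ge0.
  have := Ke (K / (4 * (l + m) ^+ 2 + 1) / 2) ltac:(by rewrite !divr_gt0).
  apply/negP; rewrite -ltNge.
  have -> : 4 * (K / (4 * (l + m) ^+ 2 + 1) / 2) * (l + m) ^+ 2 =
     K / 2 * ((4 * (l + m) ^+ 2) / (4 * (l + m) ^+ 2 + 1)).
    by field; rewrite gt_eqF.
  have q1 : (4 * (l + m) ^+ 2) / (4 * (l + m) ^+ 2 + 1) <= 1.
    by rewrite ler_pdivrMr// mul1r lerDl.
  have K2 : 0 <= K / 2 by rewrite divr_ge0.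
  rewrite (le_lt_trans (ler_wpM2l K2 q1))//; lra.
move=> e0; have [r r0 {}hD] := hD e e0.
have [n hn] : exists n, (l + m) / 2 ^+ n < r.
  have lm1 : 0 < l + m + 1 by rewrite ltr_wpDl// addr_ge0.
  have := @cvg_expr R 2^-1 ltac:(by rewrite ger0_norm ?invr_ge0// invf_lt1// ltr1n).
  move=> /cvgrPdist_lt /(_ _ (divr_gt0 r0 lm1)) [n _ /(_ n (leqnn n))].
  rewrite /= sub0r normrN exprVn ger0_norm ?invr_ge0 ?exprn_ge0// ltr_pdivlMr//.
  move=> H; exists n; apply: le_lt_trans H; rewrite mulrC.
  by rewrite ler_wpM2l ?invr_ge0 ?exprn_ge0// lerDl.
have := hc n; have := hd n.
case: (svalP (s n)); move: (sval (s n)) => [u v] /= xu ul yv vm hK hdn hcn.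
have sub z : in_rect u v (ln n) (mn n) z -> in_rect x y l m z.
  by move=> [/andP[? ?] /andP[? ?]]; split; lra.
pose aff := fun z => (f (c +i* d) - D * (c +i* d)) + D * z.
have caff z : ccontinuous aff z.
  rewrite /aff; under [X in ccontinuous X]eq_fun do
    rewrite addrC -[f _ - _]opprK.
  apply: ccontinuousB; last exact: ccontinuous_cst.
  by apply: ccontinuousMl; exact: ccontinuous_id.
have crect : ccontinuous_on (in_rect u v (ln n) (mn n)) f.
  by move=> z /sub; exact: cf.
have E : rect_int f u v (ln n) (mn n) =
    rect_int (fun z => f z - aff z) u v (ln n) (mn n).
  by rewrite rect_intB// rect_int_affine// subr0.
have : normc (rect_int f u v (ln n) (mn n)) <=
    4 * (e * ((l + m) / 2 ^+ n)) * (ln n + mn n).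
  rewrite E; apply: rect_int_bound => //.
    by move=> z zn; apply: ccontinuousB => //; exact: crect.
  move=> z [z1 z2].
  have zd : normc (z - (c +i* d)) <= (l + m) / 2 ^+ n.
    rewrite (le_trans (normc_le_ReIm _))// mulrDl; case: z z1 z2 => p q /= z1 z2.
    by apply: lerD; rewrite ler_norml; rewrite /ln /mn in z1 z2; lra.
  have := hD (z - (c +i* d)) (le_lt_trans zd hn).
  rewrite (addrC (c +i* d)) subrK => H.
  have -> : f z - aff z = f z - f (c +i* d) - D * (z - (c +i* d)).
    by rewrite /aff; ring.
  by rewrite (le_trans H)// ler_wpM2l// ltW.
move=> /(le_trans hK).
rewrite (_ : 4 * _ * _ = (4 * e * (l + m) ^+ 2) / 4 ^+ n); last first.
  have -> : 4 ^+ n = 2 ^+ n * 2 ^+ n :> R by rewrite -exprMn -natrM.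
  by rewrite /ln /mn; field; rewrite expf_neq0.
by rewrite ler_pM2r// invr_gt0 exprn_gt0.
Qed.

End Goursat.

(** * The complex exponential *)

Section ComplexExponential.
Variable R : realType.
Local Notation C := R[i].

Lemma is_derive_eps (f : R -> R) (x d : R) : is_derive x 1 f d ->
  forall e, 0 < e -> exists2 r : R, 0 < r & forall k,
    `|k| < r -> `|f (x + k) - f x - d * k| <= e * `|k|.
Proof.
move=> [df dE] e e0; move: df => /cvgrPdist_le /(_ _ e0).
rewrite -/('D_1 f x) dE => /nbhs_ballP[r /= r0 H]; exists r => // k kr.
have [->|k0] := eqVneq k 0; first by rewrite addr0 subrr mulr0 subr0 !normr0 mulr0.
have := H k; rewrite /ball /= sub0r normrN => /(_ kr k0).
rewrite /GRing.scale/= mulr1 distrC => {}H.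
rewrite (_ : _ - _ - _ = (k^-1 * (f (k + x) - f x) - d) * k).
  by rewrite normrM ler_wpM2r.
by rewrite mulrBl mulrAC mulVf// mul1r (addrC x).
Qed.

Definition cexp (s : C) : C :=
  (expR (complex.Re s))%:C * (cos (complex.Im s) +i* sin (complex.Im s)).

Lemma cexpD s t : cexp (s + t) = cexp s * cexp t.
Proof.
case: s t => a b [c d]; rewrite /cexp /= expRD cosD sinD; simpc.
by congr Complex; ring.
Qed.

Lemma normc_cexp s : normc (cexp s) = expR (complex.Re s).
Proof.
rewrite normcM normc_real ger0_norm ?expR_ge0// /normc cos2Dsin2 sqrtr1.
by rewrite mulr1.
Qed.

Lemma cexp_neq0 s : cexp s != 0.
Proof. by rewrite -normc_gt0 normc_cexp expR_gt0. Qed.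

Lemma cexp_periodic s : cexp (s + (0 +i* (2 * pi))) = cexp s.
Proof.
rewrite cexpD /cexp /= expR0 mul1r mulr_natl sin2pi cos2pi.
by rewrite -[1 +i* 0]/(1 : C) mulr1.
Qed.

Lemma cexp_differentiable (z : C^o) : differentiable (cexp : C^o -> C^o) z.
Proof.
apply/differentiable_epsP; exists (cexp z).
suff H e : 0 < e -> exists2 r : R, 0 < r & forall k : C, normc k < r ->
    normc (cexp k - 1 - k) <= e * normc k.
  move=> e e0; have [r r0 {}H] := H _ (divr_gt0 e0 (expR_gt0 (complex.Re z))).
  exists r => // k /H; rewrite cexpD.
  have -> : cexp z * cexp k - cexp z - cexp z * k = cexp z * (cexp k - 1 - k).
    by ring.
  rewrite normcM normc_cexp -ler_pdivlMl ?expR_gt0// => {}H.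
  by rewrite (le_trans H)// mulrAC mulrC.
move=> e0; pose e' := Num.min 1 (e / 8).
have e'0 : 0 < e' by rewrite lt_min ltr01 divr_gt0.
have e'1 : e' <= 1 by rewrite ge_min lexx.
have e'e : 8 * e' <= e.
  by rewrite mulrC -ler_pdivlMr// ge_min lexx orbT.
have [r1 r10 H1] := is_derive_eps (is_derive_expR 0) e'0.
have [r2 r20 H2] := is_derive_eps (is_derive_cos 0) e'0.
have [r3 r30 H3] := is_derive_eps (is_derive_sin 0) e'0.
pose r := Num.min (Num.min r1 r2) (Num.min r3 (e' / 2)).
exists r; first by rewrite !lt_min r10 r20 r30/= divr_gt0.
move=> k; rewrite !lt_min => /andP[/andP[k1 k2] /andP[k3 k4]].
have hx := Re_le_normc k; have hy := Im_le_normc k.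
rewrite (le_trans (normc_le_ReIm _))//.
case: k k1 k2 k3 k4 hx hy => x y /= k1 k2 k3 k4 hx hy.
set K := normc _ in k1 k2 k3 k4 hx hy *.
have := H1 x (le_lt_trans hx k1); have := H2 y (le_lt_trans hy k2).
have := H3 y (le_lt_trans hy k3).
rewrite !add0r expR0 cos0 sin0 oppr0 mul0r !subr0 !mul1r addr0 => h3 h2 h1.
have K0 : 0 <= K by exact: normc_ge0.
have hx' : e' * `|x| <= e' * K by rewrite ler_wpM2l// ltW.
have hy' : e' * `|y| <= e' * K by rewrite ler_wpM2l// ltW.
have ex : `|expR x - 1| <= 2 * K.
  have -> : expR x - 1 = (expR x - 1 - x) + x by ring.
  rewrite (le_trans (ler_normD _ _))// (le_trans (lerD h1 hx))//.
  by rewrite mulr_natl mulr2n lerD2r (le_trans hx')// ler_piMl.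
have ex2 : `|expR x| <= 2.
  have -> : expR x = (expR x - 1) + 1 by ring.
  by rewrite (le_trans (ler_normD _ _))// normr1; lra.
rewrite addr0 mul0r mul0r addr0 !subr0.
have hRe : `|expR x * cos y - 1 - x| <= e' * K + 2 * (e' * K).
  have -> : expR x * cos y - 1 - x = (expR x - 1 - x) + expR x * (cos y - 1).
    by ring.
  rewrite (le_trans (ler_normD _ _))// lerD ?(le_trans h1)// normrM.
  by apply: ler_pM => //; exact: le_trans h2 hy'.
have hIm : `|expR x * sin y - y| <= 2 * (e' * K) + 2 * K * K.
  have -> : expR x * sin y - y = expR x * (sin y - y) + (expR x - 1) * y.
    by ring.
  rewrite (le_trans (ler_normD _ _))// !normrM lerD//; apply: ler_pM => //.
  exact: le_trans h3 hy'.
have KK : 2 * K * K <= e' * K by rewrite ler_wpM2r//; lra.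
have e'K : 8 * (e' * K) <= e * K by rewrite mulrA ler_wpM2r.
have e'K0 : 0 <= e' * K by rewrite mulr_ge0// ltW.
move: hRe hIm.
set A := `|_|; set B := `|_| => hRe hIm.
lra.
Qed.

End ComplexExponential.

(** * Integrals over circles *)

Section CauchyTaylor.
Variable R : realType.
Local Notation C := R[i].
Implicit Types (f G : C -> C) (x y : R).

(** [circle_int G x] is the integral of [G z * z] with respect to the angle
    over the circle of radius [expR x], that is, [-'i] times the contour
    integral of [G]. *)
Definition circle_int G x : C :=
  vint (fun s => G (cexp s) * cexp s) x 0 (2 * pi).

Lemma pi2_ge0 : 0 <= 2 * pi :> R.
Proof. by rewrite mulr_ge0// pi_ge0. Qed.

Lemma ccontinuousM f G z : ccontinuous f z -> ccontinuous G z ->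
  ccontinuous (fun z => f z * G z) z.
Proof.
move=> cf cG e e0.
have N0 : 0 < 1 + normc (f z) + normc (G z).
  by rewrite -addrA ltr_pwDl// addr_ge0 ?normc_ge0.
pose d := Num.min 1 (e / (1 + normc (f z) + normc (G z))).
have d0 : 0 < d by rewrite lt_min ltr01 divr_gt0.
have [r r0 Hf] := cf d d0; have [s s0 HG] := cG d d0.
exists (Num.min r s); first by rewrite lt_min r0.
move=> k; rewrite lt_min => /andP[/Hf {}Hf /HG {}HG].
have -> : f (z + k) * G (z + k) - f z * G z =
  (f (z + k) - f z) * (G (z + k) - G z) +
  (f z * (G (z + k) - G z) + (f (z + k) - f z) * G z) by ring.
have d1 : d <= 1 by rewrite ge_min lexx.
have de : d * (1 + normc (f z) + normc (G z)) <= e.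
  by rewrite -ler_pdivlMr// ge_min lexx orbT.
have A0 := normc_ge0 (f (z + k) - f z); have B0 := normc_ge0 (G (z + k) - G z).
have F0 := normc_ge0 (f z); have E0 := normc_ge0 (G z).
rewrite (le_lt_trans (le_normcD _ _))//.
have := le_normcD (f z * (G (z + k) - G z)) ((f (z + k) - f z) * G z).
rewrite !normcM => h.
have h1 : normc (f (z + k) - f z) * normc (G (z + k) - G z) < d.
  by rewrite (le_lt_trans _ Hf)// ler_piMr// (le_trans (ltW HG)).
have h2 : normc (f z) * normc (G (z + k) - G z) <= normc (f z) * d.
  by rewrite ler_wpM2l// ltW.
have h3 : normc (f (z + k) - f z) * normc (G z) <= d * normc (G z).
  by rewrite ler_wpM2r// ltW.
lra.
Qed.

Lemma ccontinuous_comp_cexp f s :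
  ccontinuous f (cexp s) -> ccontinuous (f \o @cexp R) s.
Proof.
move=> cf e e0; have [r r0 H] := cf e e0.
have [t t0 H'] := differentiable_ccontinuous (@cexp_differentiable R s) r0.
exists t => // k /H' /H /=.
by rewrite (addrC (cexp s)) subrK.
Qed.

Lemma circle_integrand_ccontinuous G s : ccontinuous G (cexp s) ->
  ccontinuous (fun s => G (cexp s) * cexp s) s.
Proof.
move=> cG; apply: ccontinuousM; first exact: ccontinuous_comp_cexp.
exact: differentiable_ccontinuous (@cexp_differentiable R s).
Qed.

Lemma circle_integrable G x :
  (forall y, ccontinuous G (cexp (x +i* y))) ->
  cintegrable 0 (0 + 2 * pi) (fun y => G (cexp (x +i* y)) * cexp (x +i* y)).
Proof.
move=> cG; apply: (@vintegrable _ (fun s => G (cexp s) * cexp s) x 0 0) => //.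
  move=> [u v] [/= xu _]; apply: circle_integrand_ccontinuous.
  by rewrite addr0 -eq_le in xu; rewrite -(eqP xu).
by rewrite addr0 lexx.
Qed.

(** In the coordinate [s = log z], an annulus becomes a rectangle whose
    horizontal sides carry the same values by periodicity. *)
Lemma circle_int_const G x x' : x <= x' ->
  (forall z : C^o, expR x <= normc z <= expR x' ->
     differentiable (G : C^o -> C^o) z) ->
  circle_int G x = circle_int G x'.
Proof.
move=> xx' dG; pose F s := G (cexp s) * cexp s.
have : rect_int F x 0 (x' - x) (2 * pi) = 0.
  apply: goursat; rewrite ?subr_ge0 ?pi2_ge0//.
  move=> [u v] [/= /andP[xu ux'] _].
  apply: cdiffM; last exact: cexp_differentiable.
  apply: cdiff_comp; first exact: cexp_differentiable.
  apply: dG; rewrite normc_cexp /= !ler_expR xu.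
  by rewrite addrC subrK in ux'.
rewrite /rect_int; have -> : hint F x (x' - x) (0 + 2 * pi) = hint F x (x' - x) 0.
  apply: eq_cint => t _; rewrite /F -[in RHS](cexp_periodic (t +i* 0)).
  by congr (G (cexp _) * cexp _); simpc.
rewrite subrr add0r => /eqP; rewrite mulf_eq0 => /orP[|].
  by rewrite eq_complex /= oner_eq0 andbF.
by rewrite subr_eq0 addrC subrK => /eqP.
Qed.

Lemma circle_int_bound G x M : (forall y, ccontinuous G (cexp (x +i* y))) ->
  (forall y, 0 <= y <= 0 + 2 * pi -> normc (G (cexp (x +i* y))) <= M) ->
  normc (circle_int G x) <= 2 * (M * expR x) * (2 * pi).
Proof.
move=> cG GM; rewrite -[leRHS](_ : 2 * (M * expR x) * (0 + 2 * pi - 0) = _); last first.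
  by rewrite add0r subr0.
apply: cint_bound; rewrite ?lerDl ?pi2_ge0//.
  exact: circle_integrable.
by move=> y /GM {}GM; rewrite normcM normc_cexp /= ler_wpM2r ?expR_ge0.
Qed.

(** By compactness of the range of angles, the integrand is continuous in the
    radius uniformly in the angle. *)
Lemma circle_int_continuous G x : (forall y, ccontinuous G (cexp (x +i* y))) ->
  (\forall x' \near x, forall y, ccontinuous G (cexp (x' +i* y))) ->
  forall e : R, 0 < e ->
  \forall x' \near x, normc (circle_int G x' - circle_int G x) <= e.
Proof.
move=> cG cGn e e0; pose F s := G (cexp s) * cexp s.
have cF y : ccontinuous F (x +i* y) by exact: circle_integrand_ccontinuous.
pose d := e / (2 * (2 * pi)).
have pi0 := @pi_gt0 R.
have d0 : 0 < d by rewrite divr_gt0// !mulr_gt0.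
have : \forall x' \near x, `[0, 0 + 2 * pi] `<=`
    (fun y => normc (F (x' +i* y) - F (x +i* y)) <= d).
  have/compact_near_coveringP/(_ _ (nbhs x)
    (fun x' y => normc (F (x' +i* y) - F (x +i* y)) <= d) _) :=
    @segment_compact R 0 (0 + 2 * pi).
  apply => y _.
  have [r r0 H] := cF y _ (divr_gt0 d0 (ltr0n _ 2)).
  exists (ball y (r / 2), ball x (r / 2)).
    by split; apply/nbhs_ballP; exists (r / 2) => //=; rewrite divr_gt0.
  move=> [y' x'] [/= yy' xx'].
  have Hx : normc (F (x' +i* y') - F (x +i* y)) < d / 2.
    have -> : x' +i* y' = x +i* y + ((x' - x) +i* (y' - y)).
      by simpc; congr Complex; ring.
    apply: H; rewrite (le_lt_trans (normc_le_ReIm _))//= (splitr r).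
    by rewrite distrC (distrC y') ltrD.
  have Hy : normc (F (x +i* y') - F (x +i* y)) < d / 2.
    have -> : x +i* y' = x +i* y + (0 +i* (y' - y)).
      by simpc; congr Complex; ring.
    apply: H; rewrite (le_lt_trans (normc_le_ReIm _))//= (splitr r).
    by rewrite normr0 distrC ltrD// divr_gt0.
  have -> : F (x' +i* y') - F (x +i* y') =
      (F (x' +i* y') - F (x +i* y)) - (F (x +i* y') - F (x +i* y)) by ring.
  by rewrite (le_trans (le_normcD _ _))// normcN (splitr d) lerD// ltW.
move=> H; near=> x'.
have cG' : forall y, ccontinuous G (cexp (x' +i* y)) by near: x'.
have H' : `[0, 0 + 2 * pi] `<=`
    (fun y => normc (F (x' +i* y) - F (x +i* y)) <= d) by near: x'.
rewrite /circle_int /vint -cintB; [|exact: circle_integrable..].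
have -> : e = 2 * d * (0 + 2 * pi - 0).
  by rewrite /d add0r subr0 mulrAC [RHS]mulrC divfK// !mulf_neq0 ?gt_eqF//.
apply: cint_bound; first by rewrite add0r pi2_ge0.
  by apply: cintegrableB; exact: circle_integrable.
by move=> y y02; apply: H'; rewrite /= in_itv.
Unshelve. all: by end_near. Qed.

End CauchyTaylor.

(** * Taylor expansion of holomorphic functions *)

Section Taylor.
Variable R : realType.
Local Notation C := R[i].
Local Notation cdiff f z := (differentiable (f : C^o -> C^o) (z : C^o)).
Implicit Types (f G : C -> C) (x y : R) (z w : C).

Lemma circle_bounded G x : (forall y, ccontinuous G (cexp (x +i* y))) ->
  exists M, forall y, 0 <= y <= 0 + 2 * pi -> normc (G (cexp (x +i* y))) <= M.
Proof.
move=> cG.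
have/compact_near_coveringP/(_ _ (nbhs (pinfty_nbhs R))
    (fun M y => normc (G (cexp (x +i* y))) <= M) _) :=
    @segment_compact R 0 (0 + 2 * pi).
case=> [y _|M [_ H]].
  have cGe : ccontinuous (G \o @cexp R) (x +i* y).
    exact: ccontinuous_comp_cexp.
  have [r r0 H] := cGe 1 ltr01.
  exists (ball y r, [set M | normc (G (cexp (x +i* y))) + 1 < M]).
    split; first by apply/nbhs_ballP; exists r.
    by exists (normc (G (cexp (x +i* y))) + 1); split=> //; exact: num_real.
  move=> [y' M] [/= yy' HM]; rewrite (le_trans _ (ltW HM))//.
  have := H (0 +i* (y' - y)).
  have -> : normc (0 +i* (y' - y)) = `|y' - y|.
    by rewrite /normc expr0n add0r sqrtr_sqr.
  rewrite distrC => /(_ yy') /ltW h.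
  have -> : G (cexp (x +i* y')) = G (cexp (x +i* y)) +
     (G (cexp (x +i* y')) - G (cexp (x +i* y))) by ring.
  rewrite (le_trans (le_normcD _ _))// lerD2l.
  move: h => /=; congr (normc (G (cexp _) - _) <= _).
  by simpc; congr Complex; ring.
exists (M + 1) => y y02; apply: (H (M + 1)); first by rewrite ltrDl.
by rewrite /= in_itv.
Qed.

(** A single point at which [G] is merely continuous does not spoil the
    vanishing: the integral is constant on either side of its radius, and
    continuous across it. *)
Lemma circle_int_eq0 G w X : (forall z, normc z < expR X -> z != w -> cdiff G z) ->
  ccontinuous G w -> forall x, x < X -> circle_int G x = 0.
Proof.
move=> dG cGw.
have cG x y : x < X -> ccontinuous G (cexp (x +i* y)).
  move=> xX; have [->//|zw] := eqVneq (cexp (x +i* y)) w.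
  by apply/differentiable_ccontinuous/dG; rewrite // normc_cexp /= ltr_expR.
have cGn x : x < X -> \forall x' \near x, forall y, ccontinuous G (cexp (x' +i* y)).
  by move=> xX; near=> x' => y; apply: cG; near: x'; exact: lt_nbhsl.
have const x x' : x <= x' -> x' < X ->
    (forall z, expR x <= normc z <= expR x' -> z != w) ->
    circle_int G x = circle_int G x'.
  move=> xx' xX H; apply: circle_int_const => // z zx; apply: dG; last exact: H.
  by case/andP: zx => _ /le_lt_trans -> //; rewrite ltr_expR.
have small (z : C) : (forall e : R, 0 < e -> normc z <= e) -> z = 0.
  move=> H; apply: eq0_normc; apply/eqP; rewrite eq_le normc_ge0 andbT.
  by apply/ler_addgt0Pl => e e0; rewrite addr0; exact: H.
have pi0 := @pi_gt0 R.
have inner x : x < X -> normc w = 0 \/ expR x < normc w -> circle_int G x = 0.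
  move=> xX hw; apply: small => e e0.
  have cG0 : ccontinuous G 0.
    have [<-//|w0] := eqVneq w 0.
    apply/differentiable_ccontinuous/dG; rewrite ?normc0 ?expR_gt0//.
    by rewrite eq_sym.
  have [r r0 H] := cG0 1 ltr01.
  pose B := normc (G 0) + 1.
  have B0 : 0 < B by rewrite ltr_wpDl// normc_ge0.
  pose q := Num.min (r / 2) (e / (2 * B * (2 * pi))).
  have q0 : 0 < q by rewrite lt_min !divr_gt0// !mulr_gt0.
  pose x1 := Num.min x (ln q).
  have x1x : x1 <= x by rewrite ge_min lexx.
  have ex1 : expR x1 <= q.
    by rewrite -[leRHS]lnK ?posrE// ler_expR ge_min lexx orbT.
  rewrite -(const _ _ x1x xX) => [|z /andP[z1 z2]]; last first.
    apply: contra_eqN (erefl true) => /eqP zw; subst z.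
    case: hw => [w0|]; last by rewrite ltNge z2.
    by move: z1; rewrite w0 leNgt expR_gt0.
  have x1X : x1 < X by exact: le_lt_trans xX.
  apply: (@le_trans _ _ (2 * (B * expR x1) * (2 * pi))).
    apply: circle_int_bound => [y|y _]; first exact: cG.
    have -> : G (cexp (x1 +i* y)) = G 0 + (G (0 + cexp (x1 +i* y)) - G 0).
      by rewrite add0r; ring.
    rewrite (le_trans (le_normcD _ _))// lerD2l ltW// H// normc_cexp /=.
    rewrite (le_lt_trans ex1)// (@le_lt_trans _ _ (r / 2))//.
      by rewrite ge_min lexx.
    by rewrite ltr_pdivrMr// ltr_pMr// ltr1n.
  have -> : 2 * (B * expR x1) * (2 * pi) = expR x1 * (2 * B * (2 * pi)) by ring.
  rewrite -ler_pdivlMr ?mulr_gt0// (le_trans ex1)//.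
  by rewrite ge_min lexx orbT.
have near_int x (e : R) : x < X -> 0 < e -> exists2 d : R, 0 < d & forall x',
    `|x - x'| < d -> normc (circle_int G x' - circle_int G x) <= e.
  move=> xX e0; have := circle_int_continuous (fun y => cG x y xX) (cGn x xX) e0.
  by case/nbhs_ballP => d /= d0 H; exists d.
have bnd x : x < X -> expR x = normc w -> circle_int G x = 0.
  move=> xX hw; apply: small => e e0; have [d d0 H] := near_int x e xX e0.
  have d2 : 0 < d / 2 by rewrite divr_gt0.
  have xx' : x - d / 2 < x by rewrite ltrBlDr ltrDl.
  have /H : `|x - (x - d / 2)| < d.
    by rewrite opprB addrC subrK gtr0_norm// ltr_pdivrMr// ltr_pMr// ltr1n.
  rewrite inner ?sub0r ?normcN//; first exact: lt_trans xX.
  by right; rewrite -hw ltr_expR.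
move=> x xX; have [xw|wx] := ltP (expR x) (normc w); first by apply: inner => //; right.
have [/eqP w0|w0] := eqVneq (normc w) 0; first by apply: inner => //; left; exact/eqP.
have w0' : 0 < normc w by rewrite lt_neqAle eq_sym w0 normc_ge0.
pose xw := ln (normc w); have exw : expR xw = normc w by rewrite lnK.
have xwx : xw <= x by rewrite -ler_expR exw.
move: xwx; rewrite le_eqVlt => /predU1P[xe|xwx]; first by apply: bnd; rewrite // -xe.
apply: small => e e0; have xwX := lt_trans xwx xX.
have [d d0 H] := near_int xw e xwX e0.
pose x' := Num.min x (xw + d / 2).
have d2 : 0 < d / 2 by rewrite divr_gt0.
have xwx' : xw < x' by rewrite lt_min xwx ltrDl.
have x'x : x' <= x by rewrite ge_min lexx.
have /H : `|xw - x'| < d.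
  rewrite distrC gtr0_norm ?subr_gt0// ltrBlDl gt_min; apply/orP; right.
  by rewrite ltrD2l ltr_pdivrMr// ltr_pMr// ltr1n.
rewrite (bnd xw)// subr0 (const _ _ x'x xX)// => z /andP[z1 _].
apply: contra_eqN (erefl true) => /eqP zw; move: z1.
by rewrite zw -exw ler_expR leNgt xwx'.
Unshelve. all: by end_near. Qed.

Lemma cdiff_exprn n z : cdiff (fun z => z ^+ n) z.
Proof. exact: (@cdiffX R (fun z => z) n z (cdiff_id z)). Qed.

Lemma circle_int_inv x : circle_int (fun z => z^-1) x = (2 * pi)%:C.
Proof.
rewrite /circle_int /vint.
rewrite (@eq_cint _ _ _ _ (fun=> 1)) => [|y _]; last by rewrite mulVf// cexp_neq0.
by rewrite cint_cst ?lerDl ?pi2_ge0// add0r subr0 mulr1.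
Qed.

Lemma circle_int_invX n x : circle_int (fun z => (z ^+ n.+2)^-1) x = 0.
Proof.
have c t y : ccontinuous (fun z : C => (z ^+ n.+2)^-1) (cexp (t +i* y)).
  apply: differentiable_ccontinuous.
  apply: (@cdiffV R (fun z => z ^+ n.+2)); last exact: cdiff_exprn.
  by rewrite expf_neq0// cexp_neq0.
have E : circle_int (fun z => (z ^+ n.+2)^-1) (x + 1) =
    (expR (- n.+1%:R))%:C * circle_int (fun z => (z ^+ n.+2)^-1) x.
  rewrite /circle_int /vint -cintZ; last exact: (@circle_integrable R (fun z => z ^- n.+2) x (c x)).
  apply: eq_cint => y _.
  have -> : (x + 1) +i* y = 1%:C + (x +i* y) by simpc; congr Complex; ring.
  rewrite cexpD; have z0 := cexp_neq0 (x +i* y).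
  have -> : cexp 1%:C = (expR 1)%:C :> C.
    by rewrite /cexp /= cos0 sin0 -[1 +i* 0]/(1 : C) mulr1.
  have -> : expR (- n.+1%:R) = (expR 1)^-1 ^+ n.+1 :> R.
    by rewrite -expRN -expRM_natl mulrN mulr1.
  rewrite rmorphXn /= fmorphV /=.
  have e0 : (expR 1)%:C != 0 :> C by rewrite fmorph_eq0 gt_eqF// expR_gt0.
  rewrite exprMn exprVn [_%:C ^+ n.+2]exprS.
  have := expf_neq0 n.+1 e0; have := expf_neq0 n.+2 z0.
  move: (_ ^+ n.+2) (_ ^+ n.+1) => Z A Z0 A0.
  by field; rewrite e0 Z0 A0.
have : circle_int (fun z => (z ^+ n.+2)^-1) x =
    circle_int (fun z => (z ^+ n.+2)^-1) (x + 1).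
  apply: circle_int_const; first by rewrite lerDl.
  move=> z /andP[z1 _].
  apply: (@cdiffV R (fun z => z ^+ n.+2)); last exact: cdiff_exprn.
  by rewrite expf_neq0// -normc_gt0 (lt_le_trans (expR_gt0 _) z1).
rewrite E => /eqP; rewrite -subr_eq0 -[X in X - _]mul1r -mulrBl mulf_eq0.
case/orP => [|/eqP//]; rewrite subr_eq0 eq_complex /= => /andP[/eqP e1 _].
have : expR (- n.+1%:R) < 1 :> R by rewrite expR_lt1 oppr_lt0.
by rewrite -e1 ltxx.
Qed.

Lemma circle_intB G1 G2 x : (forall y, ccontinuous G1 (cexp (x +i* y))) ->
  (forall y, ccontinuous G2 (cexp (x +i* y))) ->
  circle_int (fun z => G1 z - G2 z) x = circle_int G1 x - circle_int G2 x.
Proof.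
move=> c1 c2; rewrite /circle_int /vint -cintB; try exact: circle_integrable.
by apply: eq_cint => y _; rewrite mulrBl.
Qed.

Lemma circle_intZ G a x : (forall y, ccontinuous G (cexp (x +i* y))) ->
  circle_int (fun z => a * G z) x = a * circle_int G x.
Proof.
move=> c1; rewrite /circle_int /vint -cintZ; last exact: circle_integrable.
by apply: eq_cint => y _; rewrite mulrA.
Qed.

Definition taylor_coef f x n : C :=
  (2 * pi)%:C^-1 * circle_int (fun z => f z / z ^+ n.+1) x.

(** Cauchy: the difference quotient [G] at [w] has vanishing circle integral,
    and [1 / (z - w)] is expanded in powers of [w / z] with an exact
    remainder, so that only [G] itself has to be bounded on the circle. *)
Lemma cauchy_expansion f w x X : x < X -> normc w < expR x ->
  (forall z, normc z < expR X -> cdiff f z) ->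
  (fun n => normc (f w - \sum_(k < n) taylor_coef f x k * w ^+ k)) @ \oo --> (0 : R).
Proof.
move=> xX wx df.
have wX : normc w < expR X by rewrite (lt_trans wx)// ltr_expR.
have [d hd] := (differentiable_epsP _ _).1 (df w wX).
pose G z := if z == w then d else (f z - f w) / (z - w).
have Gw k : k != 0 -> G (w + k) = (f (w + k) - f w) / k.
  by move=> k0; rewrite /G -subr_eq0 addrAC subrr add0r (negbTE k0).
have cGw : ccontinuous G w.
  move=> e e0; have [r r0 H] := hd (e / 2) (divr_gt0 e0 (ltr0n _ 2)).
  exists r => // k /H; have [->|k0] := eqVneq k 0.
    by move=> _; rewrite addr0 subrr normc0.
  rewrite Gw// [G w]/G eqxx => h.
  have k1 : 0 < normc k by rewrite normc_gt0.
  rewrite -(ltr_pM2r k1) -normcM mulrBl divfK// (le_lt_trans h)//.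
  by rewrite ltr_pM2r// ltr_pdivrMr// ltr_pMr// ltr1n.
have dG z : normc z < expR X -> z != w -> cdiff G z.
  move=> zX zw.
  have r0 : 0 < normc (z - w) by rewrite normc_gt0 subr_eq0.
  apply: (@near_eq_cdiff _ (fun z => (f z - f w) * (z - w)^-1) G _ z r0).
    move=> k kr; rewrite /G ifN//; apply: contraTneq kr => <-.
    by rewrite opprD addrA subrr sub0r normcN ltxx.
  apply: cdiffM; first by apply: cdiffB; [exact: df|exact: cdiff_cst].
  apply: (@cdiffV _ (fun z => z - w)); first by rewrite subr_eq0.
  by apply: cdiffB; [exact: cdiff_id|exact: cdiff_cst].
have cexpX y : normc (cexp (x +i* y)) < expR X.
  by rewrite normc_cexp ltr_expR.
have cw y : cexp (x +i* y) != w.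
  by apply: contraTneq wx => <-; rewrite normc_cexp /= ltxx.
have cG y : ccontinuous G (cexp (x +i* y)).
  by apply/differentiable_ccontinuous/dG.
have cinv n y : cdiff (fun z => (z ^+ n)^-1) (cexp (x +i* y)).
  apply: (@cdiffV _ (fun z => z ^+ n)); last exact: cdiff_exprn.
  by rewrite expf_neq0// cexp_neq0.
have cf n y : ccontinuous (fun z => f z / z ^+ n) (cexp (x +i* y)).
  by apply/differentiable_ccontinuous/cdiffM; [exact: df|exact: cinv].
have ci n y : ccontinuous (fun z => (z ^+ n)^-1) (cexp (x +i* y)).
  exact: differentiable_ccontinuous.
have cR n y : ccontinuous (fun z => w ^+ n / z ^+ n * G z) (cexp (x +i* y)).
  by apply: ccontinuousM => //; apply: ccontinuousMl.
(* For [n > 0], [r n] is [2 * pi] times the remainder after [n] terms; the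
   recursion starts from [r 0 = 0], which is Cauchy's theorem. *)
pose r n := circle_int (fun z => w ^+ n / z ^+ n * G z) x.
have r0 : r 0%N = 0.
  rewrite -[RHS](circle_int_eq0 dG cGw xX); congr (circle_int _ x).
  by apply/funext => z; rewrite !expr0 divr1 mul1r.
have pi0 : (2 * pi)%:C != 0 :> C by rewrite fmorph_eq0 gt_eqF// mulr_gt0// pi_gt0.
have rS n : r n.+1 = r n - w ^+ n *
    ((2 * pi)%:C * taylor_coef f x n - f w * circle_int (fun z => (z ^+ n.+1)^-1) x).
  rewrite mulrA divff// mul1r -circle_intZ// -circle_intB//; last first.
    by move=> y; apply: ccontinuousMl.
  rewrite -circle_intZ; last first.
    by move=> y; apply: ccontinuousB => //; apply: ccontinuousMl.
  rewrite /r -circle_intB//; last first.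
    by move=> y; apply: ccontinuousMl; apply: ccontinuousB => //; apply: ccontinuousMl.
  rewrite /circle_int /vint; apply: eq_cint => y _; congr (_ * _).
  rewrite /G (negbTE (cw y)).
  have := cexp_neq0 (x +i* y); move: (cexp _) (cw y) => z zw z0.
  have := expf_neq0 n z0; rewrite !exprS; move: (z ^+ n) => Z Z0.
  by field; rewrite z0 Z0 subr_eq0.
have rE n : r n.+1 = (2 * pi)%:C * (f w - \sum_(k < n.+1) taylor_coef f x k * w ^+ k).
  elim: n => [|n IH]; rewrite rS.
    have -> : circle_int (fun z => (z ^+ 1)^-1) x = (2 * pi)%:C.
      by rewrite -(circle_int_inv x); congr (circle_int _ x).
    by rewrite r0 expr0 big_ord_recr big_ord0 /= expr0; ring.
  rewrite IH circle_int_invX [in RHS]big_ord_recr /=; ring.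
have [M hM] := circle_bounded cG.
pose q := normc w / expR x.
have q0 : 0 <= q by rewrite divr_ge0 ?normc_ge0 ?expR_ge0.
have q1 : q < 1 by rewrite ltr_pdivrMr ?expR_gt0// mul1r.
have bound n : normc (f w - \sum_(k < n.+1) taylor_coef f x k * w ^+ k) <=
    (2 * (M * expR x)) * q ^+ n.+1.
  have p0 : 0 < 2 * pi :> R by rewrite mulr_gt0// pi_gt0.
  rewrite -(ler_pM2l p0) -[X in X * normc _](gtr0_norm p0) -normc_real -normcM -rE.
  have -> : 2 * pi * (2 * (M * expR x) * q ^+ n.+1) =
    2 * ((q ^+ n.+1 * M) * expR x) * (2 * pi) by ring.
  apply: circle_int_bound => // y y02; rewrite normcM ler_pM ?normc_ge0//.
    rewrite normcM normcV !normcX normc_cexp /= /q expr_div_n//.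
  exact: hM.
rewrite -cvg_shiftS.
apply: (@squeeze_cvgr _ _ _ _ (fun=> 0) (fun n => (2 * (M * expR x)) * q ^+ n.+1)).
- by apply: nearW => n; rewrite normc_ge0 bound.
- exact: cvg_cst.
- rewrite -(mulr0 (2 * (M * expR x))); apply: cvgMl_tmp.
  rewrite (cvg_shiftS (fun n => q ^+ n)).
  by apply: cvg_expr; rewrite ger0_norm.
Qed.

(** The circle that defines the coefficients can be enlarged so as to enclose
    any given point of the disc, since [z |-> f z / z ^+ n.+1] is holomorphic
    between two circles around [0]. *)
Theorem taylor f (rho : R) : 0 < rho ->
  (forall z, normc z < rho -> cdiff f z) ->
  exists c : nat -> C, forall w, normc w < rho ->
  (fun n => normc (f w - \sum_(k < n) c k * w ^+ k)) @ \oo --> (0 : R).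
Proof.
move=> rho0 df; pose x := ln (rho / 2).
have rho2 : 0 < rho / 2 by rewrite divr_gt0.
have elnr : expR (ln rho) = rho by rewrite lnK.
exists (taylor_coef f x) => w wr; pose m := (normc w + rho) / 2.
have m0 : 0 < m by rewrite divr_gt0// ltr_wpDl// normc_ge0.
have wm : normc w < m by rewrite ltr_pdivlMr// mulr_natr mulr2n ltrD2l.
have mr : m < rho by rewrite ltr_pdivrMr// mulr_natr mulr2n ltrD2r.
have elnm : expR (ln m) = m by rewrite lnK.
suff -> : taylor_coef f x = taylor_coef f (ln m).
  apply: (@cauchy_expansion f w (ln m) (ln rho)); rewrite ?elnm ?elnr//.
  by rewrite ltr_ln.
apply/funext => n.
suff H : circle_int (fun z => f z / z ^+ n.+1) x =
    circle_int (fun z => f z / z ^+ n.+1) (ln m) by rewrite /taylor_coef H.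
apply: circle_int_const.
  by rewrite ler_ln ?posrE// ler_pM2r// lerDr normc_ge0.
move=> z; rewrite elnm lnK// => /andP[z1 z2].
have z0 : z != 0 by rewrite -normc_gt0 (lt_le_trans rho2 z1).
apply: cdiffM; first by apply: df; exact: le_lt_trans mr.
by apply: (@cdiffV _ (fun z => z ^+ n.+1)); [rewrite expf_neq0|exact: cdiff_exprn].
Qed.

End Taylor.

(** * Real power series and their derivatives *)

Section RealPowerSeries.
Variable R : realType.
Implicit Types (c e : R^nat) (x y r : R).

Lemma pseries0 c : pseries c 0 @ \oo --> c 0%N.
Proof.
apply: cvg_near_cst; near=> n.
rewrite /pseries /series /= -[n]prednK; last by near: n; exact: nbhs_infty_gt.
rewrite big_nat_recl//= expr0 mulr1 big1 ?addr0// => i _.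
by rewrite expr0n mulr0.
Unshelve. all: by end_near. Qed.

Lemma pseries_behead c x s : x != 0 -> pseries c x @ \oo --> s ->
  pseries (fun n => c n.+1) x @ \oo --> (s - c 0%N) / x.
Proof.
move=> x0 cs.
have -> : pseries (fun n => c n.+1) x =
    (fun n => (pseries c x n.+1 - c 0%N) / x).
  apply/funext => n; rewrite /pseries /series /= big_nat_recl//= expr0 mulr1.
  rewrite [c 0%N + _]addrC addrK mulr_suml; apply: eq_bigr => i _.
  by rewrite exprS mulrA -(mulrA _ x) [x * _]mulrC mulrA mulfK.
apply: cvgMr_tmp; apply: cvgB; last exact: cvg_cst.
by rewrite (cvg_shiftS (pseries c x)).
Qed.

Lemma natr_le_expr (d : R) n : 0 < d <= 1 -> n.+1%:R <= (1 + d) ^+ n / d.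
Proof.
move=> /andP[d0 d1]; rewrite ler_pdivlMr//.
elim: n => [|n IH]; first by rewrite mul1r expr0.
rewrite -natr1 mulrDl mul1r exprS [leRHS]mulrDl mul1r lerD//.
have h1 : 1 <= (1 + d) ^+ n by apply: exprn_ege1; rewrite lerDl ltW.
by rewrite -[leLHS]mulr1 ler_wpM2l// ltW.
Qed.

(** Polynomial factors do not change the radius of convergence: by Bernoulli,
    [n.+1] is absorbed by a ratio slightly larger than one. *)
Lemma is_cvg_pseries_diffs c r : (forall x, `|x| < r -> cvgn (pseries c x)) ->
  forall x, `|x| < r -> cvgn (pseries (pseries_diffs c) x).
Proof.
move=> cc x xr; have [y xy yr] : exists2 y, `|x| < y & y < r.
  by exists ((`|x| + r) / 2); rewrite ?midf_lt.
have y0 : 0 < y by exact: le_lt_trans xy.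
have cy : cvgn (pseries c y) by apply: cc; rewrite gtr0_norm.
have [K [Kreal Kf]] := cvg_series_bounded cy.
pose M := `|K| + 1.
have M0 : 0 <= M by rewrite addr_ge0.
have cM n : `|c n| * y ^+ n <= M.
  have := Kf M ltac:(by rewrite (le_lt_trans (ler_norm K))// ltrDl) n I.
  by rewrite /= normrM normrX (gtr0_norm y0).
have [->|x0] := eqVneq x 0; first by apply/cvg_ex; exists (pseries_diffs c 0%N); exact: pseries0.
have nx0 : 0 < `|x| by rewrite normr_gt0.
pose d := Num.min 1 ((y / `|x| - 1) / 2).
have d0 : 0 < d.
  by rewrite lt_min ltr01 divr_gt0// subr_gt0 ltr_pdivlMr// mul1r.
have d1 : d <= 1 by rewrite ge_min lexx.
have dy : (1 + d) * (`|x| / y) < 1.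
  have : d < y / `|x| - 1.
    rewrite (@le_lt_trans _ _ ((y / `|x| - 1) / 2))//; first by rewrite ge_min lexx orbT.
    by rewrite ltr_pdivrMr// ltr_pMr ?ltr1n// subr_gt0 ltr_pdivlMr// mul1r.
  by rewrite ltrBrDl ltr_pdivlMr// mulrA ltr_pdivrMr// mul1r.
pose q := (1 + d) * (`|x| / y).
have q0 : 0 <= q.
  apply: mulr_ge0; first by apply: addr_ge0 => //; exact: ltW.
  by apply: divr_ge0 => //; exact: ltW.
apply: normed_cvg; rewrite /normed_series_of /=.
apply: (@series_le_cvg _ _ (geometric (M / (y * d)) q)).
- by move=> n; rewrite normr_ge0.
- by move=> n; rewrite /geometric /= mulr_ge0 ?exprn_ge0// divr_ge0// mulr_ge0// ltW.
- move=> n; rewrite /geometric /= /pseries_diffs !normrM normrX normr_nat.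
  have cn : `|c n.+1| <= M / y ^+ n.+1 by rewrite ler_pdivlMr ?exprn_gt0.
  have nn := @natr_le_expr d n ltac:(by rewrite d0 d1).
  apply: (@le_trans _ _ ((1 + d) ^+ n / d * (M / y ^+ n.+1) * `|x| ^+ n)).
    by rewrite ler_wpM2r ?exprn_ge0// ler_pM.
  rewrite /q !exprMn exprVn (exprS y) le_eqVlt; apply/orP; left; apply/eqP.
  have yn0 : y ^+ n != 0 by rewrite expf_neq0// gt_eqF.
  move: (y ^+ n) (`|x| ^+ n) ((1 + d) ^+ n) yn0 => Y X D Y0.
  by field; rewrite Y0 (gt_eqF y0) (gt_eqF d0).
- by apply: is_cvg_geometric_series; rewrite ger0_norm.
Qed.

Lemma pseries_is_derive c g (a r : R) :
  (forall x, `|x - a| < r -> pseries c (x - a) @ \oo --> g x) ->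
  forall x, `|x - a| < r ->
  is_derive x 1 g (limn (pseries (pseries_diffs c) (x - a))).
Proof.
move=> cg x xr.
have cc y : `|y| < r -> cvgn (pseries c y).
  move=> yr; apply/cvg_ex; exists (g (y + a)).
  by rewrite -[y in pseries c y](addrK a); apply: cg; rewrite addrK.
have cc1 := is_cvg_pseries_diffs cc; have cc2 := is_cvg_pseries_diffs cc1.
pose K := (`|x - a| + r) / 2.
have xK : `|x - a| < K by rewrite ltr_pdivlMr// mulr_natr mulr2n ltrD2l.
have K0 : `|K| = K by rewrite gtr0_norm// (le_lt_trans _ xK).
have Kr : `|K| < r by rewrite K0 ltr_pdivrMr// mulr_natr mulr2n ltrD2r.
have H := pseries_snd_diffs (cc _ Kr) (cc1 _ Kr) (cc2 _ Kr) _.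
have {H} := H (x - a) ltac:(by rewrite K0).
move=> H.
have D : is_derive x 1 ((fun y => limn (pseries c y)) \o (fun y => y - a))
  (limn (pseries (pseries_diffs c) (x - a))).
  rewrite -[X in is_derive _ _ _ X]mulr1; apply: is_derive1_comp.
  by rewrite -[X in is_derive _ _ _ X]subr0; apply: is_deriveB.
apply: (near_eq_is_derive _ D).
near=> y; apply/cvg_lim => //; apply: cg; near: y.
apply/nbhs_ballP; exists (r - `|x - a|) => /=; first by rewrite subr_gt0.
move=> y /= xy; rewrite -(subrK x y) -addrA (le_lt_trans (ler_normD _ _))//.
by rewrite -ltrBrDr distrC.
Unshelve. all: by end_near. Qed.

Lemma pseries_derive1n c g (a r : R) :
  (forall x, `|x - a| < r -> pseries c (x - a) @ \oo --> g x) ->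
  forall n x, `|x - a| < r ->
  pseries (iter n (@pseries_diffs R) c) (x - a) @ \oo --> derive1n n g x.
Proof.
move=> cg; elim=> [|n IH] x xr; first exact: cg.
have := pseries_is_derive IH xr; move=> [_ Dx].
rewrite derive1nS derive1E Dx.
have cc y : `|y| < r -> cvgn (pseries (iter n (@pseries_diffs R) c) y).
  move=> yr; apply/cvg_ex; exists (derive1n n g (y + a)).
  by rewrite -[y in pseries _ y](addrK a); apply: IH; rewrite addrK.
exact: is_cvg_pseries_diffs cc _ xr.
Qed.

Lemma iter_pseries_diffs0 c n : iter n (@pseries_diffs R) c 0%N = n`!%:R * c n.
Proof.
suff H k : iter n (@pseries_diffs R) c k * k`!%:R = (n + k)`!%:R * c (n + k)%N.
  by have := H 0%N; rewrite addn0 mulr1.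
elim: n k => [|n IH] k; first by rewrite add0n mulrC.
rewrite /= {1}/pseries_diffs mulrAC -natrM -factS mulrC IH.
by rewrite addSnnS.
Qed.

Lemma derive1n_pseries c g (a r : R) n : 0 < r ->
  (forall x, `|x - a| < r -> pseries c (x - a) @ \oo --> g x) ->
  derive1n n g a = n`!%:R * c n.
Proof.
move=> r0 cg; have := @pseries_derive1n c g a r cg n a.
rewrite subrr normr0 => /(_ r0); rewrite -iter_pseries_diffs0 => H.
have P0 := @pseries0 (iter n (@pseries_diffs R) c). exact: (norm_cvg_unique H P0).
Qed.

Lemma pseries_continuous0 e g r : 0 < r ->
  (forall x, `|x| < r -> x != 0 -> pseries e x @ \oo --> g x) ->
  g x @[x --> 0^'] --> e 0%N.
Proof.
move=> r0 eg; pose f x := if x == 0 then e 0%N else g x.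
have ef x : `|x - 0| < r -> pseries e (x - 0) @ \oo --> f x.
  rewrite subr0 /f => xr; have [->|x0] := eqVneq x 0; first exact: pseries0.
  exact: eg.
have [df _] := @pseries_is_derive e f 0 r ef 0 ltac:(by rewrite subrr normr0).
have : {for 0, continuous f}.
  exact/differentiable_continuous/derivable1_diffP.
move=> /continuous_withinNx; rewrite {2}/f eqxx; apply: cvg_trans.
apply: near_eq_cvg; near=> x; rewrite /f ifN//; near: x.
exact: nbhs_dnbhs_neq.
Unshelve. all: by end_near. Qed.

(** The coefficients of a power series whose sum is [x ^+ n * g x] with [g]
    converging at [0]: peel off the vanishing coefficients one at a time. *)
Lemma pseries_lead e g L n r : 0 < r ->
  (forall x, `|x| < r -> x != 0 -> pseries e x @ \oo --> x ^+ n * g x) ->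
  g x @[x --> 0^'] --> L -> (forall j, (j < n)%N -> e j = 0) /\ e n = L.
Proof.
move=> r0; elim: n e => [|n IH] e eg gL.
  split => //; apply: norm_cvg_unique (pseries_continuous0 r0 _) gL => x xr x0.
  by have := eg x xr x0; rewrite expr0 mul1r.
have e0 : e 0%N = 0.
  apply: norm_cvg_unique (pseries_continuous0 r0 eg) _.
  suff : x ^+ n.+1 * g x @[x --> 0^'] --> 0 * L by rewrite mul0r.
  apply: cvgM => //; have /continuous_withinNx := @exprn_continuous R n.+1 0.
  by rewrite expr0n.
have es x : `|x| < r -> x != 0 ->
    pseries (fun k => e k.+1) x @ \oo --> x ^+ n * g x.
  move=> xr x0; have := pseries_behead x0 (eg x xr x0).
  by rewrite e0 subr0 exprS mulrAC [x * _]mulrC mulfK//.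
have [H1 H2] := IH _ es gL.
by split => // -[//|j] /H1.
Qed.

End RealPowerSeries.

(** * Holomorphic functions and their values at real points *)

Section HolomorphicReal.
Variable R : realType.
Local Notation C := R[i].
Local Notation cdiff f z := (differentiable (f : C^o -> C^o) (z : C^o)).
Implicit Types (f g : C -> C) (z w : C) (x y r : R).

Lemma ReD z w : complex.Re (z + w) = complex.Re z + complex.Re w.
Proof. by case: z w => ? ? []. Qed.

Lemma ReB z w : complex.Re (z - w) = complex.Re z - complex.Re w.
Proof. by case: z w => ? ? []. Qed.

Lemma ImD z w : complex.Im (z + w) = complex.Im z + complex.Im w.
Proof. by case: z w => ? ? []. Qed.

Lemma ImB z w : complex.Im (z - w) = complex.Im z - complex.Im w.
Proof. by case: z w => ? ? []. Qed.

Lemma Re_realM z x : complex.Re (z * x%:C) = complex.Re z * x.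
Proof. by case: z => a b /=; rewrite mulr0 subr0. Qed.

Lemma Im_realM z x : complex.Im (z * x%:C) = complex.Im z * x.
Proof. by case: z => a b /=; rewrite mulr0 add0r. Qed.

Lemma Re_sum n (F : 'I_n -> C) :
  complex.Re (\sum_(k < n) F k) = \sum_(k < n) complex.Re (F k).
Proof. exact: (big_morph (@complex.Re R) ReD). Qed.

Lemma Im_sum n (F : 'I_n -> C) :
  complex.Im (\sum_(k < n) F k) = \sum_(k < n) complex.Im (F k).
Proof. exact: (big_morph (@complex.Im R) ImD). Qed.

Lemma normc_cvg_Re (u : nat -> C) l :
  (fun n => normc (l - u n)) @ \oo --> (0 : R) ->
  (fun n => complex.Re (u n)) @ \oo --> complex.Re l.
Proof.
move=> ul; apply/cvgrPdist_lt => e e0; move/cvgrPdist_lt : ul => /(_ e e0).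
apply: filterS => n; rewrite sub0r normrN ger0_norm ?normc_ge0//.
by apply: le_lt_trans; rewrite -ReB Re_le_normc.
Qed.

Lemma normc_cvg_Im (u : nat -> C) l :
  (fun n => normc (l - u n)) @ \oo --> (0 : R) ->
  (fun n => complex.Im (u n)) @ \oo --> complex.Im l.
Proof.
move=> ul; apply/cvgrPdist_lt => e e0; move/cvgrPdist_lt : ul => /(_ e e0).
apply: filterS => n; rewrite sub0r normrN ger0_norm ?normc_ge0//.
by apply: le_lt_trans; rewrite -ImB Im_le_normc.
Qed.

Lemma normc_cvg_lt (u : nat -> C) l (e : R) :
  (fun n => normc (l - u n)) @ \oo --> (0 : R) -> 0 < e ->
  exists N, forall n, (N <= n)%N -> normc (l - u n) < e.
Proof.
move=> ul e0; move/cvgrPdist_lt : ul => /(_ e e0)[N _ H]; exists N => n /H /=.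
by rewrite sub0r normrN ger0_norm ?normc_ge0.
Qed.

Lemma pseries_Re (c : nat -> C) x n :
  complex.Re (\sum_(k < n) c k * x%:C ^+ k) =
  pseries (fun k => complex.Re (c k)) x n.
Proof.
rewrite /pseries /series /= big_mkord Re_sum.
by apply: eq_bigr => k _; rewrite -rmorphXn Re_realM.
Qed.

Lemma pseries_Im (c : nat -> C) x n :
  complex.Im (\sum_(k < n) c k * x%:C ^+ k) =
  pseries (fun k => complex.Im (c k)) x n.
Proof.
rewrite /pseries /series /= big_mkord Im_sum.
by apply: eq_bigr => k _; rewrite -rmorphXn Im_realM.
Qed.

Lemma real_taylor f (g : R -> R) r : 0 < r ->
  (forall z, normc z < r -> cdiff f z) ->
  (forall x, `|x| < r -> f x%:C = (g x)%:C) ->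
  exists c : R^nat, forall x, `|x| < r -> pseries c x @ \oo --> g x.
Proof.
move=> r0 df fg; have [c hc] := taylor r0 df.
exists (fun k => complex.Re (c k)) => x xr.
have := hc x%:C; rewrite normc_real => /(_ xr) /normc_cvg_Re.
rewrite fg//= => H; apply: cvg_trans H; apply: near_eq_cvg.
by apply: nearW => n; rewrite pseries_Re.
Qed.

(** The real and imaginary parts of the Taylor coefficients are those of power
    series that vanish on an interval. *)
Lemma disc_identity f r : 0 < r -> (forall z, normc z < r -> cdiff f z) ->
  (forall x, `|x| < r -> f x%:C = 0) -> forall z, normc z < r -> f z = 0.
Proof.
move=> r0 df f0; have [c hc] := taylor r0 df.
have zero (e : R^nat) : (forall x, `|x| < r -> pseries e x @ \oo --> 0) ->
    forall n, e n = 0.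
  move=> e0 n; apply: (@pseries_lead R e (fun=> 0) 0 n r r0 _ _).2.
    by move=> x xr _; rewrite mulr0; exact: e0.
  exact: cvg_cst.
have c0 n : c n = 0.
  apply/eqP; rewrite eq_complex /=; apply/andP; split; apply/eqP.
    apply: (zero (fun n => complex.Re (c n))) => x xr.
    have := hc x%:C; rewrite normc_real => /(_ xr) /normc_cvg_Re.
    rewrite f0//= => H; apply: cvg_trans H; apply: near_eq_cvg.
    by apply: nearW => k; rewrite pseries_Re.
  apply: (zero (fun n => complex.Im (c n))) => x xr.
  have := hc x%:C; rewrite normc_real => /(_ xr) /normc_cvg_Im.
  rewrite f0//= => H; apply: cvg_trans H; apply: near_eq_cvg.
  by apply: nearW => k; rewrite pseries_Im.
move=> z /hc H; apply: eq0_normc.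
apply: (norm_cvg_unique _ H); apply: cvg_near_cst; apply: nearW => n.
by rewrite big1 ?subr0// => k _; rewrite c0 mul0r.
Qed.

(** [t |-> l / (1 - t)] maps the unit disc onto the half-plane
    [Re z > l / 2], with inverse [z |-> 1 - l / z]. *)
Lemma moebius_disc (l : R) z : 0 < l -> l / 2 < complex.Re z ->
  normc (1 - l%:C / z) < 1.
Proof.
move=> l0 lz.
have zgt : 0 < complex.Re z by rewrite (lt_trans _ lz)// divr_gt0.
have z0 : z != 0 by apply: contraTneq zgt => ->; rewrite ltxx.
have -> : 1 - l%:C / z = (z - l%:C) / z by rewrite mulrBl divff.
rewrite normcM normcV ltr_pdivrMr ?normc_gt0// mul1r.
case: z lz zgt z0 => a b /= lz a0 _.
rewrite /normc /= ltr_sqrt; last by rewrite ltr_pwDl// ?exprn_gt0// sqr_ge0.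
rewrite oppr0 addr0 ltrD2r; have : 0 < l * (2 * a - l).
  by rewrite mulr_gt0// subr_gt0; lra.
by move=> h; rewrite -subr_gt0 (_ : _ - _ = l * (2 * a - l)); last ring.
Qed.

Lemma moebius_half_plane (l : R) w : 0 < l -> normc w < 1 ->
  l / 2 < complex.Re (l%:C / (1 - w)).
Proof.
case: w => a b l0; rewrite /normc -[X in _ < X]sqrtr1 ltr_sqrt ?ltr01// => ab1.
have n0 : 0 < (1 - a) ^+ 2 + (- b) ^+ 2.
  rewrite lt_neqAle addr_ge0 ?sqr_ge0// andbT eq_sym paddr_eq0 ?sqr_ge0//.
  apply/negP => /andP[]; rewrite !sqrf_eq0 subr_eq0 oppr_eq0 => /eqP a1 /eqP b0.
  by move: ab1; rewrite -a1 b0 expr1n expr0n addr0 ltxx.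
have -> : complex.Re (l%:C / (1 - a +i* b)) =
    l * ((1 - a) / ((1 - a) ^+ 2 + (- b) ^+ 2)).
  by rewrite /= sub0r mul0r subr0.
rewrite ltr_pM2l// ltr_pdivlMr// ltr_pdivrMl// sqrrN.
by rewrite -subr_gt0 (_ : _ - _ = 1 - (a ^+ 2 + b ^+ 2)) ?subr_gt0//; ring.
Qed.

(** Two functions holomorphic on a half-plane that agree on its real points
    are equal there: pulled back to the unit disc, their difference has a
    Taylor series that vanishes on the diameter. *)
Lemma half_plane_identity f g (s : R) : 0 < s ->
  (forall z, s < complex.Re z -> cdiff f z) ->
  (forall z, s < complex.Re z -> cdiff g z) ->
  (forall x, s < x -> f x%:C = g x%:C) ->
  forall z, s < complex.Re z -> f z = g z.
Proof.
move=> s0 df dg fg z sz; pose l := s + s.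
have l0 : 0 < l by rewrite addr_gt0.
have l2 : l / 2 = s by rewrite /l; field.
pose p w := l%:C / (1 - w).
have pw w : normc w < 1 -> s < complex.Re (p w).
  by move=> w1; rewrite -l2; exact: moebius_half_plane.
have dp w : normc w < 1 -> cdiff p w.
  move=> w1; apply: cdiffM; first exact: cdiff_cst.
  apply: (@cdiffV _ (fun w => 1 - w)).
    by rewrite subr_eq0; apply: contraTneq w1 => <-; rewrite normc1 ltxx.
  by apply: cdiffB; [exact: cdiff_cst|exact: cdiff_id].
have H : forall w, normc w < 1 -> f (p w) - g (p w) = 0.
  apply: (@disc_identity (fun w => f (p w) - g (p w)) 1 ltr01) => [w w1|x x1].
    have dfw := df (p w) (pw w w1); have dgw := dg (p w) (pw w w1).
    apply: (@cdiffB _ (fun w => f (p w)) (fun w => g (p w))).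
      exact: (cdiff_comp (dp w w1) dfw).
    exact: (cdiff_comp (dp w w1) dgw).
  have := pw x%:C; rewrite normc_real => /(_ x1).
  have -> : p x%:C = (l / (1 - x))%:C.
    by rewrite /p rmorphM fmorphV rmorphB.
  by move=> /fg ->; rewrite subrr.
have := H (1 - l%:C / z) (moebius_disc l0 _); rewrite l2 => /(_ sz).
have z0 : z != 0.
  by apply: contraTneq sz => ->; rewrite -leNgt ltW.
have -> : p (1 - l%:C / z) = z.
  by rewrite /p subKr invf_div mulrC divfK// fmorph_eq0 gt_eqF.
by move/eqP; rewrite subr_eq0 => /eqP.
Qed.

(** * Power series with real coefficients as complex functions *)

(** Limits of the real and of the imaginary part, each of which is a real
    series. *)
Definition real_pseries (b : R^nat) z : C :=
  limn (fun n => \sum_(k < n) b k * complex.Re (z ^+ k)) +i*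
  limn (fun n => \sum_(k < n) b k * complex.Im (z ^+ k)).

(** Convergence radius at least [rho], tested on nonnegative reals only; as an
    absolute convergence it transfers to all complex points of the disc. *)
Definition abs_cvg_disc (b : R^nat) (rho : R) :=
  forall x, 0 <= x < rho -> cvgn (pseries (fun k => `|b k|) x).

Lemma real_pseries_cvg b rho z : abs_cvg_disc b rho -> normc z < rho ->
  (fun n => normc (real_pseries b z - \sum_(k < n) (b k)%:C * z ^+ k))
    @ \oo --> (0 : R).
Proof.
move=> hb zr.
have part (q : C -> R) : (forall w, `|q w| <= normc w) ->
    (fun n => \sum_(k < n) b k * q (z ^+ k)) @ \oo -->
    limn (fun n => \sum_(k < n) b k * q (z ^+ k)).
  move=> hq; have -> : (fun n => \sum_(k < n) b k * q (z ^+ k)) =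
      series (fun k => b k * q (z ^+ k)).
    by apply/funext => n; rewrite /series /= big_mkord.
  apply: normed_cvg; rewrite /normed_series_of /=.
  apply: series_le_cvg (hb (normc z) _); rewrite ?normc_ge0 ?zr//= => n.
  - by rewrite mulr_ge0// exprn_ge0// normc_ge0.
  - by rewrite normrM ler_wpM2l// -normcX.
have hR := part _ (@Re_le_normc R); have hI := part _ (@Im_le_normc R).
set lR := limn _ in hR; set lI := limn _ in hI.
apply: (@squeeze_cvgr _ _ _ _ (fun=> 0) (fun n =>
  `|lR - \sum_(k < n) b k * complex.Re (z ^+ k)| +
  `|lI - \sum_(k < n) b k * complex.Im (z ^+ k)|)).
- apply: nearW => n; rewrite normc_ge0 (le_trans (normc_le_ReIm _))//.
  rewrite ReB ImB Re_sum Im_sum /real_pseries /= -/lR -/lI.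
  by rewrite lerD//; under eq_bigr do rewrite mulrC (Re_realM, Im_realM) mulrC.
- exact: cvg_cst.
- have nrm (u : R^nat) l : u @ \oo --> l -> (fun n => `|l - u n|) @ \oo --> (0 : R).
    move=> ul; have : (fun n => `|l - u n|) @ \oo --> `|l - l|.
      by apply: cvg_norm; apply: cvgB => //; exact: cvg_cst.
    by rewrite subrr normr0.
  have H := cvgD (nrm _ _ hR) (nrm _ _ hI); rewrite (addr0 (0 : R)) in H.
  exact: H.
Qed.

Lemma normc_sum n (F : 'I_n -> C) :
  normc (\sum_(k < n) F k) <= \sum_(k < n) normc (F k).
Proof.
elim: n F => [|n IH] F; first by rewrite !big_ord0 normc0.
by rewrite !big_ord_recr /= (le_trans (le_normcD _ _))// lerD2r.
Qed.

(** Second order Taylor remainder of a power. The factor [r ^+ 2] stands on the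
    left so that no exponent [n - 2] occurs. *)
Lemma exprD_remainder z k n (r : R) : normc z <= r -> normc (z + k) <= r ->
  r ^+ 2 * normc ((z + k) ^+ n - z ^+ n - n%:R * z ^+ n.-1 * k) <=
  (n ^ 2)%:R * r ^+ n * normc k ^+ 2.
Proof.
move=> zr zkr; have r0 : 0 <= r := le_trans (normc_ge0 z) zr.
have first m : r * normc ((z + k) ^+ m - z ^+ m) <= m%:R * r ^+ m * normc k.
  elim: m => [|m IH]; first by rewrite !expr0 subrr normc0 mulr0 !mul0r.
  have -> : (z + k) ^+ m.+1 - z ^+ m.+1 =
      (z + k) * ((z + k) ^+ m - z ^+ m) + k * z ^+ m by rewrite !exprS; ring.
  rewrite (le_trans (ler_wpM2l r0 (le_normcD _ _)))// !normcM normcX mulrDr.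
  have h1 : r * (normc (z + k) * normc ((z + k) ^+ m - z ^+ m)) <=
      r * (m%:R * r ^+ m * normc k).
    rewrite mulrCA ler_pM ?mulr_ge0 ?normc_ge0//.
  have h2 : r * (normc k * normc z ^+ m) <= r * (normc k * r ^+ m).
    by rewrite !ler_wpM2l ?normc_ge0// lerXn2r// nnegrE normc_ge0.
  rewrite (le_trans (lerD h1 h2))// -natr1 exprS le_eqVlt; apply/orP; left.
  by apply/eqP; ring.
elim: n => [|n IH].
  by rewrite !expr0 subrr !mul0r subr0 normc0 mulr0.
have -> : (z + k) ^+ n.+1 - z ^+ n.+1 - n.+1%:R * z ^+ n.+1.-1 * k =
    z * ((z + k) ^+ n - z ^+ n - n%:R * z ^+ n.-1 * k) + k * ((z + k) ^+ n - z ^+ n).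
  case: n {IH} => [|n]; first by rewrite !expr1 !expr0; ring.
  by rewrite /= -!natr1 !exprS; ring.
rewrite (le_trans (ler_wpM2l _ (le_normcD _ _)))// ?exprn_ge0// !normcM mulrDr.
have h1 : r ^+ 2 * (normc z * normc ((z + k) ^+ n - z ^+ n - n%:R * z ^+ n.-1 * k)) <=
    r * ((n ^ 2)%:R * r ^+ n * normc k ^+ 2).
  by rewrite mulrCA ler_pM ?mulr_ge0 ?normc_ge0 ?exprn_ge0.
have h2 : r ^+ 2 * (normc k * normc ((z + k) ^+ n - z ^+ n)) <=
    r * normc k * (n%:R * r ^+ n * normc k).
  have -> : r ^+ 2 * (normc k * normc ((z + k) ^+ n - z ^+ n)) =
    r * normc k * (r * normc ((z + k) ^+ n - z ^+ n)) by ring.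
  by rewrite ler_wpM2l// mulr_ge0// normc_ge0.
rewrite (le_trans (lerD h1 h2))//.
have -> : r * ((n ^ 2)%:R * r ^+ n * normc k ^+ 2) + r * normc k * (n%:R * r ^+ n * normc k)
   = (n ^ 2 + n)%:R * r ^+ n.+1 * normc k ^+ 2 by rewrite natrD (exprS r); ring.
rewrite ler_wpM2r ?exprn_ge0 ?normc_ge0// ler_wpM2r ?exprn_ge0// ler_nat.
by rewrite !expnS !expn0; lia.
Qed.

Lemma abs_cvg_diffs b rho : abs_cvg_disc b rho -> abs_cvg_disc (pseries_diffs b) rho.
Proof.
move=> hb x /andP[x0 xr].
have := @is_cvg_pseries_diffs R (fun k => `|b k|) rho.
have -> : pseries_diffs (fun k => `|b k|) = (fun k => `|pseries_diffs b k|).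
  by apply/funext => k; rewrite /pseries_diffs normrM normr_nat.
apply; last by rewrite ger0_norm.
move=> y yr; have /= hy := hb `|y|; rewrite normr_ge0 yr in hy.
apply: normed_cvg; rewrite /normed_series_of /=.
have -> : (fun n => `| `|b n| * y ^+ n|) = (fun n => `|b n| * `|y| ^+ n).
  by apply/funext => n; rewrite normrM normr_id normrX.
exact: hy isT.
Qed.

Lemma abs_cvg_mulrn b rho :
  abs_cvg_disc b rho -> abs_cvg_disc (fun n => n%:R * b n) rho.
Proof.
move=> /abs_cvg_diffs hb x xr; have /cvg_ex[/= l hl] := hb x xr.
apply/cvg_ex; exists (x * l); rewrite -cvg_shiftS.
have -> : (fun n => pseries (fun k => `|k%:R * b k|) x n.+1) =
    (fun n => x * pseries (fun k => `|pseries_diffs b k|) x n).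
  apply/funext => n; rewrite /pseries /series /= big_nat_recl//=.
  rewrite mul0r normr0 mul0r add0r mulr_sumr; apply: eq_bigr => k _.
  by rewrite /pseries_diffs exprS mulrCA.
exact: cvgMl_tmp.
Qed.

(** Summing [exprD_remainder] over the series: the increment differs from the
    formal derivative by at most a constant times [normc k ^+ 2]. *)
Lemma real_pseries_differentiable b rho z : abs_cvg_disc b rho -> normc z < rho ->
  cdiff (real_pseries b) z.
Proof.
move=> hb zr; have hb1 := abs_cvg_diffs hb; have hb2 := abs_cvg_diffs hb1.
apply/differentiable_epsP; exists (real_pseries (pseries_diffs b) z).
have [r zr' rr] : exists2 r, normc z < r & r < rho.
  by exists ((normc z + rho) / 2); rewrite ?midf_lt.
have r0 : 0 < r := le_lt_trans (normc_ge0 z) zr'.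
pose S := limn (series (fun n => `|b n| * (n ^ 2)%:R * r ^+ n)).
have cS : cvgn (series (fun n => `|b n| * (n ^ 2)%:R * r ^+ n)).
  have -> : (fun n => `|b n| * (n ^ 2)%:R * r ^+ n) =
      (fun n => `|n%:R * (n%:R * b n)| * r ^+ n).
    apply/funext => n.
    by rewrite !normrM normr_nat mulrA -natrM mulnn [_ * `|b n|]mulrC.
  by apply: (abs_cvg_mulrn (abs_cvg_mulrn hb)); rewrite (ltW r0) rr.
have hS n : series (fun n => `|b n| * (n ^ 2)%:R * r ^+ n) n <= S.
  apply: nondecreasing_cvgn_le => //; apply: nondecreasing_series => k _ _.
  by rewrite !mulr_ge0// exprn_ge0// ltW.
have r20 : 0 <= r ^+ 2 by exact: sqr_ge0.
have S0 : 0 <= S by rewrite (le_trans _ (hS 0%N))// /series /= big_geq.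
have key k : normc k <= r - normc z -> r ^+ 2 * normc (real_pseries b (z + k) -
    real_pseries b z - real_pseries (pseries_diffs b) z * k) <= S * normc k ^+ 2.
  move=> hk.
  have zkr : normc (z + k) <= r.
    by rewrite (le_trans (le_normcD _ _))// addrC -lerBrDr.
  have zkrho := le_lt_trans zkr rr.
  have c1 := real_pseries_cvg hb zkrho.
  have c2 := real_pseries_cvg hb zr.
  have c3 := real_pseries_cvg hb1 zr.
  set f1 := real_pseries b (z + k) in c1 *.
  set f2 := real_pseries b z in c2 *.
  set f3 := real_pseries (pseries_diffs b) z in c3 *.
  apply/ler_addgt0Pl => e e0.
  pose e' := e / (r ^+ 2 * (2 + normc k)).
  have w0 : 0 < r ^+ 2 * (2 + normc k).
    by rewrite mulr_gt0 ?exprn_gt0// ltr_pwDl// normc_ge0.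
  have e'0 : 0 < e' by rewrite divr_gt0.
  have [M1 {}c1] := normc_cvg_lt c1 e'0; have [M2 {}c2] := normc_cvg_lt c2 e'0.
  have [M3 {}c3] := normc_cvg_lt c3 e'0.
  pose N := maxn M1 (maxn M2 M3).
  have N1 := c1 N.+1 (leq_trans (leq_maxl _ _) (leqnSn _)).
  have N2 := c2 N.+1 (leq_trans (leq_trans (leq_maxl _ _) (leq_maxr _ _)) (leqnSn _)).
  have N3 := c3 N (leq_trans (leq_maxr _ _) (leq_maxr _ _)).
  clear c1 c2 c3; move: (N) N1 N2 N3 => {}N N1 N2 N3.
  set s1 := \sum_(j < _) _ in N1; set s2 := \sum_(j < _) _ in N2.
  set s3 := \sum_(j < _) _ in N3.
  have s3E : s3 = \sum_(j < N.+1) (b j)%:C * (j%:R * z ^+ j.-1).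
    rewrite big_ord_recl /= !mul0r mulr0 add0r; apply: eq_bigr => j _.
    rewrite /pseries_diffs /bump /= add1n rmorphM rmorph_nat /=; ring.
  have fin : r ^+ 2 * normc (s1 - s2 - s3 * k) <= S * normc k ^+ 2.
    have -> : s1 - s2 - s3 * k = \sum_(j < N.+1) (b j)%:C *
        ((z + k) ^+ j - z ^+ j - j%:R * z ^+ j.-1 * k).
      rewrite s3E mulr_suml -!sumrB; apply: eq_bigr => j _; ring.
    rewrite (le_trans (ler_wpM2l r20 (normc_sum _)))//.
    rewrite mulr_sumr.
    apply: (@le_trans _ _ (series (fun n => `|b n| * (n ^ 2)%:R * r ^+ n) N.+1 * normc k ^+ 2)).
      rewrite /series /= big_mkord mulr_suml; apply: ler_sum => j _.
      rewrite normcM normc_real mulrCA -2![leRHS]mulrA ler_wpM2l//.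
      rewrite [leRHS]mulrA.
      by apply: exprD_remainder => //; exact: ltW.
    by rewrite ler_wpM2r ?exprn_ge0 ?normc_ge0.
  clear s3E; clearbody f1 f2 f3 s1 s2 s3.
  have -> : f1 - f2 - f3 * k = (s1 - s2 - s3 * k) +
      ((f1 - s1) - (f2 - s2) - (f3 - s3) * k) by ring.
  rewrite (le_trans (ler_wpM2l r20 (le_normcD _ _)))// mulrDr.
  rewrite addrC lerD//.
  have -> : e = r ^+ 2 * (e' + e' + e' * normc k).
    have wn : r ^+ 2 * (2 + normc k) != 0 by rewrite gt_eqF.
    by rewrite -(divfK wn e) -/e'; ring.
  rewrite ler_wpM2l//.
  rewrite (le_trans (le_normcD _ _))// normcN lerD//.
    by rewrite (le_trans (le_normcD _ _))// normcN lerD// ltW.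
  by rewrite normcM ler_wpM2r ?normc_ge0// ltW.
move=> e e0; pose d := Num.min (r - normc z) (e * r ^+ 2 / (S + 1)).
have S1 : 0 < S + 1 by rewrite ltr_wpDl.
exists d; first by rewrite lt_min subr_gt0 zr' divr_gt0// mulr_gt0// exprn_gt0.
move=> k; rewrite lt_min => /andP[/ltW/key H ke].
have r2 : 0 < r ^+ 2 by rewrite exprn_gt0.
rewrite -(ler_pM2l r2) (le_trans H)// expr2 !mulrA ler_wpM2r ?normc_ge0//.
rewrite ltr_pdivlMr// in ke; rewrite (mulrC _ e) (le_trans _ (ltW ke))//.
by rewrite mulrDr mulr1 mulrC lerDl normc_ge0.
Qed.

End HolomorphicReal.

(** * Expansions in powers of 1 - l / z *)

Section MoebiusExpansion.
Variable R : realType.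
Local Notation C := R[i].
Local Notation cdiff f z := (differentiable (f : C^o -> C^o) (z : C^o)).
Implicit Types (h : R -> R) (H : C -> C) (b c : R^nat) (x t l : R).

Lemma pseries_tail c x s n : x != 0 -> pseries c x @ \oo --> s ->
  pseries (fun k => c (n + k)%N) x @ \oo -->
    (s - \sum_(k < n) c k * x ^+ k) / x ^+ n.
Proof.
move=> x0; elim: n => [|n IH] cs.
  by rewrite big_ord0 subr0 expr0 divr1.
have := pseries_behead x0 (IH cs); rewrite addn0.
rewrite (_ : (fun k => c (n + k.+1)%N) = (fun k => c (n.+1 + k)%N)); last first.
  by apply/funext => k; rewrite addnS.
rewrite big_ord_recr /= exprSr.
have xn0 : x ^+ n != 0 by rewrite expf_neq0.
rewrite (_ : (_ / _ - c n) / x =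
  (s - (\sum_(k < n) c k * x ^+ k + c n * x ^+ n)) / (x ^+ n * x))//.
by field; rewrite x0 xn0.
Qed.

Lemma pseries_poly (p : {poly R}) x :
  pseries (fun k => p`_k) x @ \oo --> p.[x].
Proof.
apply: cvg_near_cst; near=> n; rewrite /pseries /series /= big_mkord.
by rewrite (@horner_coef_wide _ n)//; near: n; exact: nbhs_infty_ge.
Unshelve. all: by end_near. Qed.

Lemma pseriesB b c x s s' : pseries b x @ \oo --> s -> pseries c x @ \oo --> s' ->
  pseries (fun k => b k - c k) x @ \oo --> s - s'.
Proof.
move=> bs cs; have -> : pseries (fun k => b k - c k) x =
    (fun n => pseries b x n - pseries c x n).
  apply/funext => n; rewrite /pseries /series /= -sumrB.
  by apply: eq_bigr => k _; rewrite mulrBl.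
exact: cvgB.
Qed.

(** In the variable [x = l - a], [l ^ (n - 1) * h l] is a polynomial of degree
    less than [n] plus [x ^+ n] times a function with value [b n / a] at
    [x = 0]: the terms of index below [n] in the expansion of [h] in powers of
    [1 - a / l] lose their denominators against [l ^ (n - 1)]. *)
Lemma derive1n_moebius h H (a : R) b n : 0 < a ->
  (forall z, 0 < complex.Re z -> cdiff H z) ->
  (forall x, 0 < x -> H x%:C = (h x)%:C) ->
  (forall t, `|t| < 1 -> pseries b t @ \oo --> h (a / (1 - t))) ->
  a * derive1n n (fun l : R => l ^ (n%:Z - 1) * h l) a = n`!%:R * b n.
Proof.
move=> a0 dH Hh bh; pose g l := l ^ (n%:Z - 1) * h l.
have gE l : 0 < l -> g l = l ^+ n / l * h l.
  by move=> l0; rewrite /g expfzDr ?gt_eqF.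
pose F w := (a%:C + w) ^+ n * (a%:C + w)^-1 * H (a%:C + w).
have dF w : normc w < a -> cdiff F w.
  move=> wa; have da : cdiff (fun w => a%:C + w) w.
    by apply: (@cdiffD _ (fun=> a%:C)); [exact: cdiff_cst|exact: cdiff_id].
  have aw : 0 < complex.Re (a%:C + w).
    rewrite ReD /= -ltrBlDl sub0r.
    by have := le_lt_trans (Re_le_normc w) wa; rewrite ltr_norml => /andP[].
  have aw0 : a%:C + w != 0 by apply: contraTneq aw => ->; rewrite ltxx.
  apply: cdiffM; last exact: (cdiff_comp da (dH _ aw)).
  by apply: cdiffM; [exact: cdiffX|exact: cdiffV].
have posD x : `|x| < a -> 0 < a + x.
  by rewrite ltr_norml => /andP[h1 h2]; rewrite -ltrBlDl sub0r.
have [c hc] : exists c, forall x, `|x| < a -> pseries c x @ \oo --> g (a + x).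
  apply: (real_taylor a0 dF) => x xa; rewrite gE ?posD// /F -rmorphD Hh ?posD//.
  by rewrite -rmorphXn -fmorphV -!rmorphM.
have -> : derive1n n g a = n`!%:R * c n.
  apply: (@derive1n_pseries R c g a a n a0) => x xa.
  by have := hc _ xa; rewrite (addrC a) subrK.
suff -> : c n = b n / a by rewrite mulrCA [a * _]mulrC divfK ?gt_eqF.
(* The terms of index below [n] of the expansion of [h], multiplied by
   [l ^ (n - 1)] and written in the variable [x = l - a]. *)
pose P : {poly R} := \sum_(k < n) (b k)%:P * ('X^k * (a%:P + 'X) ^+ (n.-1 - k)).
have sizeP : (size P <= n)%N.
  apply: (leq_trans (size_sum _ _ _)); apply/bigmax_leqP => k _.
  rewrite mul_polyC (leq_trans (size_scale_leq _ _))//.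
  rewrite (leq_trans (size_polyMleq _ _))// size_polyXn addSn /=.
  rewrite (leq_trans (leq_add (leqnn _) (size_poly_exp_leq _ _)))//.
  by rewrite addrC size_XaddC mul1n; have := ltn_ord k; lia.
have PE x : 0 < a + x ->
    P.[x] = (a + x) ^+ n / (a + x) * \sum_(k < n) b k * (x / (a + x)) ^+ k.
  move=> ax0; rewrite /P horner_sum mulr_sumr; apply: eq_bigr => k _.
  rewrite !hornerE exprMn exprVn.
  have -> : (a + x) ^+ n = (a + x) * (a + x) ^+ k * (a + x) ^+ (n.-1 - k).
    by rewrite -exprS -exprD; congr (_ ^+ _); have := ltn_ord k; lia.
  have ax := gt_eqF ax0.
  have axk : (a + x) ^+ k != 0 by rewrite expf_neq0// ax.
  change (b k * x ^+ k * (a + x) ^+ (n.-1 - k) =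
    (a + x) * (a + x) ^+ k * (a + x) ^+ (n.-1 - k) / (a + x) * b k *
    (x ^+ k / (a + x) ^+ k)).
  by field; rewrite axk ax.
pose e j := c j - P`_j.
(* The other terms, divided by [t ^+ n]. *)
pose T t := (h (a / (1 - t)) - \sum_(k < n) b k * t ^+ k) / t ^+ n.
have Tb : T t @[t --> 0^'] --> b n.
  have -> : b n = b (n + 0)%N by rewrite addn0.
  apply: (@pseries_continuous0 R (fun k => b (n + k)%N) T 1 ltr01) => t t1 t0.
  by apply: pseries_tail => //; exact: bh.
have a2 : 0 < a / 2 by rewrite divr_gt0.
have eb : forall x, `|x| < a / 2 -> x != 0 ->
    pseries e x @ \oo --> x ^+ n * ((a + x)^-1 * T (x / (a + x))).
  move=> x xa x0; have xa' : `|x| < a.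
    by rewrite (lt_trans xa)// ltr_pdivrMr// ltr_pMr// ltr1n.
  have ax0 := posD x xa'.
  have -> : x ^+ n * ((a + x)^-1 * T (x / (a + x))) = g (a + x) - P.[x].
    rewrite gE// PE// /T.
    have -> : a / (1 - x / (a + x)) = a + x.
      by field; rewrite ?(gt_eqF a0) ?(gt_eqF ax0) ?addrK ?(gt_eqF a0).
    rewrite -mulrBr exprMn exprVn.
    have axn : (a + x) ^+ n != 0 by rewrite expf_neq0// gt_eqF.
    have xn : x ^+ n != 0 by rewrite expf_neq0.
    by field; rewrite xn axn gt_eqF.
  by apply: pseriesB; [exact: hc|exact: pseries_poly].
have lim : (a + x)^-1 * T (x / (a + x)) @[x --> 0^'] --> a^-1 * b n.
  apply: cvgM.
    have : {for 0, continuous (fun x => (a + x)^-1)}.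
      apply: cvgV; first by rewrite addr0 gt_eqF.
      by apply: cvgD; [exact: cvg_cst|exact: cvg_id].
    by move=> /continuous_withinNx; rewrite addr0.
  apply/cvgrPdist_lt => eps eps0; move/cvgrPdist_lt : Tb => /(_ _ eps0).
  case/nbhs_ballP => d /= d0 Hd.
  apply/nbhs_ballP; exists (Num.min (a / 2) (d * (a / 2))) => /=.
    by rewrite lt_min a2 mulr_gt0.
  move=> x; rewrite /ball /= sub0r normrN lt_min => /andP[xa xd] x0.
  have ax : a / 2 < a + x.
    by move: xa; rewrite ltr_norml => /andP[h1 h2]; lra.
  have ax0 := lt_trans a2 ax.
  apply: Hd; last by rewrite mulf_neq0// invr_neq0// gt_eqF.
  rewrite /ball /= sub0r normrN normrM normfV (gtr0_norm ax0) ltr_pdivrMr//.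
  by rewrite (lt_trans xd)// ltr_pM2l.
have [_] := pseries_lead a2 eb lim.
by rewrite /e (nth_default _ sizeP) subr0 mulrC.
Qed.

(** Each expansion defines a holomorphic function on its own half-plane; on
    overlaps they agree since they agree on the real axis, so evaluating at
    [z] the expansion centred at [Re z] gives one holomorphic function. *)
Lemma holomorphic_extension h (b : R -> R^nat) :
  (forall l, 0 < l -> abs_cvg_disc (b l) 1) ->
  (forall l t, 0 < l -> `|t| < 1 -> pseries (b l) t @ \oo --> h (l / (1 - t))) ->
  exists H, (forall z, 0 < complex.Re z -> cdiff H z) /\
    forall x, 0 < x -> H x%:C = (h x)%:C.
Proof.
move=> hb bh; pose K l z := real_pseries (b l) (1 - l%:C / z).
have dK l z : 0 < l -> l / 2 < complex.Re z -> cdiff (K l) z.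
  move=> l0 lz; have z0 : z != 0.
    by apply: contraTneq lz => ->; rewrite -leNgt ltW// divr_gt0.
  apply: (@cdiff_comp _ (fun z => 1 - l%:C / z)).
    apply: cdiffB; first exact: cdiff_cst.
    apply: cdiffM; first exact: cdiff_cst.
    by apply: (@cdiffV _ (fun z => z)) => //; exact: cdiff_id.
  by apply: (real_pseries_differentiable (hb l l0)); exact: moebius_disc.
have Kh l x : 0 < l -> l / 2 < x -> K l x%:C = (h x)%:C.
  move=> l0 lx; have x0 : 0 < x by rewrite (lt_trans _ lx)// divr_gt0.
  have w1 := @moebius_disc R l x%:C l0 lx.
  have tE : 1 - l%:C / x%:C = (1 - l / x)%:C by rewrite rmorphB rmorphM fmorphV.
  have c := real_pseries_cvg (hb l l0) w1.
  rewrite /K tE in c *; rewrite tE normc_real in w1.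
  have lE : l / (1 - (1 - l / x)) = x.
    by rewrite subKr invf_div mulrC divfK// gt_eqF.
  have := bh l _ l0 w1; rewrite lE => hx.
  apply/eqP; rewrite eq_complex /=; apply/andP; split; apply/eqP.
    apply: (norm_cvg_unique _ hx); apply: cvg_trans (normc_cvg_Re c).
    apply: near_eq_cvg; apply: nearW => n /=.
    by rewrite (pseries_Re (fun k => (b l k)%:C)).
  apply: (norm_cvg_unique (normc_cvg_Im c)).
  apply: cvg_near_cst; apply: nearW => n.
  rewrite (pseries_Im (fun k => (b l k)%:C)) /pseries /series /= big1// => k _.
  by rewrite mul0r.
have KK l l' z : 0 < l -> 0 < l' -> l / 2 < complex.Re z -> l' / 2 < complex.Re z ->
    K l z = K l' z.
  move=> l0 l0' lz lz'.
  apply: (@half_plane_identity R (K l) (K l') (Num.max (l / 2) (l' / 2))).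
  - by rewrite lt_max divr_gt0.
  - by move=> w; rewrite gt_max => /andP[? ?]; exact: dK.
  - by move=> w; rewrite gt_max => /andP[? ?]; exact: dK.
  - by move=> x; rewrite gt_max => /andP[? ?]; rewrite !Kh.
  - by rewrite gt_max lz.
have half x : 0 < x -> x / 2 < x.
  by move=> x0; rewrite ltr_pdivrMr// ltr_pMr// ltr1n.
exists (fun z => K (complex.Re z) z); split => [z z0|x x0]; last first.
  by rewrite /= Kh//; exact: half.
have r0 : 0 < complex.Re z / 2 by rewrite divr_gt0.
apply: (@near_eq_cdiff _ (K (complex.Re z)) _ _ z r0); last first.
  by apply: dK => //; exact: half.
move=> k kr; have zk : complex.Re z / 2 < complex.Re (z + k).
  rewrite ReD; have := le_lt_trans (Re_le_normc k) kr.
  by rewrite ltr_norml => /andP[h1 h2]; lra.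
have zk0 := lt_trans r0 zk.
by apply: KK => //; exact: half.
Qed.

End MoebiusExpansion.

(** * Orthonormal systems of square integrable functions *)

Section SquareIntegrable.
Context d (T : measurableType d) (R : realType).
Variables (mu : {measure set T -> \bar R}) (D : set T).
Hypothesis mD : measurable D.
Implicit Types (f g : T -> R) (phi : nat -> T -> R).

Lemma integrable_sumr n (f : nat -> T -> R) :
  (forall k, mu.-integrable D (EFin \o f k)) ->
  mu.-integrable D (EFin \o (fun x => \sum_(k < n) f k x)).
Proof.
move=> fi; have : mu.-integrable D (fun x => \sum_(k < n) (f k x)%:E)%E.
  by apply: integrable_sum => // k _; exact: fi.
by apply: eq_integrable => // x _; rewrite sumEFin.
Qed.

Lemma Rintegral_sumr n (f : nat -> T -> R) :
  (forall k, mu.-integrable D (EFin \o f k)) ->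
  \int[mu]_(x in D) (\sum_(k < n) f k x) = \sum_(k < n) \int[mu]_(x in D) f k x.
Proof.
move=> fi; elim: n => [|n IH].
  rewrite big_ord0 (@eq_Rintegral _ _ _ mu D (fun=> 0)) => [|x _]; last by rewrite big_ord0.
  by rewrite Rintegral_cst// mul0r.
rewrite big_ord_recr /= -IH -RintegralD//; last exact: integrable_sumr.
by apply: eq_Rintegral => x _; rewrite big_ord_recr.
Qed.

Definition sqint f := measurable_fun D f /\
  (\int[mu]_(x in D) (f x ^+ 2)%:E < +oo)%E.

Definition ip f g : R := \int[mu]_(x in D) (f x * g x).

Lemma sqint_sqr_integrable f : sqint f ->
  mu.-integrable D (EFin \o (fun x => f x ^+ 2)).
Proof.
move=> [mf f2]; apply/integrableP; split.
  by apply/measurable_EFinP; exact: measurable_funX.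
rewrite (eq_integral (fun x => (f x ^+ 2)%:E))// => x _ /=.
by rewrite ger0_norm// sqr_ge0.
Qed.

Lemma sqr_integrable_sqint f : measurable_fun D f ->
  mu.-integrable D (EFin \o (fun x => f x ^+ 2)) -> sqint f.
Proof.
move=> mf /integrableP[_ f2]; split => //; apply: le_lt_trans f2.
by rewrite [leRHS](eq_integral (fun x => (f x ^+ 2)%:E))// => x _ /=; rewrite ger0_norm// sqr_ge0.
Qed.

Lemma sqint_mul f g : sqint f -> sqint g ->
  mu.-integrable D (EFin \o (fun x => f x * g x)).
Proof.
move=> sf sg; have f2 := sqint_sqr_integrable sf; have g2 := sqint_sqr_integrable sg.
apply: (le_integrable mD _ _ (integrableD mD f2 g2)) => [|x _].
  by apply/measurable_EFinP/measurable_funM; [case: sf|case: sg].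
rewrite /= lee_fin normrM [leRHS]ger0_norm; last by rewrite addr_ge0 ?sqr_ge0.
rewrite -(real_normK (num_real (f x))) -(real_normK (num_real (g x))).
have := sqr_ge0 (`|f x| - `|g x|); have := mulr_ge0 (normr_ge0 (f x)) (normr_ge0 (g x)).
rewrite sqrrB; lra.
Qed.

Lemma sqintD f g : sqint f -> sqint g -> sqint (fun x => f x + g x).
Proof.
move=> sf sg; apply: sqr_integrable_sqint.
  by apply: measurable_funD; [case: sf|case: sg].
have := integrableD mD (integrableD mD (sqint_sqr_integrable sf)
  (integrable_mulrl 2 mD (sqint_mul sf sg))) (sqint_sqr_integrable sg).
apply: eq_integrable => // x _ /=.
by rewrite sqrrD mulr_natl.
Qed.

Lemma sqintZ r f : sqint f -> sqint (fun x => r * f x).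
Proof.
move=> sf; apply: sqr_integrable_sqint.
  by apply: measurable_funM => //; case: sf.
have := integrable_mulrl (r ^+ 2) mD (sqint_sqr_integrable sf).
by apply: eq_integrable => // x _ /=; rewrite exprMn.
Qed.

Lemma sqint0 : sqint (fun=> 0).
Proof.
split; first exact: measurable_cst.
by rewrite (eq_integral (cst 0%E)) ?integral0 ?ltry// => x _; rewrite expr0n.
Qed.

Lemma sqintB f g : sqint f -> sqint g -> sqint (fun x => f x - g x).
Proof.
move=> sf sg; have := sqintD sf (sqintZ (-1) sg).
by under eq_fun do rewrite mulN1r.
Qed.

Lemma sqint_sum n phi (c : nat -> R) : (forall k, sqint (phi k)) ->
  sqint (fun x => \sum_(k < n) c k * phi k x).
Proof.
move=> sphi; elim: n => [|n IH].
  by under eq_fun do rewrite big_ord0; exact: sqint0.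
by under eq_fun do rewrite big_ord_recr /=; apply: sqintD => //; exact: sqintZ.
Qed.

Lemma ipC f g : ip f g = ip g f.
Proof. by apply: eq_Rintegral => x _; rewrite mulrC. Qed.

Lemma ipD f g h : sqint f -> sqint g -> sqint h ->
  ip (fun x => f x + g x) h = ip f h + ip g h.
Proof.
move=> sf sg sh; rewrite -RintegralD//; try exact: sqint_mul.
by apply: eq_Rintegral => x _; rewrite mulrDl.
Qed.

Lemma ipZ r f g : sqint f -> sqint g -> ip (fun x => r * f x) g = r * ip f g.
Proof.
move=> sf sg; rewrite -RintegralZl//; last exact: sqint_mul.
by apply: eq_Rintegral => x _; rewrite mulrA.
Qed.

Lemma ipB f g h : sqint f -> sqint g -> sqint h ->
  ip (fun x => f x - g x) h = ip f h - ip g h.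
Proof.
move=> sf sg sh; rewrite -mulN1r -ipZ// -ipD//; last exact: sqintZ.
by apply: eq_Rintegral => x _; rewrite mulN1r.
Qed.

Lemma ip_sum n phi (c : nat -> R) f : (forall k, sqint (phi k)) -> sqint f ->
  ip (fun x => \sum_(k < n) c k * phi k x) f = \sum_(k < n) c k * ip (phi k) f.
Proof.
move=> sphi sf; have i k := sqint_mul (sqintZ (c k) (sphi k)) sf.
transitivity (\sum_(k < n) ip (fun x => c k * phi k x) f); last first.
  by apply: eq_bigr => k _; rewrite ipZ.
rewrite -(@Rintegral_sumr n (fun k x => c k * phi k x * f x))//.
by apply: eq_Rintegral => x _; rewrite mulr_suml.
Qed.

Lemma ip_ge0 f : 0 <= ip f f.
Proof. by apply: Rintegral_ge0 => x _; rewrite -expr2 sqr_ge0. Qed.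

Lemma ip_self f : sqint f -> (\int[mu]_(x in D) (f x ^+ 2)%:E)%E = (ip f f)%:E.
Proof.
move=> sf; rewrite /ip /Rintegral fineK; first by apply: eq_integral => x _.
by apply: integrable_fin_num => //; exact: (sqint_mul sf sf).
Qed.

(** Used with a small [e] in place of the Cauchy-Schwarz inequality, of which
    it is the version without square roots. *)
Lemma ip_le f g (e : R) : sqint f -> sqint g -> 0 < e ->
  2 * `|ip f g| <= e * ip f f + ip g g / e.
Proof.
move=> sf sg e0.
have H (s : R) : s ^+ 2 = 1 -> 2 * (s * ip f g) <= e * ip f f + ip g g / e.
  move=> s1; have := ip_ge0 (fun x => e * f x - s * g x).
  have sef := sqintZ e sf; have ssg := sqintZ s sg.
  have sd := sqintB sef ssg; rewrite ipB// ipZ// ipZ//.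
  rewrite !(ipC _ (fun x => _ - _)) !ipB// !ipZ// (ipC g f) => h.
  have {}h : 0 <= e ^+ 2 * ip f f - 2 * e * (s * ip f g) + s ^+ 2 * ip g g by lra.
  rewrite s1 mul1r in h; rewrite -(ler_pM2l e0) -subr_ge0.
  rewrite (_ : _ - _ = e ^+ 2 * ip f f - 2 * e * (s * ip f g) + ip g g)//.
  by field; rewrite gt_eqF.
have [/ger0_norm ->|/ltW/ler0_norm ->] := leP 0 (ip f g).
  by have := H 1; rewrite expr1n mul1r; exact.
by have := H (-1); rewrite sqrrN expr1n mulN1r; exact.
Qed.

Definition orthonormal phi := (forall n, sqint (phi n)) /\
  forall m n, ip (phi m) (phi n) = (m == n)%:R.

Lemma ip_orthonormal_sum n phi (c : nat -> R) k : orthonormal phi ->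
  ip (fun x => \sum_(j < n) c j * phi j x) (phi k) = if (k < n)%N then c k else 0.
Proof.
move=> [sphi ophi]; rewrite (@ip_sum n phi c (phi k))//.
case: ltnP => kn.
  rewrite (bigD1 (Ordinal kn))//= ophi eqxx mulr1 big1 ?addr0// => j jk.
  by rewrite ophi (negbTE (_ : nat_of_ord j != k)) ?mulr0.
by rewrite big1// => j _; rewrite ophi ltn_eqF ?mulr0// (leq_trans _ kn).
Qed.

Lemma ip_projection_remainder n phi f : orthonormal phi -> sqint f ->
  ip (fun x => f x - \sum_(j < n) ip f (phi j) * phi j x)
     (fun x => f x - \sum_(j < n) ip f (phi j) * phi j x) =
  ip f f - \sum_(j < n) ip f (phi j) ^+ 2.
Proof.
move=> on sf; have sphi := on.1; pose S x := \sum_(j < n) ip f (phi j) * phi j x.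
have sS : sqint S := sqint_sum n (fun j => ip f (phi j)) sphi.
have sfS := sqintB sf sS.
have Sf : ip S f = \sum_(j < n) ip f (phi j) ^+ 2.
  rewrite (@ip_sum n phi (fun j => ip f (phi j)) f)//.
  by apply: eq_bigr => j _; rewrite (ipC (phi j)) expr2.
have SP j : (j < n)%N -> ip S (phi j) = ip f (phi j).
  by move=> jn; have := @ip_orthonormal_sum n phi (fun j => ip f (phi j)) j on;
    rewrite jn.
have SS : ip S S = \sum_(j < n) ip f (phi j) ^+ 2.
  rewrite {1}/S (@ip_sum n phi (fun j => ip f (phi j)) S)//.
  apply: eq_bigr => j _.
  by rewrite (ipC (phi j)) SP// expr2.
rewrite -/(S _) ipB// !(ipC _ (fun x => _ - _)) !ipB// SS Sf (ipC f S) Sf; ring.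
Qed.

Lemma bessel n phi f : orthonormal phi -> sqint f ->
  \sum_(j < n) ip f (phi j) ^+ 2 <= ip f f.
Proof.
by move=> on sf; rewrite -subr_ge0 -ip_projection_remainder//; exact: ip_ge0.
Qed.

(** Parseval's identity without completeness of the system: the error is the
    pairing of [f] with the remainder of [k], whose norm tends to zero as soon
    as the Fourier coefficients of [k] exhaust the norm of [k]. *)
Lemma ip_parseval phi f k : orthonormal phi -> sqint f -> sqint k ->
  (fun n => \sum_(j < n) ip k (phi j) ^+ 2) @ \oo --> ip k k ->
  (fun n => \sum_(j < n) ip f (phi j) * ip k (phi j)) @ \oo --> ip f k.
Proof.
move=> on sf sk ck; have sphi := on.1; apply/cvgrPdist_lt => e e0.
have A1 : 0 < ip f f + 1 by rewrite ltr_wpDl// ip_ge0.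
pose q := e / (ip f f + 1).
have q0 : 0 < q by rewrite divr_gt0.
move/cvgrPdist_lt : ck => /(_ (e * q) ltac:(by rewrite mulr_gt0)).
apply: filterS => n; set S := \sum_(j < n) _ ^+ 2 => hS.
pose r x := k x - \sum_(j < n) ip k (phi j) * phi j x.
have sS := sqint_sum n (fun j => ip k (phi j)) sphi.
have sr : sqint r by exact: sqintB.
have -> : ip f k - \sum_(j < n) ip f (phi j) * ip k (phi j) = ip f r.
  rewrite (ipC f r) ipB//.
  rewrite (@ip_sum n phi (fun j => ip k (phi j)) f)// (ipC f k); congr (_ - _).
  by apply: eq_bigr => j _; rewrite mulrC (ipC f).
have := ip_le sf sr q0; rewrite ip_projection_remainder// -/S => h.
have h1 : q * ip f f < e.
  by rewrite /q mulrAC -mulrA gtr_pMr// ltr_pdivrMr// mul1r ltrDl.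
have h2 : (ip k k - S) / q < e.
  by rewrite ltr_pdivrMr// (le_lt_trans (ler_norm _)).
lra.
Qed.

Lemma big_ord_sub (a : R^nat) n m : (n <= m)%N ->
  \sum_(j < m) a j - \sum_(j < n) a j = \sum_(j < m) (if (j < n)%N then 0 else a j).
Proof.
move=> nm; rewrite (big_ord_widen m a nm) (bigID (fun j : 'I_m => (j < n)%N))/=.
rewrite addrAC subrr add0r big_mkcond; apply: eq_bigr => j _.
by case: ltnP.
Qed.

(** Cauchy-Schwarz for the telescoping sum of the increments, with weights
    [2 ^+ j] against the geometric series [2 ^- j]. *)
Lemma sqr_telescope_le (u : R^nat) k m : (k <= m)%N ->
  (u m - u k) ^+ 2 <=
  2 / 2 ^+ k * \sum_(0 <= j < m) 2 ^+ j * (u j.+1 - u j) ^+ 2.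
Proof.
move=> km; rewrite (@big_cat_nat _ _ _ k)//= mulrDr.
apply: ler_wpDl.
  by rewrite mulr_ge0 ?divr_ge0 ?exprn_ge0//; apply: sumr_ge0 => j _; rewrite mulr_ge0 ?sqr_ge0// exprn_ge0.
rewrite -(subnK km); move: (m - k)%N => n; clear km; elim: n k => [|n IH] k.
  by rewrite add0n subrr expr0n /= big_geq ?mulr0.
rewrite big_ltn; last by rewrite -[X in (X < _)%N]add0n ltn_add2r.
rewrite addSnnS; have {}IH := IH k.+1.
have sq (p q : R) : (p + q) ^+ 2 <= 2 * p ^+ 2 + 2 * q ^+ 2.
  by have := sqr_ge0 (p - q); rewrite sqrrB sqrrD; lra.
have -> : u (n + k.+1)%N - u k = (u k.+1 - u k) + (u (n + k.+1)%N - u k.+1) by ring.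
rewrite (le_trans (sq _ _))// mulrDr.
have k0 : (2 : R) ^+ k != 0 by rewrite expf_neq0.
rewrite [X in _ <= X + _]mulrA divfK// lerD2l.
have -> : 2 / 2 ^+ k = 2 * (2 / 2 ^+ k.+1) :> R.
  by rewrite exprS; field; rewrite k0.
by rewrite -mulrA ler_pM2l.
Qed.

(** Riesz-Fischer, for an orthonormal system. Along a subsequence [N k] the
    partial sums [s k] satisfy [int (s k.+1 - s k)^2 <= 4^-k], so that
    [G = sum_k 2^k (s k.+1 - s k)^2] is integrable; wherever [G] is finite the
    [s k] converge with [(v - s k)^2 <= 2 / 2^k * G], and this single bound
    gives square integrability of the limit and its Fourier coefficients. *)
Theorem riesz_fischer phi (b : nat -> R) : orthonormal phi ->
  cvgn (series (fun n => b n ^+ 2)) ->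
  exists2 v, sqint v & forall n, ip v (phi n) = b n.
Proof.
move=> on cb; have [sphi ophi] := on.
pose B := series (fun n => b n ^+ 2).
have ndB : nondecreasing_seq B.
  by apply: nondecreasing_series => n _ _; exact: sqr_ge0.
pose L := limn B; have BL n : B n <= L by exact: nondecreasing_cvgn_le.
have hN' k : {N : nat | L - B N < 1 / 4 ^+ k}.
  apply: cid; have e0 : 0 < 1 / 4 ^+ k :> R by rewrite divr_gt0// exprn_gt0.
  move/cvgrPdist_lt : cb => /(_ _ e0)[N _ /(_ N (leqnn N)) /= h].
  by exists N; rewrite (le_lt_trans (ler_norm _)).
pose N k := (k + \sum_(j < k.+1) sval (hN' j))%N.
have NS k : (N k <= N k.+1)%N.
  by rewrite /N [in leqRHS]big_ord_recr /= leq_add// leq_addr.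
have LN k : L - B (N k) <= 1 / 4 ^+ k.
  apply: le_trans (ltW (svalP (hN' k))); rewrite lerD2l lerN2; apply: ndB.
  by rewrite /N big_ord_recr /= addnA leq_addl.
pose S n x := \sum_(j < n) b j * phi j x.
have sS n : sqint (S n) := sqint_sum n b sphi.
have SS n m : (n <= m)%N -> ip (fun x => S m x - S n x) (fun x => S m x - S n x) =
    B m - B n.
  move=> nm; pose c j := if (j < n)%N then 0 else b j.
  have E x : S m x - S n x = \sum_(j < m) c j * phi j x.
    rewrite /S (big_ord_sub (fun j => b j * phi j x) nm); apply: eq_bigr => j _.
    by rewrite /c; case: ifP; rewrite ?mul0r.
  rewrite (_ : (fun x => S m x - S n x) = (fun x => \sum_(j < m) c j * phi j x)); last first.
    exact/funext.
  rewrite (@ip_sum m phi c)//; last exact: (sqint_sum m c sphi).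
  transitivity (\sum_(j < m) c j ^+ 2).
    apply: eq_bigr => j _; rewrite (ipC (phi j)).
    by rewrite (@ip_orthonormal_sum m phi c j on) ltn_ord expr2.
  rewrite /B /series /= !big_mkord (big_ord_sub (fun j => b j ^+ 2) nm).
  by apply: eq_bigr => j _; rewrite /c; case: ifP; rewrite ?expr0n.
pose dk k x := S (N k.+1) x - S (N k) x.
have sd k : sqint (dk k) by exact: sqintB.
pose G x := (\sum_(0 <= k <oo) (2 ^+ k * dk k x ^+ 2)%:E)%E.
have G0 k x : (0 <= (2 ^+ k * dk k x ^+ 2)%:E)%E.
  by rewrite lee_fin mulr_ge0 ?sqr_ge0// exprn_ge0.
have mdk k : measurable_fun D (fun x => (2 ^+ k * dk k x ^+ 2)%:E).
  by apply/measurable_EFinP/measurable_funM => //; apply: measurable_funX; case: (sd k).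
have mG : measurable_fun D G by apply: ge0_emeasurable_sum => //.
have Gge0 x : (0 <= G x)%E by exact: nneseries_ge0.
have intG : (\int[mu]_(x in D) G x <= 2%:E)%E.
  rewrite integral_nneseries//.
  apply: (@le_trans _ _ (\sum_(0 <= k <oo) (2 / (2 ^ (k + 1))%:R)%:E)%E).
    apply: lee_nneseries => k _; first by move=> _; apply: integral_ge0 => x _; exact: G0.
    under eq_integral do rewrite EFinM.
    rewrite integralZl//; last exact: sqint_sqr_integrable.
    rewrite ip_self// -EFinM lee_fin SS// addn1.
    have h : B (N k.+1) - B (N k) <= 1 / 4 ^+ k.
      by apply: le_trans (LN k); rewrite lerD2r.
    have k0 : (2 : R) ^+ k != 0 by rewrite expf_neq0.
    rewrite (le_trans (ler_wpM2l _ h)) ?exprn_ge0//.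
    have -> : 4 ^+ k = 2 ^+ k * 2 ^+ k :> R by rewrite -exprMn -natrM.
    by rewrite natrX exprS le_eqVlt; apply/orP; left; apply/eqP; field; rewrite k0.
  have := @cvg_geometric_eseries_half R 2 0.
  by rewrite expr0 divr1 => /cvg_lim ->.
have iG : mu.-integrable D G.
  apply/integrableP; split => //; apply: (@le_lt_trans _ _ 2%:E); rewrite ?ltry//.
  by apply: le_trans intG; rewrite (eq_integral G)// => x _; rewrite gee0_abs.
pose A := D `&` [set x | (G x < +oo)%E].
have mA : measurable A by exact: emeasurable_fun_infty_o.
have GA x : A x -> G x = (fine (G x))%:E.
  by move=> [_ /= h]; rewrite fineK// ge0_fin_numE.
have hx x k m : A x -> (k <= m)%N ->
    (S (N m) x - S (N k) x) ^+ 2 <= 2 / 2 ^+ k * fine (G x).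
  move=> Ax km; rewrite (le_trans (sqr_telescope_le (fun j => S (N j) x) km))//.
  rewrite ler_wpM2l ?divr_ge0 ?exprn_ge0// -lee_fin -GA// -sumEFin.
  by apply: nneseries_lim_ge => j _ _; exact: G0.
have c0 : (fun k => 2 / 2 ^+ k : R) @ \oo --> 0.
  rewrite -(mulr0 2); apply: cvgMl_tmp.
  have := @cvg_expr R 2^-1 ltac:(by rewrite ger0_norm ?invr_ge0// invf_lt1// ltr1n).
  by apply: cvg_trans; apply: near_eq_cvg; apply: nearW => n; rewrite exprVn.
have cvgS x : A x -> cvgn (fun k => S (N k) x).
  move=> Ax; apply/cauchy_cvgP; apply: cauchy_exP => e e0.
  have g1 : 0 < fine (G x) + 1 by rewrite ltr_wpDl// fine_ge0.
  move/cvgrPdist_lt : c0 => /(_ (e ^+ 2 / (fine (G x) + 1))).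
  case=> [|k _ /(_ k (leqnn k)) /=]; first by rewrite divr_gt0// exprn_gt0.
  rewrite sub0r normrN ger0_norm ?divr_ge0 ?exprn_ge0// ltr_pdivlMr// => hk.
  exists (S (N k) x); exists k => // m /= km.
  rewrite /ball /= distrC -(@ltr_pXn2r _ 2)// ?nnegrE ?ltW//.
  rewrite real_normK ?num_real// (le_lt_trans (hx x k m Ax km))//.
  by rewrite (le_lt_trans _ hk)// ler_wpM2l ?divr_ge0 ?exprn_ge0// lerDl.
pose s k x := S (N k) x * \1_A x.
pose v x := limn (fun k => s k x).
have sA x k : A x -> s k x = S (N k) x.
  by move=> Ax; rewrite /s indicE mem_set// mulr1.
have snA x k : ~ A x -> s k x = 0.
  by move=> Ax; rewrite /s indicE memNset// mulr0.
have cs x : (fun k => s k x) @ \oo --> v x.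
  have [Ax|nAx] := pselect (A x).
    have E : (fun k => s k x) = (fun k => S (N k) x) by apply/funext => k; exact: sA.
    by rewrite /v E; exact: cvgS.
  have E : (fun k => s k x) = (fun=> 0) by apply/funext => k; exact: snA.
  by rewrite /v E; exact: is_cvg_cst.
have ms k : measurable_fun D (s k).
  apply: measurable_funM; first by case: (sS (N k)).
  exact: measurable_indic.
have mv : measurable_fun D v.
  by apply: (measurable_fun_cvg ms) => x _; exact: cs.
have vs k x : (((v x - s k x) ^+ 2)%:E <= (2 / 2 ^+ k)%:E * G x)%E.
  have [Ax|nAx] := pselect (A x); last first.
    have -> : v x = 0.
      apply: (norm_cvg_unique (cs x)); apply: cvg_near_cst.
      by apply: nearW => n; exact: snA.
    by rewrite snA// subrr expr0n mule_ge0// lee_fin divr_ge0 ?exprn_ge0.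
  rewrite GA// -EFinM lee_fin.
  have cc : (fun m => (s m x - s k x) ^+ 2) @ \oo --> (v x - s k x) ^+ 2.
    under eq_fun do rewrite expr2; rewrite expr2.
    by apply: cvgM; apply: cvgB => //; exact: cvg_cst.
  rewrite -(cvg_lim _ cc)//; apply: limr_le; first by apply/cvg_ex; exists ((v x - s k x) ^+ 2).
  by exists k => // m /= km; rewrite !sA//; exact: hx.
have intvs k : (\int[mu]_(x in D) ((v x - s k x) ^+ 2)%:E <= (2 / 2 ^+ k * 2)%:E)%E.
  have k0 : 0 <= 2 / 2 ^+ k :> R by rewrite divr_ge0 ?exprn_ge0.
  apply: (@le_trans _ _ (\int[mu]_(x in D) ((2 / 2 ^+ k)%:E * G x))%E).
    apply: ge0_le_integral => //.
    - by move=> x _; rewrite lee_fin sqr_ge0.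
    - by apply/measurable_EFinP; apply: measurable_funX; exact: measurable_funB.
    - by apply: emeasurable_funM => //; exact: measurable_cst.
  rewrite ge0_integralZl//; first by rewrite (EFinM (2 / 2 ^+ k)) lee_wpmul2l// lee_fin.
have ss k : sqint (s k).
  split => //; have [mS S2] := sS (N k); apply: le_lt_trans S2.
  apply: ge0_le_integral => //.
  - by move=> x _; rewrite lee_fin sqr_ge0.
  - by apply/measurable_EFinP; exact: measurable_funX.
  - by apply/measurable_EFinP; exact: measurable_funX.
  - move=> x _; rewrite lee_fin; have [Ax|nAx] := pselect (A x).
      by rewrite sA.
    by rewrite snA// expr0n sqr_ge0.
have svs k : sqint (fun x => v x - s k x).
  split; first exact: measurable_funB.
  by apply: le_lt_trans (intvs k) _; rewrite ltry.
have sv : sqint v.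
  have := sqintD (svs 0%N) (ss 0%N).
  by under eq_fun do rewrite subrK.
have sphiE k n : (n < N k)%N -> ip (s k) (phi n) = b n.
  move=> nN; transitivity (ip (S (N k)) (phi n)).
    congr fine; apply: ae_eq_integral => //.
    - by apply: (measurable_int mu); exact: sqint_mul.
    - by apply: (measurable_int mu); exact: sqint_mul.
    - have := integrable_ae mD iG; apply: filterS => x Gx Dx.
      by rewrite sA//; split => //=; rewrite -ge0_fin_numE//; exact: Gx.
  by have := @ip_orthonormal_sum (N k) phi b n on; rewrite nN.
exists v => // n.
suff : `|ip v (phi n) - b n| ^+ 2 <= 0.
  by rewrite real_normK ?num_real// => h; apply/eqP; rewrite -subr_eq0 -sqrf_eq0 eq_le h sqr_ge0.
have le k : (n < k)%N -> `|ip v (phi n) - b n| ^+ 2 <= 2 / 2 ^+ k * 2.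
  move=> nk; have nN : (n < N k)%N by rewrite (leq_trans nk)// leq_addr.
  rewrite real_normK ?num_real// -(sphiE k n nN) -ipB//.
  have h1 := bessel n.+1 on (svs k).
  have h2 := intvs k; rewrite ip_self// lee_fin in h2.
  apply: le_trans h2; apply: le_trans h1; rewrite big_ord_recr /= lerDr.
  by apply: sumr_ge0 => j _; exact: sqr_ge0.
have cc : (fun k => 2 / 2 ^+ k * 2 : R) @ \oo --> (0 * 2 : R) by exact: cvgMr_tmp.
rewrite mul0r in cc; rewrite -(cvg_lim _ cc)//.
apply: limr_ge; first by apply/cvg_ex; exists 0.
by exists n.+1 => // k /= nk; exact: le.
Qed.

End SquareIntegrable.

(** * Gamma integrals *)

Section HalfLine.
Variable R : realType.
Local Notation mu := (@lebesgue_measure R).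
Local Notation D := (`]0, +oo[%classic : set R).
Implicit Types (f F G : R -> R) (a s l x : R).

(** A compact exhaustion of the open half-line; the scale [c] lets a dilation
    map one exhaustion to another. *)
Definition exhaust c n : set R := `[c / n.+2%:R, c * n.+2%:R]%classic.

Lemma exhaust_pos c n x : 0 < c -> exhaust c n x -> 0 < x.
Proof.
move=> c0; rewrite /exhaust /= in_itv /= => /andP[h _]; apply: lt_le_trans h.
by rewrite divr_gt0.
Qed.

Lemma bigcup_exhaust c : 0 < c -> \bigcup_n exhaust c n = D.
Proof.
move=> c0; apply/seteqP; split => [x [n _ /(exhaust_pos c0) x0]|x].
  by rewrite /= in_itv /= x0.
rewrite /= in_itv /= andbT => x0.
exists (Num.truncn (x / c + c / x)) => //; rewrite /exhaust /= in_itv /=.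
have h : x / c + c / x <= (Num.truncn (x / c + c / x)).+2%:R.
  by rewrite ltW// (lt_trans (truncnS_gt _))// ltr_nat.
have h1 : 0 < x / c by rewrite divr_gt0.
have h2 : 0 < c / x by rewrite divr_gt0.
have k1 : c / x <= (Num.truncn (x / c + c / x)).+2%:R.
  by rewrite (le_trans _ h)// lerDr ltW.
have k2 : x / c <= (Num.truncn (x / c + c / x)).+2%:R.
  by rewrite (le_trans _ h)// lerDl ltW.
apply/andP; split; last by rewrite mulrC -ler_pdivrMr.
by rewrite ler_pdivrMr// mulrC -ler_pdivrMr.
Qed.

Lemma exhaust_nd c : 0 < c -> nondecreasing_seq (exhaust c).
Proof.
move=> c0 n m nm; apply/subsetPset => x; rewrite /exhaust /= !in_itv /= => /andP[h1 h2].
apply/andP; split.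
  by rewrite (le_trans _ h1)// ler_pM2l// lef_pV2 ?posrE// ler_nat.
by rewrite (le_trans h2)// ler_pM2l// ler_nat.
Qed.

Lemma exhaust_sub c n : 0 < c -> exhaust c n `<=` D.
Proof. by move=> c0; rewrite -(bigcup_exhaust c0); exact: bigcup_sup. Qed.

Lemma ge0_exhaust_cvg c (f : R -> \bar R) : 0 < c -> measurable_fun D f ->
  (forall x, 0 < x -> (0 <= f x)%E) ->
  (\int[mu]_(x in exhaust c n) f x)%E @[n --> \oo] --> (\int[mu]_(x in D) f x)%E.
Proof.
move=> c0 mf f0; rewrite -(bigcup_exhaust c0).
apply: ge0_nondecreasing_set_cvg_integral.
- exact: exhaust_nd.
- by move=> n; exact: measurable_itv.
- by move=> n; apply: measurable_funS mf => //; exact: exhaust_sub.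
- by move=> n x /(exhaust_pos c0); exact: f0.
Qed.

Lemma exhaust_FTC F f n : (forall x, 0 < x -> is_derive x 1 F (f x)) ->
  (forall x, 0 < x -> {for x, continuous f}) ->
  (\int[mu]_(x in exhaust 1 n) (f x)%:E = (F n.+2%:R - F n.+2%:R^-1)%:E)%E.
Proof.
move=> dF cf; have n0 : 0 < n.+2%:R^-1 :> R by rewrite invr_gt0.
have cF x : 0 < x -> {for x, continuous F}.
  move=> /dF[d _]; exact/differentiable_continuous/derivable1_diffP.
have E : exhaust 1 n = `[n.+2%:R^-1, n.+2%:R]%classic by rewrite /exhaust !mul1r.
rewrite E (@continuous_FTC2 _ f F)//.
- by rewrite (@lt_trans _ _ 1) ?invf_lt1 ?ltr1n.
- rewrite -E; apply/continuous_in_subspaceT => x /set_mem/(exhaust_pos ltr01).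
  exact: cf.
- split.
  + by move=> x; rewrite in_itv /= => /andP[h _]; case: (dF x (lt_trans n0 h)).
  + by apply: cvg_at_right_filter; exact: cF.
  + by apply: cvg_at_left_filter; exact: cF.
- move=> x; rewrite in_itv /= => /andP[h _]; rewrite derive1E.
  by case: (dF x (lt_trans n0 h)).
Qed.

Lemma continuous_measurable_pos f : (forall x, 0 < x -> {for x, continuous f}) ->
  measurable_fun D f.
Proof.
move=> cf; apply: open_continuous_measurable_fun; first exact: interval_open.
by move=> x; rewrite inE /= in_itv /= andbT => /cf.
Qed.

Lemma expr_le_expR (c x : R) n : 0 < c -> 0 <= x ->
  x ^+ n <= n`!%:R / c ^+ n * expR (c * x).
Proof.
move=> c0 x0; have cn : 0 < c ^+ n by rewrite exprn_gt0.
rewrite mulrAC ler_pdivlMr// -exprMn (mulrC x).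
have f0 : 0 < n`!%:R :> R by rewrite ltr0n fact_gt0.
rewrite -ler_pdivrMl// [_^-1 * _]mulrC.
case: n {cn} f0 => [|n] f0.
  by rewrite expr0 fact0 mulr1n divr1 -expR0 ler_expR mulr_ge0// ltW.
apply: le_trans (expR_ge1Dxn n _); last by rewrite mulr_ge0// ltW.
by rewrite lerDr.
Qed.

Lemma is_derive_inv f x df : f x != 0 -> is_derive x 1 f df ->
  is_derive x 1 (fun y => (f y)^-1) (- (f x) ^- 2 * df).
Proof.
move=> fx0 [dfx fE]; split; first exact: derivableV.
by rewrite deriveV// fE.
Qed.

Lemma is_derive_continuous f x df : is_derive x 1 f df -> {for x, continuous f}.
Proof. by move=> [d _]; exact/differentiable_continuous/derivable1_diffP. Qed.

Definition gamma_fun s l x : R := x `^ (s - 1) * expR (- (l * x)).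

Lemma gamma_fun_ge0 s l x : 0 <= gamma_fun s l x.
Proof. by rewrite mulr_ge0 ?powR_ge0 ?expR_ge0. Qed.

Lemma is_derive_gamma_fun s l x : 0 < x ->
  is_derive x 1 (gamma_fun (s + 1) l)
    (s * gamma_fun s l x - l * gamma_fun (s + 1) l x).
Proof.
move=> x0; rewrite /gamma_fun !addrK.
have h1 := @is_derive1_powR R s x x0.
have h2 : is_derive x 1 (fun x => expR (- (l * x))) (expR (- (l * x)) * (- l)).
  apply: (@is_derive1_comp R expR (fun x => - (l * x))).
  rewrite -[X in is_derive _ _ _ X]mulrN1 mulrC mulN1r.
  apply: is_deriveN; rewrite -[X in is_derive _ _ _ X]mulr1.
  exact: is_deriveZ.
apply: (is_derive_eq (is_deriveM h1 h2)).
by rewrite /GRing.scale /=; ring.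
Qed.

Lemma gamma_fun_continuous s l x : 0 < x -> {for x, continuous (gamma_fun s l)}.
Proof.
move=> x0; have := is_derive_gamma_fun (s - 1) l x0; rewrite subrK => -[d _].
exact/differentiable_continuous/derivable1_diffP.
Qed.

Lemma gamma_fun_measurable s l : measurable_fun D (gamma_fun s l).
Proof. by apply: continuous_measurable_pos => x; exact: gamma_fun_continuous. Qed.

(** The primitive [C * (x / (1 + x)) ^ s] is bounded on the half-line and its
    derivative dominates the integrand both at [0] and at infinity. *)
Lemma gamma_fun_integrable s l : 0 < s -> 0 < l ->
  mu.-integrable D (EFin \o gamma_fun s l).
Proof.
move=> s0 l0; apply/integrableP; split.
  by apply/measurable_EFinP; exact: gamma_fun_measurable.
under eq_integral do rewrite /= ger0_norm ?gamma_fun_ge0//.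
pose m := (Num.truncn (s + 1)).+1.
pose C := m`!%:R / l ^+ m * expR l / s.
have C0 : 0 <= C.
  by rewrite !mulr_ge0 ?expR_ge0 ?invr_ge0 ?exprn_ge0// ltW.
pose q x := x / (1 + x).
pose F x := C * (q x) `^ s.
pose f x := C * (s * (q x) `^ (s - 1) * ((1 + x) ^- 2)).
have q0 x : 0 < x -> 0 < q x by move=> x0; rewrite divr_gt0// addr_gt0.
have q1 x : 0 < x -> q x <= 1.
  by move=> x0; rewrite ler_pdivrMr ?addr_gt0// mul1r lerDr.
have dq x : 0 < x -> is_derive x 1 q ((1 + x) ^- 2).
  move=> x0; have x1 : 1 + x != 0 by rewrite gt_eqF// addr_gt0.
  have d1 : is_derive x 1 (fun x => 1 + x) 1.
    by rewrite -[X in is_derive _ _ _ X]add0r; exact: is_deriveD.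
  apply: (is_derive_eq (is_deriveM (is_derive_id x 1) (is_derive_inv x1 d1))).
  by rewrite /GRing.scale /=; field.
have dF x : 0 < x -> is_derive x 1 F (f x).
  move=> x0; have dp := is_derive1_powR s (q0 x x0).
  exact: is_deriveZ (is_derive1_comp dp (dq x x0)).
have cf x : 0 < x -> {for x, continuous f}.
  move=> x0; have dp := is_derive1_powR (s - 1) (q0 x x0).
  have c1 := is_derive_continuous (is_derive1_comp dp (dq x x0)).
  have d1 : is_derive x 1 (fun x => (1 + x) ^+ 2) (2 * (1 + x)).
    have d1 : is_derive x 1 (fun x => 1 + x) 1.
      by rewrite -[X in is_derive _ _ _ X]add0r; exact: is_deriveD.
    apply: (is_derive_eq (is_deriveM d1 d1)).
    by rewrite /GRing.scale /=; ring.
  have x1 : (1 + x) ^+ 2 != 0 by rewrite expf_neq0// gt_eqF// addr_gt0.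
  have c2 := is_derive_continuous (@is_derive_inv (fun x => (1 + x) ^+ 2) x _ x1 d1).
  have c3 : {for x, continuous (fun x => s * q x `^ (s - 1))}.
    exact: (@cvgM _ _ _ _ (fun=> s) _ s _ (cvg_cst _) c1).
  exact: (@cvgM _ _ _ _ (fun=> C) _ C _ (cvg_cst _) (cvgM c3 c2)).
have fF x : 0 < x -> gamma_fun s l x <= f x.
  move=> x0; have y0 : 0 < 1 + x by rewrite addr_gt0.
  have -> : f x = C * s * x `^ (s - 1) * ((1 + x) `^ (s + 1))^-1.
    rewrite /f /q powRM ?invr_ge0 ?ltW// -(powR_inv1 (ltW y0)) -powRrM.
    rewrite -(powR_invn 2 (ltW y0)) -powRN.
    have -> : - (s + 1) = -1 * (s - 1) + - 2%:R by ring.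
    by rewrite (powRD (x := 1 + x)) ?(gt_eqF y0) ?implybT//; ring.
  rewrite /gamma_fun [C * s * _]mulrC -mulrA ler_wpM2l ?powR_ge0//.
  rewrite ler_pdivlMr ?powR_gt0// expRN ler_pdivrMl ?expR_gt0//.
  apply: (@le_trans _ _ ((1 + x) ^+ m)).
    have y1 : 1 <= 1 + x by rewrite lerDl ltW.
    have sm : s + 1 <= m%:R by rewrite ltW// truncnS_gt.
    by rewrite -(powR_mulrn m (ltW y0)); exact: ler_powR sm.
  rewrite (le_trans (expr_le_expR m l0 (ltW y0)))//.
  rewrite /C mulrDr mulr1 expRD le_eqVlt; apply/orP; left; apply/eqP.
  by field; rewrite gt_eqF//= expf_neq0// gt_eqF.
apply: (@le_lt_trans _ _ C%:E); last by rewrite ltry.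
have H : (\int[mu]_(x in exhaust 1 n) (gamma_fun s l x)%:E)%E @[n --> \oo] -->
    (\int[mu]_(x in D) (gamma_fun s l x)%:E)%E.
  apply: (@ge0_exhaust_cvg 1 (EFin \o gamma_fun s l)) => //.
    by apply/measurable_EFinP; exact: gamma_fun_measurable.
  by move=> x _; rewrite lee_fin gamma_fun_ge0.
rewrite -(cvg_lim _ H)//; apply: lime_le; first by apply/cvg_ex; eexists; exact: H.
apply: nearW => n; apply: (@le_trans _ _ (\int[mu]_(x in exhaust 1 n) (f x)%:E)%E).
  apply: ge0_le_integral => //.
  - exact: measurable_itv.
  - by move=> x _; rewrite lee_fin gamma_fun_ge0.
  - apply/measurable_EFinP; apply: measurable_funS (gamma_fun_measurable s l) => //.
    exact: exhaust_sub.
  - apply/measurable_EFinP; apply: measurable_funS (continuous_measurable_pos cf) => //.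
    exact: exhaust_sub.
  - by move=> x /(exhaust_pos ltr01) x0; rewrite lee_fin fF.
rewrite (exhaust_FTC n dF cf) lee_fin lerBlDr ler_wpDr//.
  by rewrite mulr_ge0// powR_ge0.
have n0 : 0 < n.+2%:R :> R by [].
have q10 : q n.+2%:R `^ s <= 1 `^ s.
  apply: ge0_ler_powR; rewrite ?nnegrE ?ler01 ?q1//; first exact: ltW.
  exact/ltW/q0.
by rewrite powR1 in q10; rewrite /F -[leRHS]mulr1 ler_wpM2l.
Qed.

Definition gamma_int s l : R := \int[mu]_(x in D) gamma_fun s l x.

Lemma gamma_intE s l : 0 < s -> 0 < l ->
  (\int[mu]_(x in D) (gamma_fun s l x)%:E)%E = (gamma_int s l)%:E.
Proof.
move=> s0 l0; rewrite /gamma_int /Rintegral fineK//.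
by apply: integrable_fin_num => //; exact: gamma_fun_integrable.
Qed.

Lemma gamma_fun_exhaust_cvg c s l : 0 < c -> 0 < s -> 0 < l ->
  (fun n => \int[mu]_(x in exhaust c n) gamma_fun s l x) @ \oo --> gamma_int s l.
Proof.
move=> c0 s0 l0; apply: fine_cvg; rewrite -gamma_intE//.
apply: (@ge0_exhaust_cvg c (EFin \o gamma_fun s l)) => //.
  by apply/measurable_EFinP; exact: gamma_fun_measurable.
by move=> x _; rewrite lee_fin gamma_fun_ge0.
Qed.

Lemma gamma_fun_cvg0 s l : 0 < s -> 0 < l ->
  (fun n => gamma_fun (s + 1) l n.+2%:R - gamma_fun (s + 1) l n.+2%:R^-1) @ \oo
    --> (0 : R).
Proof.
move=> s0 l0; rewrite -[X in _ --> X](subr0 0); apply: cvgB.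
- pose m := (Num.truncn s).+1; pose C := m.+1`!%:R / l ^+ m.+1.
  apply: (@squeeze_cvgr _ _ _ _ (fun=> 0) (fun n => C * n.+1%:R^-1)).
  + apply: nearW => n; rewrite gamma_fun_ge0 /= /gamma_fun addrK expRN.
    have x0 : 0 < n.+2%:R :> R by [].
    rewrite ler_pdivrMr ?expR_gt0//.
    apply: (@le_trans _ _ (n.+2%:R ^+ m)).
      rewrite -(powR_mulrn m (ltW x0)).
      have sm : s <= m%:R by rewrite ltW// truncnS_gt.
      have n1 : 1 <= n.+2%:R :> R by rewrite ler1n.
      exact: ler_powR sm.
    apply: (@le_trans _ _ (C * n.+2%:R^-1 * expR (l * n.+2%:R))).
      rewrite mulrAC ler_pdivlMr// -exprSr; exact: expr_le_expR (ltW x0).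
    have C0 : 0 <= C by rewrite divr_ge0// exprn_ge0// ltW.
    rewrite ler_wpM2r ?expR_ge0// ler_wpM2l//.
    by rewrite lef_pV2 ?posrE// ler_nat.
  + exact: cvg_cst.
  + rewrite -[X in _ --> X](mulr0 C); apply: cvgMl_tmp; exact: cvg_harmonic.
- apply: (@squeeze_cvgr _ _ _ _ (fun=> 0) (fun n => (n.+2%:R^-1) `^ s)).
  + apply: nearW => n; rewrite gamma_fun_ge0 /= /gamma_fun addrK.
    rewrite ler_piMr ?powR_ge0// expR_le1 oppr_le0 mulr_ge0 ?invr_ge0// ltW//.
  + exact: cvg_cst.
  + apply/cvgrPdist_le => e e0; rewrite /=.
    have h0 : 0 < e `^ s^-1 by rewrite powR_gt0.
    have := @cvg_harmonic R => /cvgrPdist_le /(_ _ h0); apply: filterS => n.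
    rewrite !sub0r !normrN /= !ger0_norm ?powR_ge0// ?invr_ge0// => h.
    have -> : e = (e `^ s^-1) `^ s by rewrite -powRrM mulVf ?gt_eqF// powRr1// ltW.
    apply: ge0_ler_powR; rewrite ?nnegrE ?invr_ge0 ?powR_ge0//; first exact: ltW.
    by rewrite (le_trans _ h)// lef_pV2 ?posrE// ler_nat.
Qed.

(** Integration by parts on the exhausting intervals, with boundary terms that
    vanish in the limit. *)
Lemma gamma_intS s l : 0 < s -> 0 < l ->
  l * gamma_int (s + 1) l = s * gamma_int s l.
Proof.
move=> s0 l0; have s1 : 0 < s + 1 by rewrite addr_gt0.
pose f x := s * gamma_fun s l x - l * gamma_fun (s + 1) l x.
have H n : s * (\int[mu]_(x in exhaust 1 n) gamma_fun s l x) -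
    l * (\int[mu]_(x in exhaust 1 n) gamma_fun (s + 1) l x) =
    gamma_fun (s + 1) l n.+2%:R - gamma_fun (s + 1) l n.+2%:R^-1.
  have mE : measurable (exhaust 1 n) by exact: measurable_itv.
  have i t : 0 < t -> mu.-integrable (exhaust 1 n) (EFin \o gamma_fun t l).
    move=> t0; apply: integrableS (gamma_fun_integrable t0 l0) => //.
    exact: exhaust_sub.
  rewrite -!RintegralZl; try exact: i; try exact: mE.
  rewrite -RintegralB//; try (apply: integrable_mulrl => //; exact: i).
  have cf x : 0 < x -> {for x, continuous f}.
    move=> x0; apply: cvgB.
      by apply: cvgMl_tmp; exact: gamma_fun_continuous.
    by apply: cvgMl_tmp; exact: gamma_fun_continuous.
  have dF x (x0 : 0 < x) := is_derive_gamma_fun s l x0.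
  by rewrite /Rintegral (exhaust_FTC n dF cf).
have lim1 : (fun n => s * (\int[mu]_(x in exhaust 1 n) gamma_fun s l x) -
    l * (\int[mu]_(x in exhaust 1 n) gamma_fun (s + 1) l x)) @ \oo -->
    s * gamma_int s l - l * gamma_int (s + 1) l.
  by apply: cvgB; apply: cvgMl_tmp; exact: gamma_fun_exhaust_cvg.
have lim2 := gamma_fun_cvg0 s0 l0.
apply/esym/eqP; rewrite -subr_eq0; apply/eqP.
apply: (norm_cvg_unique lim1); apply: cvg_trans lim2.
by apply: near_eq_cvg; apply: nearW => n; rewrite -H.
Qed.

(** Substitution [x |-> l * x] on the exhausting intervals: it carries
    [exhaust 1 n] to [exhaust l n]. *)
Lemma gamma_int_scale s l : 0 < s -> 0 < l ->
  gamma_int s l = gamma_int s 1 / l `^ s.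
Proof.
move=> s0 l0; pose f x := l * gamma_fun s 1 (l * x).
have fE x : 0 < x -> f x = l `^ s * gamma_fun s l x.
  move=> x0; rewrite /f /gamma_fun mul1r powRM ?ltW// !mulrA; congr (_ * _ * _).
  by rewrite mulr_powRB1// ltW.
have H n : \int[mu]_(x in exhaust l n) gamma_fun s 1 x =
    l `^ s * \int[mu]_(x in exhaust 1 n) gamma_fun s l x.
  have n0 : 0 < n.+2%:R :> R by [].
  have d1 x : is_derive x 1 (fun x => l * x) l.
    rewrite -[X in is_derive _ _ _ X]mulr1; exact: is_deriveZ.
  have d1E : (fun x => l * x)^`()%classic = fun=> l.
    by apply/funext => x; rewrite derive1E; case: (d1 x).
  have E1 : exhaust 1 n = `[n.+2%:R^-1, n.+2%:R]%classic by rewrite /exhaust !mul1r.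
  have ab : n.+2%:R^-1 <= n.+2%:R :> R.
    by rewrite ltW// (@lt_trans _ _ 1) ?invf_lt1 ?ltr1n.
  have := @integration_by_substitution_increasing R (fun x => l * x)
    (gamma_fun s 1) n.+2%:R^-1 n.+2%:R ab.
  have mE : measurable (exhaust 1 n) by exact: measurable_itv.
  rewrite d1E -E1 /Rintegral => ->.
  - rewrite -[in RHS]RintegralZl//; last first.
      apply: integrableS (gamma_fun_integrable s0 l0) => //; exact: exhaust_sub.
    congr fine; apply: eq_integral => x /set_mem/(exhaust_pos ltr01) x0.
    by rewrite -fE// /f mulrC.
  - by move=> x y _ _ xy; rewrite ltr_pM2l.
  - by move=> x _; exact: cvg_cst.
  - exact: is_cvg_cst.
  - exact: is_cvg_cst.
  - split.
    + by move=> x _; case: (d1 x).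
    + by apply: cvg_at_right_filter; exact: (is_derive_continuous (d1 _)).
    + by apply: cvg_at_left_filter; exact: (is_derive_continuous (d1 _)).
  - apply/continuous_in_subspaceT => x; rewrite inE => /(exhaust_pos l0).
    exact: gamma_fun_continuous.
have l1 : (fun n => l `^ s * \int[mu]_(x in exhaust 1 n) gamma_fun s l x) @ \oo -->
    l `^ s * gamma_int s l.
  by apply: cvgMl_tmp; exact: gamma_fun_exhaust_cvg.
have l2 := gamma_fun_exhaust_cvg l0 s0 ltr01.
have ls : l `^ s != 0 by rewrite gt_eqF// powR_gt0.
apply: (mulfI ls); rewrite [RHS]mulrC divfK//.
apply: (norm_cvg_unique l1); apply: cvg_trans l2.
by apply: near_eq_cvg; apply: nearW => n; rewrite H.
Qed.

Lemma gamma_int_gt0 s l : 0 < s -> 0 < l -> 0 < gamma_int s l.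
Proof.
move=> s0 l0.
pose c := expR (- (l * 2)) / 2.
have c0 : 0 < c by rewrite divr_gt0// expR_gt0.
apply: (lt_le_trans c0); rewrite -lee_fin -gamma_intE//.
have sub : `[1, 2]%classic `<=` D.
  by move=> x; rewrite /= !in_itv /= andbT => /andP[h _]; exact: lt_le_trans h.
apply: (@le_trans _ _ (\int[mu]_(x in `[1%R, 2%R]) (gamma_fun s l x)%:E)%E); last first.
  apply: ge0_subset_integral => //.
  - by apply/measurable_EFinP; exact: gamma_fun_measurable.
  - by move=> x _; rewrite lee_fin gamma_fun_ge0.
apply: (@le_trans _ _ (\int[mu]_(x in `[1%R, 2%R]) (cst c%:E x))%E).
  rewrite integral_cst//= lebesgue_measure_itv /= lte_fin ltr1n /=.
  by rewrite -EFinB -EFinM lee_fin (_ : c * (2 - 1) = c)//; ring.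
apply: ge0_le_integral => //.
- by move=> x _; rewrite lee_fin ltW.
- apply/measurable_EFinP.
  exact: measurable_funS sub (gamma_fun_measurable s l).
- move=> x /=; rewrite in_itv /= => /andP[x1 x2].
  have x0 : 0 < x := lt_le_trans ltr01 x1.
  rewrite lee_fin /c /gamma_fun mulrC ler_pM ?invr_ge0 ?expR_ge0//; last first.
    by rewrite ler_expR lerN2 ler_pM2l.
  apply: (@le_trans _ _ x^-1); first by rewrite lef_pV2 ?posrE.
  have -> : x `^ (s - 1) = x `^ s / x.
    by rewrite powRB ?(gt_eqF x0) ?implybT// powRr1// ltW.
  have x0i : 0 <= x^-1 by rewrite invr_ge0 ltW.
  rewrite -[leLHS]mul1r ler_wpM2r//.
  have := ler_powR x1 (ltW s0); by rewrite powRr0.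
Qed.

End HalfLine.

(** * Rising factorials *)

Section Pochhammer.
Variable R : realType.
Implicit Types (a x : R) (n j : nat).

Lemma pochhammer0 a : pochhammer a 0 = 1.
Proof. by rewrite /pochhammer big_nil. Qed.

Lemma pochhammerS a n : pochhammer a n.+1 = pochhammer a n * (a + n%:R).
Proof. by rewrite /pochhammer big_nat_recr. Qed.

Lemma pochhammerSl a n : pochhammer a n.+1 = a * pochhammer (a + 1) n.
Proof.
rewrite /pochhammer big_nat_recl//= addr0; congr (_ * _).
by apply: eq_bigr => i _; rewrite -natr1; ring.
Qed.

Lemma pochhammerD a n j :
  pochhammer a (n + j) = pochhammer a n * pochhammer (a + n%:R) j.
Proof.
elim: j => [|j IH]; first by rewrite addn0 pochhammer0 mulr1.
by rewrite addnS !pochhammerS IH natrD; ring.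
Qed.

Lemma pochhammer_gt0 a n : 0 < a -> 0 < pochhammer a n.
Proof.
move=> a0; elim: n => [|n IH]; first by rewrite pochhammer0.
by rewrite pochhammerS mulr_gt0// ltr_wpDr.
Qed.

(** The left-hand side is, up to sign, the [n]-th finite difference of a
    polynomial in [x] of degree [j <= n] with leading coefficient one. *)
Lemma pochhammer_difference n j x : (j <= n)%N ->
  \sum_(k < n.+1) (-1) ^+ k * 'C(n, k)%:R * pochhammer (x + k%:R) j =
  if j == n then (-1) ^+ n * n`!%:R else 0.
Proof.
elim: n j x => [|n IH] j x.
  rewrite leqn0 => /eqP ->; rewrite big_ord_recr big_ord0 /= bin0 pochhammer0.
  by rewrite fact0; ring.
move=> jn.
have -> : \sum_(k < n.+2) (-1) ^+ k * 'C(n.+1, k)%:R * pochhammer (x + k%:R) j =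
    \sum_(k < n.+1) (-1) ^+ k * 'C(n, k)%:R *
      (pochhammer (x + k%:R) j - pochhammer (x + k%:R + 1) j).
  rewrite big_ord_recl /= bin0.
  under eq_bigr do rewrite /bump /= add1n binS natrD mulrDr mulrDl.
  rewrite big_split /= addrA big_ord_recr /= bin_small// mulr0 mul0r addr0.
  under [RHS]eq_bigr do rewrite mulrBr.
  rewrite sumrB; congr (_ + _).
    rewrite [RHS]big_ord_recl /= bin0; congr (_ + _).
      by rewrite addr0.
    by rewrite addr0; apply: eq_bigr => k _; rewrite /bump /= add1n.
  rewrite -sumrN; apply: eq_bigr => k _.
  by rewrite exprS -natr1 addrA; ring.
case: j jn => [|j] jn.
  by rewrite big1// => k _; rewrite !pochhammer0 subrr mulr0.
rewrite (eq_bigr (fun k : 'I_n.+1 => - j.+1%:R *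
    ((-1) ^+ k * 'C(n, k)%:R * pochhammer (x + 1 + k%:R) j))) => [|k _]; last first.
  rewrite pochhammerSl pochhammerS -(addrA x 1) (addrC 1) (addrA x) -natr1; ring.
rewrite -mulr_sumr IH// eqSS; case: eqP => [->|_]; last by rewrite mulr0.
by rewrite factS natrM exprS; ring.
Qed.

End Pochhammer.

(** * Laguerre polynomials and the gamma densities *)

Section Laguerre.
Variable R : realType.
Local Notation mu := (@lebesgue_measure R).
Local Notation D := (`]0, +oo[%classic : set R).
Variables (a : R) (a0 : 0 < a).
Implicit Types (l m x t : R) (n j k : nat) (p : {poly R}) (u : R -> R).

Let mD : measurable (D : set (measurableTypeR R)).
Proof. exact: measurable_itv. Qed.

Lemma Gamma_int : Gamma a = gamma_int a 1.
Proof. by apply: eq_Rintegral => x _; rewrite /gamma_fun mul1r. Qed.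

Lemma Gamma_gt0 : 0 < Gamma a.
Proof. by rewrite Gamma_int gamma_int_gt0. Qed.

Lemma gamma_densityE l x :
  gamma_density a l x = l `^ a / Gamma a * gamma_fun a l x.
Proof. by rewrite /gamma_density /gamma_fun mulrA. Qed.

Lemma gamma_density_ge0 l x : 0 <= gamma_density a l x.
Proof.
rewrite gamma_densityE; apply: mulr_ge0; last exact: gamma_fun_ge0.
by apply: divr_ge0; [exact: powR_ge0|exact: ltW Gamma_gt0].
Qed.

Lemma gamma_density_gt0 l x : 0 < l -> 0 < x -> 0 < gamma_density a l x.
Proof.
move=> l0 x0; rewrite gamma_densityE mulr_gt0//.
  by rewrite divr_gt0 ?powR_gt0// Gamma_gt0.
by rewrite mulr_gt0 ?powR_gt0 ?expR_gt0.
Qed.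

Lemma gamma_density_measurable l : measurable_fun D (gamma_density a l).
Proof.
have -> : gamma_density a l = fun x => l `^ a / Gamma a * gamma_fun a l x.
  by apply/funext => x; exact: gamma_densityE.
by apply: measurable_funM => //; exact: gamma_fun_measurable.
Qed.

Lemma gamma_int_pochhammer l k : 0 < l ->
  gamma_int (a + k%:R) l = Gamma a / l `^ a * (pochhammer a k / l ^+ k).
Proof.
move=> l0; elim: k => [|k IH].
  by rewrite addr0 pochhammer0 expr0 divr1 mulr1 Gamma_int -gamma_int_scale.
have ak : 0 < a + k%:R by rewrite ltr_wpDr.
rewrite -natr1 addrA; apply: (mulfI (lt0r_neq0 l0)).
rewrite gamma_intS// IH pochhammerS exprS.
have ln : l ^+ k != 0 by rewrite expf_neq0// gt_eqF.
have la : l `^ a != 0 by rewrite gt_eqF// powR_gt0.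
by field; rewrite ln la gt_eqF.
Qed.

Lemma gamma_fun_shift l x k : 0 < x ->
  x ^+ k * gamma_fun a l x = gamma_fun (a + k%:R) l x.
Proof.
move=> x0; rewrite /gamma_fun mulrA; congr (_ * _).
rewrite -powR_mulrn ?ltW// -powRD ?(gt_eqF x0) ?implybT//.
by congr (_ `^ _); ring.
Qed.

Lemma gamma_density_moment_integrable l k : 0 < l ->
  mu.-integrable D (EFin \o (fun x => gamma_density a l x * x ^+ k)).
Proof.
move=> l0; have ak : 0 < a + k%:R by rewrite ltr_wpDr.
have := integrable_mulrl (l `^ a / Gamma a) mD (gamma_fun_integrable ak l0).
apply: eq_integrable => // x; rewrite inE /= in_itv /= andbT => x0.
by rewrite -gamma_fun_shift// gamma_densityE; congr EFin; ring.
Qed.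

Lemma gamma_density_moment l k : 0 < l ->
  \int[mu]_(x in D) (gamma_density a l x * x ^+ k) = pochhammer a k / l ^+ k.
Proof.
move=> l0; have ak : 0 < a + k%:R by rewrite ltr_wpDr.
rewrite (@eq_Rintegral _ _ _ mu D
  (fun x => l `^ a / Gamma a * gamma_fun (a + k%:R) l x)) => [|x]; last first.
  rewrite inE /= in_itv /= andbT => x0.
  by rewrite -gamma_fun_shift// gamma_densityE; ring.
rewrite RintegralZl//; last exact: gamma_fun_integrable.
rewrite -/(gamma_int _ _) gamma_int_pochhammer// mulrA -[RHS]mul1r; congr (_ * _).
have la : l `^ a != 0 by rewrite gt_eqF// powR_gt0.
by field; rewrite la gt_eqF// Gamma_gt0.
Qed.

Lemma gamma_density_poly_integrable l p : 0 < l ->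
  mu.-integrable D (EFin \o (fun x => gamma_density a l x * p.[x])).
Proof.
move=> l0; have := integrable_sumr mD (size p) (fun k =>
  integrable_mulrl p`_k mD (gamma_density_moment_integrable k l0)).
apply: eq_integrable => // x _ /=; congr EFin.
by rewrite horner_coef mulr_sumr; apply: eq_bigr => k _; ring.
Qed.

Lemma gamma_density_poly l p n : 0 < l -> (size p <= n)%N ->
  \int[mu]_(x in D) (gamma_density a l x * p.[x]) =
  \sum_(k < n) p`_k * (pochhammer a k / l ^+ k).
Proof.
move=> l0 pn; under [RHS]eq_bigr do rewrite -gamma_density_moment//.
have i k := gamma_density_moment_integrable k l0.
transitivity (\int[mu]_(x in D) (\sum_(k < n) p`_k * (gamma_density a l x * x ^+ k))).
  apply: eq_Rintegral => x _; rewrite (horner_coef_wide _ pn) mulr_sumr.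
  by apply: eq_bigr => k _; ring.
rewrite (Rintegral_sumr mD n (fun k => integrable_mulrl p`_k mD (i k))).
by apply: eq_bigr => k _; rewrite RintegralZl.
Qed.

(** A rescaling of the generalised Laguerre polynomial [L_n^(a-1) (l * x)],
    normalised to have value [1] at [0]. *)
Definition laguerre l n : {poly R} :=
  \poly_(k < n.+1) ((-1) ^+ k * 'C(n, k)%:R * l ^+ k / pochhammer a k).

(** The rising factorials in the coefficients cancel those in the moments, which
    leaves a binomial expansion. *)
Lemma laguerre_gamma_density l m n : 0 < m ->
  \int[mu]_(x in D) (gamma_density a m x * (laguerre l n).[x]) = (1 - l / m) ^+ n.
Proof.
move=> m0; rewrite (gamma_density_poly m0 (size_poly _ _)) exprBn.
apply: eq_bigr => k _; rewrite coef_poly ltn_ord expr1n mulr1 exprMn exprVn.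
have pk : pochhammer a k != 0 by rewrite gt_eqF// pochhammer_gt0.
have mk : m ^+ k != 0 by rewrite expf_neq0// gt_eqF.
by rewrite -mulr_natr; field; rewrite pk mk.
Qed.

(** Against a monomial the moments leave a finite difference of the rising
    factorial [[a + k]_j] as a function of [k]. *)
Lemma laguerre_orthogonal_monomial l n j : 0 < l -> (j <= n)%N ->
  \int[mu]_(x in D) (gamma_density a l x * (laguerre l n * 'X^j).[x]) =
  if j == n then (-1) ^+ n * n`!%:R / l ^+ n else 0.
Proof.
move=> l0 jn; have sz : (size (laguerre l n * 'X^j)%R <= j + n.+1)%N.
  by rewrite (leq_trans (size_polyMleq _ _))// size_polyXn addnS /= addnC leq_add2l size_poly.
rewrite (gamma_density_poly l0 sz) big_split_ord /= big1 ?add0r => [|k _]; last first.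
  by rewrite coefMXn ltn_ord mul0r.
transitivity ((\sum_(k < n.+1) (-1) ^+ k * 'C(n, k)%:R * pochhammer (a + k%:R) j) / l ^+ j).
  rewrite mulr_suml; apply: eq_bigr => k _.
  rewrite coefMXn ltnNge leq_addr /= addKn coef_poly ltn_ord addnC pochhammerD exprD.
  have pk : pochhammer a k != 0 by rewrite gt_eqF// pochhammer_gt0.
  have lk : l ^+ k != 0 by rewrite expf_neq0// gt_eqF.
  have lj : l ^+ j != 0 by rewrite expf_neq0// gt_eqF.
  by field; rewrite pk lk lj.
rewrite pochhammer_difference//; case: eqP => [->//|_]; by rewrite mul0r.
Qed.

Lemma laguerre_orthogonal l n p : 0 < l -> (size p <= n.+1)%N ->
  \int[mu]_(x in D) (gamma_density a l x * (laguerre l n * p).[x]) =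
  p`_n * ((-1) ^+ n * n`!%:R / l ^+ n).
Proof.
move=> l0 pn; have i j := gamma_density_poly_integrable (laguerre l n * 'X^j) l0.
transitivity (\sum_(j < n.+1) p`_j *
    \int[mu]_(x in D) (gamma_density a l x * (laguerre l n * 'X^j).[x])).
  transitivity (\int[mu]_(x in D) (\sum_(j < n.+1) p`_j *
      (gamma_density a l x * (laguerre l n * 'X^j).[x]))).
    apply: eq_Rintegral => x _; rewrite hornerM (horner_coef_wide _ pn) !mulr_sumr.
    by apply: eq_bigr => j _; rewrite hornerM hornerXn; ring.
  rewrite (Rintegral_sumr mD n.+1 (fun j => integrable_mulrl p`_j mD (i j))).
  by apply: eq_bigr => j _; rewrite RintegralZl.
rewrite big_ord_recr /= laguerre_orthogonal_monomial// eqxx big1 ?add0r// => j _.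
by rewrite laguerre_orthogonal_monomial ?(ltnW (ltn_ord j))// (ltn_eqF (ltn_ord j)) mulr0.
Qed.

Lemma laguerre_orthogonality l i n : 0 < l ->
  \int[mu]_(x in D) (gamma_density a l x * (laguerre l i * laguerre l n).[x]) =
  if i == n then n`!%:R / pochhammer a n else 0.
Proof.
move=> l0; wlog mn : i n / (i <= n)%N => [H|].
  have [|/ltnW nm] := leqP i n; first exact: H.
  by rewrite mulrC H// eq_sym; case: eqP => [->|].
rewrite [laguerre l i * _]mulrC laguerre_orthogonal//; last first.
  by rewrite (leq_trans (size_poly _ _)).
rewrite coef_poly ltnS; case: ltngtP mn => // [mn|->] _; first by rewrite mul0r.
rewrite binn; have pk : pochhammer a n != 0 by rewrite gt_eqF// pochhammer_gt0.
have lk : l ^+ n != 0 by rewrite expf_neq0// gt_eqF.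
have s1 : (-1) ^+ n * (-1) ^+ n = 1 :> R by rewrite -exprMn mulrNN mulr1 expr1n.
transitivity ((-1) ^+ n * (-1) ^+ n * (n`!%:R / pochhammer a n)).
  by field; rewrite lk pk.
by rewrite s1 mul1r.
Qed.

End Laguerre.

(** * Expansion of expectations in Laguerre coefficients *)

Section KernelExpansion.
Variable R : realType.
Local Notation mu := (@lebesgue_measure R).
Local Notation D := (`]0, +oo[%classic : set R).
Variables (a : R) (a0 : 0 < a).
Implicit Types (l m x t : R) (n j k : nat) (u v : R -> R).

Let mD : measurable (D : set (measurableTypeR R)).
Proof. exact: measurable_itv. Qed.

(** Integrating the exponential series against the gamma weight turns it into
    the binomial series. *)
Lemma binomial_series (s : R) : 0 <= s < 1 ->
  (fun N => \sum_(n < N) pochhammer a n / n`!%:R * s ^+ n) @ \oo -->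
    ((1 - s) `^ a)^-1.
Proof.
move=> /andP[s0 s1]; have s1' : 0 < 1 - s by rewrite subr_gt0.
pose f n x := s ^+ n / n`!%:R * gamma_fun (a + n%:R) 1 x.
have c0 n : 0 <= s ^+ n / n`!%:R by rewrite divr_ge0// exprn_ge0.
have an n : 0 < a + n%:R by rewrite ltr_wpDr.
have G := Gamma_gt0 a0.
have sumf x : 0 < x -> (\sum_(0 <= n <oo) (f n x)%:E)%E = (gamma_fun a (1 - s) x)%:E.
  move=> x0.
  have -> : gamma_fun a (1 - s) x = gamma_fun a 1 x * expR (s * x).
    by rewrite /gamma_fun -mulrA -expRD; congr (_ * expR _); ring.
  apply: cvg_lim => //.
  have -> : (fun N => (\sum_(0 <= n < N) (f n x)%:E)%E) =
      (fun N => (gamma_fun a 1 x * series (exp_coeff (s * x)) N)%:E).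
    apply/funext => N; rewrite sumEFin; congr EFin.
    rewrite /series /= mulr_sumr; apply: eq_bigr => n _.
    by rewrite /f -gamma_fun_shift// /exp_coeff /= exprMn; ring.
  apply: cvg_EFin; first exact: nearW.
  by apply: cvgMl_tmp; exact: is_cvg_series_exp_coeff.
have intf n : (\int[mu]_(x in D) (f n x)%:E)%E =
    (Gamma a * (pochhammer a n / n`!%:R * s ^+ n))%:E.
  under eq_integral do rewrite EFinM.
  rewrite integralZl//; last exact: gamma_fun_integrable.
  rewrite gamma_intE// -EFinM gamma_int_pochhammer// powR1 expr1n !divr1.
  by congr EFin; ring.
have E : (\sum_(0 <= n <oo) (Gamma a * (pochhammer a n / n`!%:R * s ^+ n))%:E)%E =
    (Gamma a / (1 - s) `^ a)%:E.
  transitivity (\int[mu]_(x in D) (gamma_fun a (1 - s) x)%:E)%E; last first.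
    by rewrite (gamma_intE a0 s1') (gamma_int_scale a0 s1') -Gamma_int.
  transitivity (\int[mu]_(x in D) (\sum_(0 <= n <oo) (f n x)%:E))%E.
    rewrite integral_nneseries//.
    - by apply: eq_eseriesr => n _; rewrite intf.
    - move=> n; apply/measurable_EFinP; apply: measurable_funM => //.
      exact: gamma_fun_measurable.
    - by move=> n x _; rewrite lee_fin mulr_ge0// gamma_fun_ge0.
  by apply: eq_integral => x; rewrite inE /= in_itv /= andbT => /sumf.
have p0 n : 0 <= Gamma a * (pochhammer a n / n`!%:R * s ^+ n).
  apply: mulr_ge0; first exact: ltW.
  by rewrite mulr_ge0 ?exprn_ge0// divr_ge0// ltW// pochhammer_gt0.
have C : (fun N => (\sum_(0 <= n < N) (Gamma a * (pochhammer a n / n`!%:R * s ^+ n))%:E)%E)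
    @ \oo --> (Gamma a / (1 - s) `^ a)%:E.
  rewrite -E; apply: is_cvg_nneseries => n _ _; by rewrite lee_fin.
have C' := fine_cvg C.
have -> : ((1 - s) `^ a)^-1 = (Gamma a)^-1 * (Gamma a / (1 - s) `^ a).
  by rewrite mulKf// gt_eqF.
have -> : (fun N => \sum_(n < N) pochhammer a n / n`!%:R * s ^+ n) =
   (fun N => (Gamma a)^-1 *
     fine (\sum_(0 <= n < N) (Gamma a * (pochhammer a n / n`!%:R * s ^+ n))%:E)%E).
  apply/funext => N; rewrite sumEFin /= -mulr_sumr mulKf ?gt_eqF// big_mkord.
  by [].
exact: (cvgMl_tmp (C' _)).
Qed.

Definition root_density l x : R := Num.sqrt (gamma_density a l x).

Lemma root_density_sqr l x : root_density l x ^+ 2 = gamma_density a l x.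
Proof. by rewrite sqr_sqrtr// gamma_density_ge0. Qed.

Lemma root_density_gt0 l x : 0 < l -> 0 < x -> 0 < root_density l x.
Proof. by move=> l0 x0; rewrite sqrtr_gt0 gamma_density_gt0. Qed.

Lemma root_density_measurable l : measurable_fun D (root_density l).
Proof.
apply: (@measurableT_comp _ _ _ _ _ _ (@Num.sqrt R)).
  exact: (continuous_measurable_fun (@sqrt_continuous R)).
exact: gamma_density_measurable.
Qed.

(** The inverse of the norm of [laguerre a l n] in [L2] of the density with
    parameter [l]; it is the same for all [l]. *)
Definition laguerre_norm n : R := Num.sqrt (pochhammer a n / n`!%:R).

Lemma laguerre_norm_sqr n : laguerre_norm n ^+ 2 = pochhammer a n / n`!%:R.
Proof. by rewrite sqr_sqrtr// divr_ge0// ltW// pochhammer_gt0. Qed.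

Lemma laguerre_norm_gt0 n : 0 < laguerre_norm n.
Proof. by rewrite sqrtr_gt0 divr_gt0 ?pochhammer_gt0// ltr0n fact_gt0. Qed.

(** Multiplication by the root of the density carries [L2] of the density
    isometrically to [L2] of Lebesgue measure on the half-line, so that the
    measure does not depend on [l]. *)
Definition laguerre_fun l n x : R :=
  root_density l x * (laguerre_norm n * (laguerre a l n).[x]).

Lemma laguerre_fun_sqint l n : 0 < l -> sqint mu D (laguerre_fun l n).
Proof.
move=> l0; apply: sqr_integrable_sqint.
  apply: measurable_funM; first exact: root_density_measurable.
  apply: measurable_funM => //; apply: measurable_funTS.
  apply: continuous_measurable_fun => x; exact: continuous_horner.
have := integrable_mulrl (laguerre_norm n ^+ 2) mD
  (gamma_density_poly_integrable a0 (laguerre a l n * laguerre a l n) l0).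
apply: eq_integrable => // x _ /=; congr EFin.
by rewrite /laguerre_fun -root_density_sqr hornerM; ring.
Qed.

Lemma laguerre_fun_orthonormal l : 0 < l -> orthonormal mu D (laguerre_fun l).
Proof.
move=> l0; split=> [n|i n]; first exact: laguerre_fun_sqint.
transitivity (laguerre_norm i * laguerre_norm n * \int[mu]_(x in D)
    (gamma_density a l x * (laguerre a l i * laguerre a l n).[x])).
  rewrite -RintegralZl//; last exact: gamma_density_poly_integrable.
  apply: eq_Rintegral => x _.
  by rewrite /laguerre_fun -root_density_sqr hornerM; ring.
rewrite laguerre_orthogonality//; case: eqP => [->|_]; last by rewrite mulr0.
rewrite -expr2 laguerre_norm_sqr mulr1n.
have pn : pochhammer a n != 0 by rewrite gt_eqF// pochhammer_gt0.
have fn : n`!%:R != 0 :> R by rewrite pnatr_eq0 -lt0n fact_gt0.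
by field; rewrite pn fn.
Qed.

(** Pairing with [kernel l m] in [L2] is expectation under the parameter [m]. *)
Definition kernel l m x : R := gamma_density a m x / root_density l x.

Lemma kernel_sqr l m x : 0 < l -> 0 < x ->
  kernel l m x ^+ 2 =
  m `^ a * m `^ a / (Gamma a * l `^ a) * gamma_fun a (2 * m - l) x.
Proof.
move=> l0 x0; rewrite /kernel expr_div_n root_density_sqr !gamma_densityE.
have G := Gamma_gt0 a0.
have la : 0 < l `^ a by rewrite powR_gt0.
have xa : 0 < x `^ (a - 1) by rewrite powR_gt0.
have el : 0 < expR (- (l * x)) by exact: expR_gt0.
rewrite /gamma_fun.
have -> : expR (- ((2 * m - l) * x)) = expR (- (m * x)) ^+ 2 / expR (- (l * x)).
  by rewrite expr2 -!expRD -expRB; congr expR; ring.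
by field; rewrite !gt_eqF.
Qed.

Lemma kernel_sqr_integrable l m : 0 < l -> l / 2 < m ->
  mu.-integrable D (EFin \o (fun x => kernel l m x ^+ 2)).
Proof.
move=> l0 lm; have ml : 0 < 2 * m - l by lra.
have := integrable_mulrl (m `^ a * m `^ a / (Gamma a * l `^ a)) mD
  (gamma_fun_integrable a0 ml).
apply: eq_integrable => // x; rewrite inE /= in_itv /= andbT => x0.
by rewrite /= kernel_sqr.
Qed.

Lemma root_density_inv_measurable l : 0 < l ->
  measurable_fun D (fun x => (root_density l x)^-1).
Proof.
move=> l0; apply: continuous_measurable_pos => x x0.
apply: continuousV; first by rewrite gt_eqF// root_density_gt0.
apply: (@continuous_comp _ _ _ _ (@Num.sqrt R)); last exact: sqrt_continuous.
rewrite (_ : gamma_density a l = fun x => l `^ a / Gamma a * gamma_fun a l x).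
  by apply: continuousM; [exact: cvg_cst|exact: gamma_fun_continuous].
by apply/funext => y; exact: gamma_densityE.
Qed.

Lemma kernel_sqint l m : 0 < l -> l / 2 < m -> sqint mu D (kernel l m).
Proof.
move=> l0 lm; apply: sqr_integrable_sqint; last exact: kernel_sqr_integrable.
apply: measurable_funM; first exact: gamma_density_measurable.
exact: root_density_inv_measurable.
Qed.

(** The parameters [m > l / 2] are the [l / (1 - t)] with [`|t| < 1]. *)
Lemma kernel_norm l t : 0 < l -> `|t| < 1 ->
  ip mu D (kernel l (l / (1 - t))) (kernel l (l / (1 - t))) = ((1 - t ^+ 2) `^ a)^-1.
Proof.
move=> l0; rewrite ltr_norml => /andP[t1 t2].
have t1' : 0 < 1 - t by lra.
have t2' : 0 < 1 + t by lra.
set m := l / (1 - t); have m0 : 0 < m by rewrite divr_gt0.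
have mE : 2 * m - l = m * (1 + t) by rewrite /m; field; rewrite gt_eqF.
have ml : 0 < 2 * m - l by rewrite mE mulr_gt0.
transitivity (m `^ a * m `^ a / (Gamma a * l `^ a) * gamma_int a (2 * m - l)).
  rewrite -RintegralZl//; last exact: gamma_fun_integrable.
  apply: eq_Rintegral => x; rewrite inE /= in_itv /= andbT => x0.
  by rewrite -expr2 kernel_sqr.
rewrite gamma_int_scale// -Gamma_int.
have -> : 1 - t ^+ 2 = (1 - t) * (1 + t) by ring.
have lE : l = m * (1 - t) by rewrite /m divfK// gt_eqF.
clearbody m; rewrite mE {1}lE (powRM _ (ltW m0) (ltW t1')) (powRM _ (ltW m0) (ltW t2')).
rewrite (powRM _ (ltW t1') (ltW t2')).
have G := Gamma_gt0 a0.
have ma : 0 < m `^ a by rewrite powR_gt0.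
have p1 : 0 < (1 - t) `^ a by rewrite powR_gt0.
have p2 : 0 < (1 + t) `^ a by rewrite powR_gt0.
by field; rewrite !gt_eqF.
Qed.

Lemma ip_kernel_laguerre_fun l t n : 0 < l -> `|t| < 1 ->
  ip mu D (kernel l (l / (1 - t))) (laguerre_fun l n) = laguerre_norm n * t ^+ n.
Proof.
move=> l0; rewrite ltr_norml => /andP[t1 t2].
have t1' : 0 < 1 - t by lra.
set m := l / (1 - t); have m0 : 0 < m by rewrite divr_gt0.
have -> : t = 1 - l / m by rewrite /m; field; rewrite !gt_eqF.
rewrite -(laguerre_gamma_density a0 _ _ m0) -RintegralZl//; last first.
  exact: gamma_density_poly_integrable.
apply: eq_Rintegral => x; rewrite inE /= in_itv /= andbT => x0.
rewrite /kernel /laguerre_fun; have r0 := root_density_gt0 l0 x0.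
by field; rewrite gt_eqF.
Qed.

Lemma half_lt_div l t : 0 < l -> `|t| < 1 -> l / 2 < l / (1 - t).
Proof.
move=> l0; rewrite ltr_norml => /andP[t1 t2]; rewrite ltr_pM2l// ltf_pV2 ?posrE; lra.
Qed.

(** The Fourier coefficients of the kernel exhaust its norm by the binomial
    series, so Parseval turns the pairing with any [v] into a power series. *)
Lemma expansion l t v : 0 < l -> `|t| < 1 -> sqint mu D v ->
  pseries (fun n => laguerre_norm n * ip mu D v (laguerre_fun l n)) t @ \oo -->
  ip mu D v (kernel l (l / (1 - t))).
Proof.
move=> l0 t1 sv; have sk := kernel_sqint l0 (half_lt_div l0 t1).
have := @ip_parseval _ _ _ mu D mD (laguerre_fun l) v _ (laguerre_fun_orthonormal l0) sv sk.
rewrite kernel_norm// => H; have t2 : 0 <= t ^+ 2 < 1.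
  by rewrite sqr_ge0 /= -(real_normK (num_real t)) exprn_ilt1.
have {}H := H _.
have C := binomial_series t2.
have E1 : (fun n => \sum_(j < n) ip mu D (kernel l (l / (1 - t))) (laguerre_fun l j) ^+ 2)
   = (fun N => \sum_(n < N) pochhammer a n / n`!%:R * (t ^+ 2) ^+ n).
  apply/funext => n; apply: eq_bigr => j _.
  by rewrite ip_kernel_laguerre_fun// exprMn laguerre_norm_sqr -!exprM mulnC.
rewrite E1 in H; have := H C.
apply: cvg_trans; apply: near_eq_cvg; apply: nearW => n.
rewrite /pseries /series /= big_mkord; apply: eq_bigr => j _.
by rewrite ip_kernel_laguerre_fun//; ring.
Qed.

(** By [2 |p q| <= p^2 + q^2], the terms are dominated by the given series plus
    the binomial series in [x ^+ 2]. *)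
Lemma square_summable_abs_cvg_disc (b : R^nat) : cvgn (series (fun n => b n ^+ 2)) ->
  abs_cvg_disc (fun n => laguerre_norm n * b n) 1.
Proof.
move=> cb x /andP[x0 x1].
have x2 : 0 <= x ^+ 2 < 1 by rewrite sqr_ge0 /= exprn_ilt1.
have C := binomial_series x2.
pose c n := b n ^+ 2 + pochhammer a n / n`!%:R * (x ^+ 2) ^+ n.
apply: (@series_le_cvg R _ c) => [n|n|n|].
- by rewrite mulr_ge0// exprn_ge0.
- by rewrite addr_ge0 ?sqr_ge0// -laguerre_norm_sqr mulr_ge0 ?sqr_ge0// exprn_ge0// sqr_ge0.
- rewrite /c /= normrM (gtr0_norm (laguerre_norm_gt0 n)) -laguerre_norm_sqr -exprM mulnC exprM -exprMn.
  rewrite -(real_normK (num_real (b n))).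
  have := sqr_ge0 (`|b n| - laguerre_norm n * x ^+ n).
  have := mulr_ge0 (mulr_ge0 (ltW (laguerre_norm_gt0 n)) (normr_ge0 (b n))) (exprn_ge0 n x0).
  by rewrite sqrrB; lra.
rewrite (_ : series c = series (fun n => b n ^+ 2) +
   (fun N => \sum_(n < N) pochhammer a n / n`!%:R * (x ^+ 2) ^+ n)).
  by apply: is_cvgD => //; apply/cvg_ex; eexists; exact: C.
apply/funext => N; rewrite /series /= fctE !big_mkord /c big_split.
by [].
Qed.

End KernelExpansion.

(** * Uniqueness of Laplace transforms *)

Section LaplaceUniqueness.
Variable R : realType.
Local Notation mu := (@lebesgue_measure R).
Local Notation D := (`]0, +oo[%classic : set R).
Implicit Types (w : R -> R) (c x z : R) (n m k : nat) (p : {poly R}).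

Let mD : measurable (D : set (measurableTypeR R)).
Proof. exact: measurable_itv. Qed.

Lemma bernoulli_ge z m : 0 <= z <= 1 -> 1 - m%:R * z <= (1 - z) ^+ m.
Proof.
move=> /andP[z0 z1]; elim: m => [|m IH]; first by rewrite mul0r subr0 expr0.
rewrite exprS; apply: le_trans (ler_wpM2l _ IH); last by rewrite subr_ge0.
have := mulr_ge0 (ler0n R m) (sqr_ge0 z); rewrite -natr1 expr2; lra.
Qed.

Lemma bernoulli_le z m : 0 <= z <= 1 -> (1 - z) ^+ m * (1 + m%:R * z) <= 1.
Proof.
move=> /andP[z0 z1]; elim: m => [|m IH]; first by rewrite mul0r addr0 expr0 mulr1.
rewrite exprSr -mulrA; apply: le_trans IH; rewrite ler_wpM2l ?exprn_ge0 ?subr_ge0//.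
have := mulr_ge0 (ler0n R m) (sqr_ge0 z); have := sqr_ge0 z; rewrite -natr1 !expr2; lra.
Qed.

(** Polynomials that, at [exp (-x)], approach the indicator function of
    [x <= c]; the exponent is the integer just above [exp (c n)]. *)
Definition step_poly c n : {poly R} :=
  1 - (1 - 'X^n) ^+ (Num.truncn (expR (c * n%:R))).+1.

Lemma step_polyE c n z :
  (step_poly c n).[z] = 1 - (1 - z ^+ n) ^+ (Num.truncn (expR (c * n%:R))).+1.
Proof. by rewrite /step_poly !hornerE. Qed.

Lemma expRNM x n : expR (- x) ^+ n = expR (- (x * n%:R)).
Proof. by rewrite -expRM_natr mulNr. Qed.

Lemma step_poly_itv c n x : 0 < x -> 0 <= (step_poly c n).[expR (- x)] <= 1.
Proof.
move=> x0; rewrite step_polyE.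
have z1 : 0 <= 1 - expR (- x) ^+ n <= 1.
  rewrite subr_ge0 lerBlDr lerDl exprn_ge0 ?expR_ge0// andbT.
  by rewrite exprn_ile1 ?expR_ge0// -expR0 ler_expR lerNl oppr0 ltW.
move: z1 => /andP[z0 z1].
by rewrite subr_ge0 exprn_ile1//= lerBlDr lerDl exprn_ge0.
Qed.

(** In the variable [z = exp (-x)], the power [(1 - z^n)^m] is at least
    [1 - m z^n] and at most [1 / (m z^n)]; for [m] close to [exp (c n)] it
    tends to [0] or to [1] according as [x] is below or above [c]. *)
Lemma step_poly_cvg c x : 0 < x -> x != c ->
  (fun n => (step_poly c n).[expR (- x)]) @ \oo --> ((x <= c)%R%:R : R).
Proof.
move=> x0 xc; set m := fun n => (Num.truncn (expR (c * n%:R))).+1.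
have mle n : (m n)%:R <= expR (c * n%:R) + 1.
  by rewrite /m -natr1 lerD2r Num.Theory.truncn_le expR_ge0.
have mge n : expR (c * n%:R) <= (m n)%:R by rewrite ltW// truncnS_gt.
have z01 n : 0 <= expR (- x) ^+ n <= 1.
  rewrite exprn_ge0 ?expR_ge0//= exprn_ile1 ?expR_ge0//.
  by rewrite expR_le1 oppr_le0 ltW.
have cvg0 q : 0 < q -> expR (- q) ^+ n @[n --> \oo] --> (0 : R).
  by move=> q0; apply: cvg_expr; rewrite ger0_norm ?expR_ge0// expR_lt1 oppr_lt0.
have [xc'|cx'] := leP x c.
  have {xc'}xc : 0 < c - x by rewrite subr_gt0 lt_neqAle xc.
  apply: (@squeeze_cvgr _ _ _ _ (fun n => 1 - expR (- (c - x)) ^+ n) (fun=> 1)); last 2 first.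
  - have /= := @cvgB R R^o _ _ _ _ _ _ _ (@cvg_cst R^o 1 _ _ _) (cvg0 _ xc).
    by rewrite subr0; exact.
  - exact: cvg_cst.
  apply: nearW => n; have /andP[_ ->] := step_poly_itv c n x0; rewrite andbT.
  rewrite step_polyE -/(m n) lerD2l lerN2.
  have z0 : 0 < expR (- x) ^+ n by rewrite exprn_gt0// expR_gt0.
  have := bernoulli_le (m n) (z01 n).
  set A := (1 - _) ^+ _ => hA.
  have A0 : 0 <= A by rewrite exprn_ge0// subr_ge0; case/andP: (z01 n).
  have : A * (expR (c * n%:R) * expR (- x) ^+ n) <= 1.
    apply: le_trans hA; rewrite ler_wpM2l// ler_wpDl// ler_wpM2r//; exact: ltW.
  rewrite !expRNM -expRD => h.
  have -> : - ((c - x) * n%:R) = - (c * n%:R - x * n%:R) by ring.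
  by rewrite expRN -[leRHS]mul1r ler_pdivlMr ?expR_gt0.
have {cx'}cx : 0 < x - c by rewrite subr_gt0.
apply: (@squeeze_cvgr _ _ _ _ (fun=> 0)
   (fun n => expR (- (x - c)) ^+ n + expR (- x) ^+ n)); last 2 first.
- exact: cvg_cst.
- have /= := @cvgD R R^o _ _ _ _ _ _ _ (cvg0 _ cx) (cvg0 _ x0).
  by rewrite addr0; exact.
apply: nearW => n; have /andP[-> _] /= := step_poly_itv c n x0.
rewrite step_polyE -/(m n) lerBlDr -lerBlDl; apply: le_trans (bernoulli_ge (m n) (z01 n)).
rewrite lerD2l lerN2; apply: (@le_trans _ _ ((expR (c * n%:R) + 1) * expR (- x) ^+ n)).
  by rewrite ler_wpM2r//; case/andP: (z01 n).
rewrite mulrDl mul1r !expRNM -expRD lerD2r.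
by rewrite (_ : _ + _ = - ((x - c) * n%:R))//; ring.
Qed.

Lemma measurable_expRN_poly p : measurable_fun D (fun x => p.[expR (- x)]).
Proof.
apply: continuous_measurable_pos => x _.
apply: (@continuous_comp _ _ _ (fun x => expR (- x)) (fun y => p.[y])); last first.
  exact: continuous_horner.
apply: (@continuous_comp _ _ _ (fun x => - x) (@expR R)); last exact: continuous_expR.
exact: oppr_continuous.
Qed.

Lemma integrable_bounded_mul w (f : R -> R) : mu.-integrable D (EFin \o w) ->
  measurable_fun D f -> (forall x, 0 < x -> `|f x| <= 1) ->
  mu.-integrable D (EFin \o (fun x => w x * f x)).
Proof.
move=> iw mf f1; have mw := measurable_int _ iw.
apply: (le_integrable mD _ _ iw) => [|x] /=.
  by apply/measurable_EFinP/measurable_funM => //; apply/measurable_EFinP.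
by rewrite in_itv /= andbT => x0; rewrite lee_fin normrM ler_piMr// f1.
Qed.

Lemma laplace_poly_eq0 w p : mu.-integrable D (EFin \o w) ->
  (forall k, \int[mu]_(x in D) (w x * expR (- x) ^+ k) = 0) ->
  (\int[mu]_(x in D) (w x * p.[expR (- x)])%:E)%E = 0%E.
Proof.
move=> iw w0; have gi k : mu.-integrable D (EFin \o (fun x => w x * expR (- x) ^+ k)).
  apply: integrable_bounded_mul => // [|x x0].
    have := measurable_expRN_poly 'X^k.
    by rewrite (_ : (fun x => 'X^k.[_]) = fun x => expR (- x) ^+ k)//; apply/funext => x; rewrite hornerXn.
  rewrite ger0_norm ?exprn_ge0 ?expR_ge0// exprn_ile1 ?expR_ge0//.
  by rewrite expR_le1 oppr_le0 ltW.
have fi k := integrable_mulrl p`_k mD (gi k).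
rewrite (@eq_integral _ _ _ mu D (fun x =>
    (\sum_(k < size p) p`_k * (w x * expR (- x) ^+ k))%:E)) => [|x _]; last first.
  by rewrite horner_coef mulr_sumr; congr EFin; apply: eq_bigr => k _; ring.
rewrite -(fineK (integrable_fin_num mD (integrable_sumr mD (size p) fi))); congr EFin.
rewrite [LHS](Rintegral_sumr mD (size p) fi) big1// => k _.
by rewrite RintegralZl// w0 mulr0.
Qed.

(** Uniqueness for Laplace transforms, from their values at the integers:
    testing [w] against polynomials in [exp (-x)] that tend to the indicator
    function of a half-line shows that its primitive vanishes. *)
Theorem laplace_unique w : mu.-integrable D (EFin \o w) ->
  (forall k, \int[mu]_(x in D) (w x * expR (- x) ^+ k) = 0) ->
  ae_eq mu D w (fun=> 0).
Proof.
move=> iw w0; have mw : measurable_fun D w by apply/measurable_EFinP; case/integrableP : iw.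
have half c : (\int[mu]_(x in D) (w x * (x <= c)%R%:R)%:E)%E = 0%E.
  have mi : measurable_fun D (fun x => (x <= c)%R%:R : R).
    have -> : (fun x => (x <= c)%R%:R : R) = \1_(`]-oo, c]%classic : set R).
      by apply/funext => x; rewrite indicE mem_setE in_itv.
    exact: measurable_indic.
  have [] := @dominated_convergence _ _ _ mu D mD
    (fun n x => (w x * (step_poly c n).[expR (- x)])%:E)
    (fun x => (w x * (x <= c)%R%:R)%:E) (fun x => `|w x|%:E).
  - move=> n; apply/measurable_EFinP/measurable_funM => //; exact: measurable_expRN_poly.
  - exact/measurable_EFinP/measurable_funM.
  - exists [set c]; split; [exact: measurable_set1|exact: lebesgue_measure_set1|].
    move=> x /= h; apply: contrapT => xc; apply: h; rewrite in_itv /= andbT => x0.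
    apply: cvg_EFin; first exact: nearW.
    by apply: cvgMl_tmp; apply: step_poly_cvg => //; exact/eqP.
  - have := integrable_norm iw; by [].
  - apply: aeW => x n /=; rewrite in_itv /= andbT => x0.
    have /andP[s0 s1] := step_poly_itv c n x0.
    by rewrite lee_fin normrM (ger0_norm s0) ler_piMr.
  - move=> _ _; rewrite (_ : (fun n => _) = (fun=> 0%E)); last first.
      by apply/funext => n; exact: laplace_poly_eq0.
    by move=> /(cvg_lim (@ereal_hausdorff R)) <-; rewrite lim_cst.
pose v := w \_ D.
have iv : mu.-integrable setT (EFin \o v).
  have := (@integrable_mkcond _ _ _ mu D (EFin \o w) mD).1 iw.
  by apply: eq_integrable => // x _; rewrite /v restrict_EFin.
have F0 y : \int[mu]_(x in `]-oo, y]) v x = 0.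
  rewrite Rintegral_mkcond.
  rewrite (_ : v \_ _ = (fun x => w x * (x <= y)%R%:R) \_ D); last first.
    apply/funext => x; rewrite /v !patchE !mem_setE !in_itv /=.
    by case: ifP; case: ifP; rewrite ?mulr1 ?mulr0.
  by rewrite -Rintegral_mkcond /Rintegral half.
have := FTC1Ny _ (open_integrable_locally openT iv).
have iv' y : mu.-integrable `]-oo, y] (EFin \o v) by apply: integrableS iv.
move=> /(_ iv').
apply: filterS; first exact: (ae_filter_ringOfSetsType mu).
move=> x [_ h] Dx; move: h.
rewrite (_ : (fun x => _) = cst 0); last by apply/funext => y; exact: F0.
by rewrite derive1_cst /v patchE mem_set.
Qed.

End LaplaceUniqueness.

(** * Unbiased estimators *)

Section Assembly.
Variable R : realType.
Local Notation mu := (@lebesgue_measure R).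
Local Notation D := (`]0, +oo[%classic : set R).
Local Notation C := R[i].
Local Notation cdiff f z := (differentiable (f : C^o -> C^o) (z : C^o)).
Variables (a : R) (a0 : 0 < a).
Implicit Types (l m x t c : R) (n j k : nat) (h u v T psi : R -> R).

Let mD : measurable (D : set (measurableTypeR R)).
Proof. exact: measurable_itv. Qed.

Lemma holomorphic_cdiff (H : R[i] -> R[i]) :
  holomorphic_on (@right_half_plane R) H <->
  forall z, 0 < complex.Re z -> cdiff H z.
Proof.
split=> [dH z z0|dH K z z0].
  exact: (@derivable1_diffP (R[i] : numFieldType) (R[i]^o) H z).1 (dH z z0).
exact: (@derivable1_diffP (R[i] : numFieldType) (R[i]^o) H z).2 (dH z z0).
Qed.

Lemma nneseries_lty (f : R^nat) : (forall n, 0 <= f n) ->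
  (\sum_(0 <= n <oo) (f n)%:E < +oo)%E <-> cvgn (series f).
Proof.
move=> f0; have f0' n : (0 <= n)%N -> xpredT n -> (0 <= (f n)%:E)%E.
  by move=> _ _; rewrite lee_fin.
have cv := is_cvg_nneseries f0'.
have E : (fun N => (\sum_(0 <= n < N) (f n)%:E)%E) = EFin \o series f.
  by apply/funext => N; rewrite sumEFin.
split=> [fy|cf].
  have fin : (\sum_(0 <= n <oo) (f n)%:E)%E \is a fin_num.
    by rewrite ge0_fin_numE// nneseries_ge0.
  apply/cvg_ex; exists (fine (\sum_(0 <= n <oo) (f n)%:E)%E).
  have cv' : (EFin \o series f) @ \oo --> (fine (\sum_(0 <= n <oo) (f n)%:E)%E)%:E.
    by rewrite fineK// -E.
  by move/fine_cvg : cv'; apply.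
suff -> : (\sum_(0 <= n <oo) (f n)%:E)%E = (limn (series f))%:E by rewrite ltry.
by rewrite E; apply: cvg_lim => //; apply: cvg_EFin => //; exact: nearW.
Qed.

(** If the positive and the negative part both have infinite integral then the
    integral is [+oo - +oo = -oo], so a finite value bounds both parts. *)
Lemma fin_num_integrable (f : R -> R) : measurable_fun D f ->
  (\int[mu]_(x in D) (f x)%:E)%E \is a fin_num -> mu.-integrable D (EFin \o f).
Proof.
move=> mf; have mf' : measurable_fun D (EFin \o f) by exact/measurable_EFinP.
rewrite integralE fin_numB => /andP[p n].
apply/integrableP; split => //.
rewrite -[X in integral _ _ X]/(abse \o (EFin \o f)) fune_abse.
rewrite ge0_integralD//; [|exact: measurable_funepos|exact: measurable_funeneg].
by rewrite lte_add_pinfty// ltey_eq ?p ?n.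
Qed.

Lemma expect_integrable l psi c : measurable_fun D psi -> expect a l psi = c%:E ->
  mu.-integrable D (EFin \o (fun x => gamma_density a l x * psi x)).
Proof.
move=> mpsi e; apply: fin_num_integrable; last by rewrite -/(expect a l psi) e.
by apply: measurable_funM => //; exact: gamma_density_measurable.
Qed.

Lemma L2_sqint l u : 0 < l -> L2 a l u <->
  measurable_fun D u /\ sqint mu D (fun x => root_density a l x * u x).
Proof.
move=> l0; have c0 : 0 < l `^ a / Gamma a by rewrite divr_gt0 ?powR_gt0// Gamma_gt0.
have E : measurable_fun D u ->
    (\int[mu]_(x in D) ((root_density a l x * u x) ^+ 2)%:E =
    (l `^ a / Gamma a)%:E * \int[mu]_(x in D)
      (x `^ (a - 1) * expR (- (l * x)) * u x ^+ 2)%:E)%E.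
  move=> mu'; rewrite -ge0_integralZl_EFin//.
  - apply: eq_integral => x _; rewrite -EFinM; congr EFin.
    by rewrite exprMn root_density_sqr// gamma_densityE /gamma_fun; ring.
  - by move=> x _; rewrite lee_fin mulr_ge0 ?sqr_ge0//; exact: (gamma_fun_ge0 a l x).
  - apply/measurable_EFinP/measurable_funM; last exact: measurable_funX.
    exact: (gamma_fun_measurable a l).
  - exact: ltW.
split=> [[mu' u2]|[mu' [_ u2]]]; split => //.
  split; first by apply: measurable_funM => //; exact: root_density_measurable.
  by rewrite E// lte_mul_pinfty// lee_fin ltW.
move: u2; rewrite E//; set J := integral _ _ _; rewrite !ltey.
by apply: contra => /eqP ->; rewrite mulry gtr0_sg// mul1e.
Qed.

Lemma ip_root_density l m psi : 0 < l ->
  ip mu D (fun x => root_density a l x * psi x) (kernel a l m) =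
  \int[mu]_(x in D) (gamma_density a m x * psi x).
Proof.
move=> l0; apply: eq_Rintegral => x; rewrite inE /= in_itv /= andbT => x0.
by rewrite /kernel; field; rewrite gt_eqF// root_density_gt0.
Qed.

(** The pairing of [root_density * u] with the kernel is [E_m u], that is,
    [h m]. *)
Lemma unbiased_expansion h u l t : unbiased a h u -> L2 a l u -> 0 < l -> `|t| < 1 ->
  pseries (fun n => laguerre_norm a n *
    ip mu D (fun x => root_density a l x * u x) (laguerre_fun a l n)) t @ \oo -->
  h (l / (1 - t)).
Proof.
move=> [_ ub] uL l0 t1; have [_ su] := (L2_sqint u l0).1 uL.
have m0 : 0 < l / (1 - t).
  by rewrite divr_gt0// subr_gt0 (le_lt_trans (ler_norm t)).
have -> : h (l / (1 - t)) =
    ip mu D (fun x => root_density a l x * u x) (kernel a l (l / (1 - t))).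
  by rewrite ip_root_density// /Rintegral -/(expect _ _ _) ub.
exact: expansion.
Qed.

(** [lambda d^n/dlambda^n (lambda^(n-1) h)] is [n!] times the [n]-th Taylor
    coefficient of [t |-> h (l / (1 - t))] at [0]. *)
Lemma beta_coef_sqr h (H : R[i] -> R[i]) l (b : R^nat) n : 0 < l ->
  (forall z, 0 < complex.Re z -> cdiff H z) ->
  (forall x, 0 < x -> H x%:C = (h x)%:C) ->
  (forall t, `|t| < 1 -> pseries b t @ \oo --> h (l / (1 - t))) ->
  beta_coef a h n l ^+ 2 = (b n / laguerre_norm a n) ^+ 2.
Proof.
move=> l0 dH Hh bh; rewrite /beta_coef (derive1n_moebius n l0 dH Hh bh).
have pn := pochhammer_gt0 n a0.
have fn : 0 < n`!%:R :> R by rewrite ltr0n fact_gt0.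
rewrite exprMn expr_div_n sqrr_sign sqr_sqrtr; last by rewrite mulr_ge0// ltW.
rewrite expr_div_n laguerre_norm_sqr// exprMn.
by field; rewrite !gt_eqF.
Qed.

Lemma ip_sqr_summable l v : 0 < l -> sqint mu D v ->
  cvgn (series (fun n => ip mu D v (laguerre_fun a l n) ^+ 2)).
Proof.
move=> l0 sv; apply: nondecreasing_is_cvgn.
  by apply: nondecreasing_series => n _ _; exact: sqr_ge0.
exists (ip mu D v v) => _ [n _ <-]; rewrite /series /= big_mkord.
by apply: bessel => //; exact: laguerre_fun_orthonormal.
Qed.

(** The Fourier coefficients of [root_density * u] are the [beta_coef] up to
    sign, hence square summable by Bessel; this is also what makes the
    expansions of [h] converge on the whole unit disc. *)
Lemma estimator_necessary h u : unbiased a h u -> L20 a u ->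
  (exists H : R[i] -> R[i], holomorphic_on (@right_half_plane R) H /\
     forall l, 0 < l -> H l%:C = (h l)%:C) /\
  (forall l, 0 < l -> (\sum_(0 <= n <oo) (beta_coef a h n l ^+ 2)%:E < +oo)%E).
Proof.
move=> ub uL; have uL' l : 0 < l -> L2 a l u by move=> l0; exact: (uL l l0).
pose b l n := laguerre_norm a n *
  ip mu D (fun x => root_density a l x * u x) (laguerre_fun a l n).
have sm l : 0 < l -> cvgn (series (fun n =>
    ip mu D (fun x => root_density a l x * u x) (laguerre_fun a l n) ^+ 2)).
  by move=> l0; apply: ip_sqr_summable => //; case: ((L2_sqint u l0).1 (uL' l l0)).
have bh l t : 0 < l -> `|t| < 1 -> pseries (b l) t @ \oo --> h (l / (1 - t)).
  by move=> l0 t1; apply: unbiased_expansion => //; exact: uL'.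
have [|H [dH Hh]] := @holomorphic_extension R h b _ bh.
  by move=> l l0; apply: square_summable_abs_cvg_disc => //; exact: sm.
split; first by exists H; split => //; exact/holomorphic_cdiff.
move=> l l0; apply/nneseries_lty => [n|]; first exact: sqr_ge0.
have E n := @beta_coef_sqr h H l (b l) n l0 dH Hh (fun t => bh l t l0).
rewrite (_ : (fun n => _) = (fun n =>
    ip mu D (fun x => root_density a l x * u x) (laguerre_fun a l n) ^+ 2)).
  exact: sm.
apply/funext => n; rewrite E /b mulrC mulKf// gt_eqF// laguerre_norm_gt0//.
Qed.

(** Completeness of the gamma family. Up to constants, the density with
    parameter [m0 + k] is [exp (- k x)] times that with parameter [m0], so that
    the expectations are Laplace transforms at the integers. *)
Lemma expectation_unique (M : R) u v : 0 <= M ->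
  (forall m, M < m -> mu.-integrable D (EFin \o (fun x => gamma_density a m x * u x))) ->
  (forall m, M < m -> mu.-integrable D (EFin \o (fun x => gamma_density a m x * v x))) ->
  (forall m, M < m -> \int[mu]_(x in D) (gamma_density a m x * u x) =
    \int[mu]_(x in D) (gamma_density a m x * v x)) ->
  ae_eq mu D u v.
Proof.
move=> M0 iu iv uv; pose m0 := M + 1.
have mk k : M < m0 + k%:R by rewrite /m0 -addrA ltrDl ltr_wpDr.
have mk0 k : 0 < m0 + k%:R := le_lt_trans M0 (mk k).
have ck k : 0 < (m0 + k%:R) `^ a / Gamma a by rewrite divr_gt0 ?powR_gt0// Gamma_gt0.
pose w x := gamma_fun a m0 x * (u x - v x).
have wE k x : w x * expR (- x) ^+ k = ((m0 + k%:R) `^ a / Gamma a)^-1 *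
    (gamma_density a (m0 + k%:R) x * u x - gamma_density a (m0 + k%:R) x * v x).
  have -> : w x * expR (- x) ^+ k = gamma_fun a (m0 + k%:R) x * (u x - v x).
    have e : expR (- ((m0 + k%:R) * x)) = expR (- (m0 * x)) * expR (- x) ^+ k.
      by rewrite expRNM -expRD; congr expR; ring.
    by rewrite /w /gamma_fun e; ring.
  rewrite -mulrBr gamma_densityE; move: (ck k); set c := _ / _ => c0.
  by field; rewrite gt_eqF.
have iuv k := integrableB mD (iu _ (mk k)) (iv _ (mk k)).
have iw : mu.-integrable D (EFin \o w).
  have := integrable_mulrl ((m0 + 0%:R) `^ a / Gamma a)^-1 mD (iuv 0%N).
  by apply: eq_integrable => // x _ /=; rewrite -wE expr0 mulr1.
have w0 k : \int[mu]_(x in D) (w x * expR (- x) ^+ k) = 0.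
  under eq_Rintegral do rewrite wE.
  rewrite RintegralZl//; last exact: iuv.
  by rewrite RintegralB// ?uv ?subrr ?mulr0//; [exact: iu|exact: iv].
have := laplace_unique iw w0; apply: filterS => x /= h Dx; have {h} := h Dx.
move: Dx; rewrite in_itv /= andbT => x0 /eqP.
rewrite mulf_eq0 subr_eq0 => /orP[|/eqP//].
by rewrite gt_eqF// mulr_gt0 ?powR_gt0 ?expR_gt0.
Qed.

(** The Riesz-Fischer function with the prescribed Fourier coefficients is an
    estimator that is unbiased for the parameters [m > l / 2] only. *)
Lemma local_estimator h (H : R[i] -> R[i]) l : 0 < l ->
  (forall z, 0 < complex.Re z -> cdiff H z) ->
  (forall x, 0 < x -> H x%:C = (h x)%:C) ->
  (\sum_(0 <= n <oo) (beta_coef a h n l ^+ 2)%:E < +oo)%E ->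
  exists u, [/\ measurable_fun D u,
    sqint mu D (fun x => root_density a l x * u x),
    forall m, l / 2 < m -> mu.-integrable D (EFin \o (fun x => gamma_density a m x * u x)) &
    forall m, l / 2 < m -> \int[mu]_(x in D) (gamma_density a m x * u x) = h m].
Proof.
move=> l0 dH Hh sb.
have [c hc] : exists c : R^nat, forall t, `|t| < 1 -> pseries c t @ \oo --> h (l / (1 - t)).
  apply: (@real_taylor R (fun z => H (l%:C / (1 - z))) (fun t => h (l / (1 - t)))) => // [z z1|t t1].
    have z0 : 1 - z != 0.
      apply/negP; rewrite subr_eq0 => /eqP z1'; move: z1; rewrite -z1'.
      by rewrite (normc_real 1) normr1 ltxx.
    apply: (@cdiff_comp _ (fun z => l%:C / (1 - z))).
      apply: cdiffM; first exact: cdiff_cst.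
      apply: (@cdiffV _ (fun z => 1 - z)) => //.
    by apply: dH; apply: lt_trans (moebius_half_plane l0 z1); rewrite divr_gt0.
  have t1' : 0 < 1 - t by rewrite subr_gt0 (le_lt_trans (ler_norm t)).
  by rewrite -Hh ?divr_gt0// rmorphM fmorphV rmorphB.
pose d n := c n / laguerre_norm a n.
have sd : cvgn (series (fun n => d n ^+ 2)).
  rewrite (_ : (fun n => _) = (fun n => beta_coef a h n l ^+ 2)).
    by apply/nneseries_lty => // n; exact: sqr_ge0.
  by apply/funext => n; rewrite (@beta_coef_sqr h H l c n).
have [v sv vd] := riesz_fischer mD (laguerre_fun_orthonormal a0 l0) sd.
pose u x := v x / root_density a l x.
have mu' : measurable_fun D u.
  by apply: measurable_funM; [case: sv|exact: root_density_inv_measurable].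
have uE x : 0 < x -> root_density a l x * u x = v x.
  by move=> x0; rewrite /u mulrC divfK// gt_eqF// root_density_gt0.
have su : sqint mu D (fun x => root_density a l x * u x).
  apply: sqr_integrable_sqint.
    by apply: measurable_funM => //; exact: root_density_measurable.
  have := sqint_sqr_integrable sv.
  apply: eq_integrable => // x; rewrite inE /= in_itv /= andbT => x0.
  by rewrite uE.
exists u; split => // m lm.
  have := sqint_mul mD su (kernel_sqint a0 l0 lm).
  apply: eq_integrable => // x; rewrite inE /= in_itv /= andbT => x0.
  by rewrite /kernel; congr EFin; field; rewrite gt_eqF// root_density_gt0.
have m0 : 0 < m by rewrite (lt_trans _ lm)// divr_gt0.
have t1 : `|1 - l / m| < 1.
  rewrite ltr_norml; apply/andP; split.
    by rewrite ltrBrDr -ltrBrDl opprK ltr_pdivrMr// -ltr_pdivrMl// mulrC.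
  by rewrite gtrBl divr_gt0.
have mE : l / (1 - (1 - l / m)) = m.
  by rewrite subKr invf_div mulrC divfK// gt_eqF.
rewrite -(ip_root_density m u l0) -{1}mE.
have := expansion a0 l0 t1 su; have := hc _ t1; rewrite mE => h1 h2.
apply: (norm_cvg_unique h2); apply: cvg_trans h1.
apply: near_eq_cvg; apply: nearW => n; congr (pseries _ _ _).
apply/funext => k.
have -> : ip mu D (fun x => root_density a l x * u x) (laguerre_fun a l k) = d k.
  rewrite -vd; apply: eq_Rintegral => x; rewrite inE /= in_itv /= andbT => x0.
  by rewrite uE.
by rewrite /d mulrC divfK// gt_eqF// laguerre_norm_gt0.
Qed.

Lemma ae_density_integral m u v : measurable_fun D u -> measurable_fun D v ->
  ae_eq mu D u v ->
  (\int[mu]_(x in D) (gamma_density a m x * u x)%:E =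
   \int[mu]_(x in D) (gamma_density a m x * v x)%:E)%E.
Proof.
move=> mu' mv uv; apply: ae_eq_integral => //.
- by apply/measurable_EFinP/measurable_funM => //; exact: gamma_density_measurable.
- by apply/measurable_EFinP/measurable_funM => //; exact: gamma_density_measurable.
- by apply: filterS uv => x h Dx; rewrite h.
Qed.

Lemma var_lty l u : 0 < l -> L2 a l u -> (var a l u < +oo)%E.
Proof.
move=> l0 uL; have [mu' su] := (L2_sqint u l0).1 uL.
rewrite /var; set c := fine _.
have s1 : sqint mu D (fun x => root_density a l x * 1).
  apply: sqr_integrable_sqint.
    by apply: measurable_funM => //; exact: root_density_measurable.
  have := gamma_density_moment_integrable a0 0 l0.
  by apply: eq_integrable => // x _ /=; rewrite expr0 -root_density_sqr//; congr EFin; ring.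
have [_] := sqintB mD su (sqintZ mD c s1).
congr (_ < _)%E; apply: eq_integral => x _; congr EFin.
by rewrite -root_density_sqr//; ring.
Qed.

(** By completeness the estimators of [local_estimator] for all [l] agree almost
    everywhere, so that one of them serves all parameters; and any unbiased
    estimator agrees with it almost everywhere, hence has the same variance. *)
Lemma estimator_sufficient h (H : R[i] -> R[i]) :
  (forall z, 0 < complex.Re z -> cdiff H z) ->
  (forall x, 0 < x -> H x%:C = (h x)%:C) ->
  (forall l, 0 < l -> (\sum_(0 <= n <oo) (beta_coef a h n l ^+ 2)%:E < +oo)%E) ->
  exists u, UMVUE a h u /\ L20 a u.
Proof.
move=> dH Hh sb.
have loc l (l0 : 0 < l) := local_estimator l0 dH Hh (sb l l0).
have half l : 0 < l -> l / 2 < l by move=> l0; lra.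
have [u [mu' _ iu hu]] := loc 1 ltr01.
(* All the local estimators have the same expectations for large parameters. *)
have ae l v : 0 < l -> measurable_fun D v ->
    (forall m, l / 2 < m -> mu.-integrable D (EFin \o (fun x => gamma_density a m x * v x))) ->
    (forall m, l / 2 < m -> \int[mu]_(x in D) (gamma_density a m x * v x) = h m) ->
    ae_eq mu D u v.
  move=> l0 mv iv hv.
  apply: (@expectation_unique (Num.max (1 / 2) (l / 2))).
  - by rewrite le_max divr_ge0.
  - by move=> m; rewrite gt_max => /andP[h1 _]; exact: iu.
  - by move=> m; rewrite gt_max => /andP[_ h2]; exact: iv.
  - by move=> m; rewrite gt_max => /andP[h1 h2]; rewrite hu// hv.
have uL : L20 a u.
  move=> l /= l0; have [v [mv sv iv hv]] := loc l l0.
  have uv := ae l v l0 mv iv hv.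
  apply/(L2_sqint u l0); split => //; split.
    by apply: measurable_funM => //; exact: root_density_measurable.
  case: sv => msv; congr (_ < _)%E; apply: ae_eq_integral => //.
  - by apply/measurable_EFinP/measurable_funX.
  - apply/measurable_EFinP/measurable_funX/measurable_funM => //.
    exact: root_density_measurable.
  - by apply: filterS uv => x e Dx; rewrite e.
have ub : unbiased a h u.
  split => // l l0; have [v [mv sv iv hv]] := loc l l0.
  have uv := ae l v l0 mv iv hv; rewrite /expect (ae_density_integral l mu' mv uv).
  rewrite -(hv l (half l l0)) /Rintegral fineK//.
  exact: (integrable_fin_num mD (iv l (half l l0))).
exists u; split; last exact: uL.
split; [exact: ub|by move=> l l0; apply: var_lty => //; exact: uL|].
move=> T [mT ubT] l l0.
have iT m : 0 < m -> mu.-integrable D (EFin \o (fun x => gamma_density a m x * T x)).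
  by move=> m0; exact: expect_integrable (ubT m m0).
have uT : ae_eq mu D u T.
  apply: (ae 1) => // m m2; have m0 : 0 < m by rewrite (lt_trans _ m2).
    exact: iT.
  by rewrite /Rintegral -/(expect _ _ _) ubT.
rewrite /var (ub.2 l l0) ubT// le_eqVlt; apply/orP; left; apply/eqP.
apply: (@ae_density_integral l (fun x => (u x - h l) ^+ 2) (fun x => (T x - h l) ^+ 2)).
- by apply: measurable_funX; apply: measurable_funB.
- by apply: measurable_funX; apply: measurable_funB.
- by apply: filterS uT => x e Dx; rewrite e.
Qed.

End Assembly.

Unset Implicit Arguments.

Theorem theorem2p2 (R : realType) (a : R) (ha : 0 < a) (h : R -> R) :
  (exists u : R -> R, UMVUE a h u /\ L20 a u) <->
  (exists H : R[i] -> R[i],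
     holomorphic_on (@right_half_plane R) H /\
     forall lambda : R, 0 < lambda -> H lambda%:C = (h lambda)%:C) /\
  (forall lambda : R, 0 < lambda ->
     (\sum_(0 <= n <oo) (beta_coef a h n lambda ^+ 2)%:E < +oo)%E).
Proof.
split=> [[u [[ub _ _] uL]]|[[H [dH Hh]] sb]]; first exact: estimator_necessary ub uL.
exact: (estimator_sufficient ha ((holomorphic_cdiff H).1 dH)).
Qed.
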